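(* For each infinite cardinal $\kappa\in On$ we have: (1) $\kappa\to(\kappa,\omega)$ (a result of Karagila); (2) if $\kappa$ is regular, then $\kappa\to(\kappa,\omega+1)$; (3) $Free(\kappa\mapsto[\kappa]^{<\omega},\kappa)$; (4) $FreeUnion(\kappa\mapsto[\kappa]^{<\omega},\omega)$; (5) $M(\kappa,\omega,n)\to B$.
   Context: The base theory is ZF (without the Axiom of Choice). $On$ is the class of ordinals, and $n$ denotes an arbitrary natural number. For an ordinal $\nu$, $\kappa\to(\kappa,\nu)$ means: for every $f:[\kappa]^2\to 2$ there is either a set $H\subset\kappa$ of cardinality $\kappa$ with $f$ constantly $0$ on $[H]^2$, or a set $H\subset\kappa$ of order type $\nu$ with $f$ constantly $1$ on $[H]^2$. $[\kappa]^{<\mu}$ is the set of subsets of $\kappa$ of cardinality less than $\mu$. Given a set mapping $F:\kappa\to[\kappa]^{<\mu}$, a set $X\subset\kappa$ is $F$-free iff $\alpha\notin F(\beta)$ for each $\{\alpha,\beta\}\in[X]^2$ (that is, for any two distinct $\alpha,\beta\in X$). $Free(\kappa\mapsto[\kappa]^{<\mu},\lambda)$ means that for each set mapping $F:\kappa\to[\kappa]^{<\mu}$ there is an $F$-free set $A\subset\kappa$ with $|A|=\lambda$. $FreeUnion(\kappa\mapsto[\kappa]^{<\mu},\lambda)$ means that for each set mapping $F:\kappa\to[\kappa]^{<\mu}$ the set $\kappa$ can be partitioned into $\lambda$-many $F$-free sets. A family $\mathcal A$ is $n$-almost disjoint iff $|A\cap B|<n$ for each $\{A,B\}\in[\mathcal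 A]^2$. A family $\mathcal A$ has property $B$ iff there is a set $X$ such that $X\cap A\ne\emptyset\ne A\setminus X$ for each $A\in\mathcal A$. $M(\kappa,\omega,n)\to B$ is the statement that every $n$-almost disjoint family $\mathcal A\subset[\kappa]^\omega$ has property $B$, where $[\kappa]^\omega$ is the set of countably infinite subsets of $\kappa$.
   Formalization: Clauses (2) and (3) are stated only for uncountable κ, because both fail for κ=ω: the constant colouring 1 refutes ω→(ω,ω+1), and F(n)={0,…,n−1} has no free set with two elements. Clauses (1), (4), (5) cover every infinite cardinal. *)

(* Defs.v *)
(* ZF is rendered semantically: "ZF proves S" is stated as "S holds in every
   model of ZF", for arbitrary (M, ∈) satisfying the first-order axioms; by
   Gödel's completeness theorem the two agree.  Separation and replacement are
   restricted to first-order formulas with parameters.  This restriction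
   matters: if they were postulated for arbitrary predicates M -> Prop, a choice
   principle of the metatheory would yield the axiom of choice inside M.
   Equality of the model is Leibniz equality. *)

Set Implicit Arguments.
Unset Strict Implicit.
Unset Printing Implicit Defensive.

Structure set_structure : Type := SetStructure {
  carrier :> Type;
  mem : carrier -> carrier -> Prop
}.

Declare Scope zf_scope.
Delimit Scope zf_scope with zf.
Open Scope zf_scope.
Notation "x ∈ y" := (mem x y) (at level 70, no associativity) : zf_scope.
Notation "x ∉ y" := (~ mem x y) (at level 70, no associativity) : zf_scope.

(* De Bruijn indices: a quantifier binds variable 0 and shifts the others. *)
Inductive formula : Type :=
| Mem (i j : nat)
| Eq (i j : nat)
| Bot
| Imp (p q : formula)
| And (p q : formula)
| Or (p q : formula)
| All (p : formula)
| Ex (p : formula).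

Definition scons {A : Type} (x : A) (e : nat -> A) (i : nat) : A :=
  match i with
  | O => x
  | S j => e j
  end.

Fixpoint sat (M : set_structure) (e : nat -> M) (p : formula) : Prop :=
  match p with
  | Mem i j => e i ∈ e j
  | Eq i j => e i = e j
  | Bot => False
  | Imp p q => sat e p -> sat e q
  | And p q => sat e p /\ sat e q
  | Or p q => sat e p \/ sat e q
  | All p => forall x : M, sat (scons x e) p
  | Ex p => exists x : M, sat (scons x e) p
  end.

Section Basic.
Context {M : set_structure}.
Implicit Types (a b f p s x y z : M).

Definition subset a b : Prop := forall x, x ∈ a -> x ∈ b.

Definition is_empty z : Prop := forall x, x ∉ z.

(* s = x ∪ {x} *)
Definition is_succ s x : Prop := forall z, z ∈ s <-> z ∈ x \/ z = x.

Definition is_one x : Prop := exists z, is_empty z /\ is_succ x z.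

Definition is_two x : Prop := exists z, is_one z /\ is_succ x z.

Definition is_inter c a b : Prop := forall x, x ∈ c <-> x ∈ a /\ x ∈ b.

(* p = {x, y} *)
Definition is_upair p x y : Prop := forall z, z ∈ p <-> z = x \/ z = y.

(* p = (x, y) = {{x}, {x, y}} *)
Definition is_opair p x y : Prop :=
  forall z, z ∈ p <-> is_upair z x x \/ is_upair z x y.

End Basic.

Record ZF (M : set_structure) : Prop := {
  zf_extensionality : forall x y : M, (forall z, z ∈ x <-> z ∈ y) -> x = y;
  zf_foundation : forall x : M, (exists y, y ∈ x) ->
    exists y, y ∈ x /\ forall z, z ∈ x -> z ∉ y;
  zf_pairing : forall x y : M, exists p, is_upair p x y;
  zf_union : forall x : M, exists u, forall z,
    z ∈ u <-> exists y, y ∈ x /\ z ∈ y;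
  zf_powerset : forall x : M, exists p, forall z, z ∈ p <-> subset z x;
  zf_infinity : exists w : M, (exists z, is_empty z /\ z ∈ w) /\
    forall x, x ∈ w -> exists s, is_succ s x /\ s ∈ w;
  zf_separation : forall (phi : formula) (e : nat -> M) (a : M),
    exists b, forall x, x ∈ b <-> x ∈ a /\ sat (scons x e) phi;
  zf_replacement : forall (phi : formula) (e : nat -> M) (a : M),
    (forall x y y', x ∈ a -> sat (scons x (scons y e)) phi ->
       sat (scons x (scons y' e)) phi -> y = y') ->
    exists b, forall y,
      y ∈ b <-> exists x, x ∈ a /\ sat (scons x (scons y e)) phi
}.

Section Functions.
Context {M : set_structure}.
Implicit Types (a b f p x y : M).

(* f(x) = y *)
Definition app f x y : Prop := exists p, is_opair p x y /\ p ∈ f.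

Definition function f a b : Prop :=
  (forall p, p ∈ f -> exists x y, x ∈ a /\ y ∈ b /\ is_opair p x y) /\
  (forall x, x ∈ a -> exists! y, app f x y).

Definition injection f a b : Prop :=
  function f a b /\
  (forall x x' y, app f x y -> app f x' y -> x = x').

Definition bijection f a b : Prop :=
  injection f a b /\
  (forall y, y ∈ b -> exists x, x ∈ a /\ app f x y).

(* |a| = |b| *)
Definition equipotent a b : Prop := exists f, bijection f a b.

(* |a| < |b| *)
Definition card_lt a b : Prop :=
  (exists f, injection f a b) /\ ~ equipotent a b.

End Functions.

Section Ordinals.
Context {M : set_structure}.
Implicit Types (a b c f h k m n w x y : M).

Definition ordinal a : Prop :=
  (forall x y, x ∈ a -> y ∈ x -> y ∈ a) /\
  (forall x, x ∈ a -> x ∉ x) /\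
  (forall x y z, x ∈ a -> y ∈ a -> z ∈ a -> x ∈ y -> y ∈ z -> x ∈ z) /\
  (forall x y, x ∈ a -> y ∈ a -> x ∈ y \/ x = y \/ y ∈ x) /\
  (forall b, subset b a -> (exists x, x ∈ b) ->
     exists x, x ∈ b /\ forall y, y ∈ b -> y = x \/ x ∈ y).

Definition natural n : Prop :=
  ordinal n /\
  forall m, m ∈ n \/ m = n -> is_empty m \/ exists x, is_succ m x.

Definition is_omega w : Prop := forall n, n ∈ w <-> natural n.

Definition infinite a : Prop := ~ exists n, natural n /\ equipotent a n.

Definition cardinal k : Prop :=
  ordinal k /\ forall a, a ∈ k -> ~ equipotent a k.

Definition infinite_cardinal k : Prop := cardinal k /\ infinite k.

Definition cofinal_map f a k : Prop :=
  function f a k /\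
  forall b, b ∈ k -> exists x y, x ∈ a /\ app f x y /\ (b = y \/ b ∈ y).

Definition is_cofinality c k : Prop :=
  ordinal c /\ (exists f, cofinal_map f c k) /\
  forall a, a ∈ c -> ~ exists f, cofinal_map f a k.

Definition regular k : Prop := infinite_cardinal k /\ is_cofinality k k.

(* The set h of ordinals, ordered by ∈, has order type a. *)
Definition has_order_type h a : Prop :=
  exists f, bijection f a h /\
    forall x x' y y', app f x y -> app f x' y' -> x ∈ x' -> y ∈ y'.

End Ordinals.

Section Combinatorics.
Context {M : set_structure}.
Implicit Types (a b c f h k l m n p s t x y : M).

(* p ∈ [a]^2 *)
Definition pair_of p a : Prop :=
  exists x y, x ∈ a /\ y ∈ a /\ x <> y /\ is_upair p x y.

(* s = [a]^2 *)
Definition is_pairs s a : Prop := forall p, p ∈ s <-> pair_of p a.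

Definition constant_on_pairs f h i : Prop :=
  forall p, pair_of p h -> app f p i.

(* k → (k, v) *)
Definition arrow k v : Prop :=
  forall zero one two s f : M,
    is_empty zero -> is_one one -> is_two two -> is_pairs s k ->
    function f s two ->
    (exists h, subset h k /\ equipotent h k /\ constant_on_pairs f h zero) \/
    (exists h, subset h k /\ has_order_type h v /\ constant_on_pairs f h one).

(* s = [k]^{<m} *)
Definition is_subsets_lt s k m : Prop :=
  forall x, x ∈ s <-> subset x k /\ card_lt x m.

Definition set_mapping f k m : Prop :=
  exists s, is_subsets_lt s k m /\ function f k s.

Definition free f x : Prop :=
  forall a b c, a ∈ x -> b ∈ x -> a <> b -> app f b c -> a ∉ c.

(* Free(k ↦ [k]^{<m}, l) *)
Definition Free k m l : Prop :=
  forall f, set_mapping f k m ->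
    exists a, subset a k /\ free f a /\ equipotent a l.

Definition partition t k : Prop :=
  (forall x, x ∈ t -> subset x k /\ exists a, a ∈ x) /\
  (forall x y a, x ∈ t -> y ∈ t -> a ∈ x -> a ∈ y -> x = y) /\
  (forall a, a ∈ k -> exists x, x ∈ t /\ a ∈ x).

(* FreeUnion(k ↦ [k]^{<m}, l) *)
Definition FreeUnion k m l : Prop :=
  forall f, set_mapping f k m ->
    exists t, partition t k /\ equipotent t l /\ forall x, x ∈ t -> free f x.

Definition almost_disjoint n s : Prop :=
  forall a b c, a ∈ s -> b ∈ s -> a <> b -> is_inter c a b -> card_lt c n.

Definition property_B s : Prop :=
  exists x, forall a, a ∈ s ->
    (exists y, y ∈ x /\ y ∈ a) /\ (exists y, y ∈ a /\ y ∉ x).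

(* M(k, m, n) → B *)
Definition M_to_B k m n : Prop :=
  forall s, (forall a, a ∈ s -> subset a k /\ equipotent a m) ->
    almost_disjoint n s -> property_B s.

End Combinatorics.

(* Main.v *)
(* No choice is available, so every construction has to be canonical; this is
   achieved by working with ordinals, finite sets of ordinals and definable
   class functions only.

   Finite sets of ordinals are well-ordered by comparing them at the largest
   element of their symmetric difference, and for an infinite ordinal d this
   gives an injection of the finite subsets of d into d.  Hence a set whose
   points y are determined by a finite set of earlier points and a parameter
   below d embeds into d.

   Given an operation sending finite sets to finite sets, every finite set p
   has a finite hull, and each point i gets a support, the least p whose hull
   contains i. For a set mapping F with finite values, only finitely many
   points of support at most that of i, say p, are joined to i: a smaller
   support that differs from p first at an infinite ordinal a would, together
   with the finite subsets of a, generate a set closed under F. So the points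
   form a partial order with finite lower sets in which joined points are
   comparable. The size of the lower set is then a colouring by natural numbers
   with free classes. For a free set of full size, either one of these classes,
   or one of the sets of points with the same strict lower set, works, or
   choosing for each level a large set of the latter kind and deleting the
   countably many points below them works; otherwise the coding would embed
   kappa into a smaller ordinal. The same hulls handle n-almost disjoint
   families: every A meets the union of the B that precede it in a finite set,
   so that one point of each remaining part of A gives a splitting set.

   For the partition relations, let e(y) consist of the x < y joined to y with
   e(x) = e(y) ∩ x.  Each e(y) ∪ {y} is a clique and each set {y | e(y) = s} is
   independent.  For kappa regular and uncountable, if every e(y) is finite
   and these independent sets are bounded, then the levels of the tree are
   bounded, a contradiction.  For kappa singular, one first passes to a set in
   which all degrees are small, and then glues cofinally many long independent
   sets, the existence of which again follows by coding. *)

(* Without choice, a successor cardinal need not be regular; it is even consistent, relative to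
   large cardinals, that every uncountable cardinal is singular. So a singular kappa cannot be
   approached through smaller regular ones. Nor need a union of few small sets be small: here it is
   shown small only when one ordinal below kappa bounds the order types of all its members, because
   a point is then coded by the least index of a member containing it and its position there. This
   is why size estimates are made with order types, and why the singular case sorts vertices by
   their degree before it unites neighbourhoods.

   The largest difference is the right place to compare finite sets because the sets up to p then
   consist of finitely many single ones and, for each infinite a in p, those that agree with p above
   a, omit a and are arbitrary below it. A hull should be finite, so the operation cannot be
   iterated to the end; instead each point of p pays for one step, and the union of the hulls over
   such a family is closed although no single hull is. *)
Require Import Defs.
From Stdlib Require Import Classical ClassicalEpsilon Arith Lia.

(** * Definability with parameters *)

Fixpoint mix {A : Type} (e r : nat -> A) (i : nat) : A :=
  match i with
  | 0 => e 0
  | 1 => r 0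
  | S (S j) => mix (fun k => e (S k)) (fun k => r (S k)) j
  end.

Lemma mix_even {A : Type} (e r : nat -> A) (i : nat) : mix e r (i + i) = e i.
Proof.
  revert e r; induction i as [|i IH]; intros e r; [reflexivity|].
  rewrite <- plus_n_Sm; simpl. now rewrite IH.
Qed.

Lemma mix_odd {A : Type} (e r : nat -> A) (i : nat) : mix e r (S (i + i)) = r i.
Proof.
  revert e r; induction i as [|i IH]; intros e r; [reflexivity|].
  rewrite <- plus_n_Sm.
  change (mix (fun k => e (S k)) (fun k => r (S k)) (S (i + i)) = r (S i)).
  now rewrite IH.
Qed.

Lemma parity_cases (j : nat) : exists i, j = i + i \/ j = S (i + i).
Proof.
  exists (Nat.div2 j). pose proof (Nat.div2_odd j) as H.
  destruct (Nat.odd j); simpl in H; lia.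
Qed.

Definition by_parity {A : Type} (f g : nat -> A) (j : nat) : A :=
  if Nat.even j then f (Nat.div2 j) else g (Nat.div2 j).

Lemma by_parity_even {A : Type} (f g : nat -> A) (i : nat) :
  by_parity f g (i + i) = f i.
Proof.
  unfold by_parity. replace (i + i) with (2 * i) by lia.
  now rewrite Nat.even_mul, Nat.div2_double.
Qed.

Lemma by_parity_odd {A : Type} (f g : nat -> A) (i : nat) :
  by_parity f g (S (i + i)) = g i.
Proof.
  unfold by_parity. replace (S (i + i)) with (S (2 * i)) by lia.
  rewrite Nat.div2_succ_double. rewrite Nat.even_succ, Nat.odd_mul. reflexivity.
Qed.

Definition up (f : nat -> nat) (i : nat) : nat :=
  match i with 0 => 0 | S j => S (f j) end.

Fixpoint rename (f : nat -> nat) (p : formula) : formula :=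
  match p with
  | Mem i j => Mem (f i) (f j)
  | Eq i j => Eq (f i) (f j)
  | Bot => Bot
  | Imp p q => Imp (rename f p) (rename f q)
  | And p q => And (rename f p) (rename f q)
  | Or p q => Or (rename f p) (rename f q)
  | All p => All (rename (up f) p)
  | Ex p => Ex (rename (up f) p)
  end.

Lemma sat_rename (M : set_structure) (p : formula) (f : nat -> nat) (e e' : nat -> M) :
  (forall i, e (f i) = e' i) -> sat e (rename f p) <-> sat e' p.
Proof.
  revert f e e'; induction p; intros f e e' H; simpl; rewrite ?H; try tauto.
  - rewrite (IHp1 f e e' H), (IHp2 f e e' H); tauto.
  - rewrite (IHp1 f e e' H), (IHp2 f e e' H); tauto.
  - rewrite (IHp1 f e e' H), (IHp2 f e e' H); tauto.
  - split; intros K x; specialize (K x);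
      apply (IHp (up f) (scons x e) (scons x e')); auto; intros [|i]; simpl; auto.
  - split; intros [x K]; exists x;
      apply (IHp (up f) (scons x e) (scons x e')); auto; intros [|i]; simpl; auto.
Qed.

(* Environments carry the free variables at even positions and the parameters
   at odd ones, so that parameters never interfere with binders. *)
Class Definable {M : set_structure} (P : (nat -> M) -> Prop) : Prop :=
  definable : exists phi r, forall e, P e <-> sat (mix e r) phi.

(** The language has no terms, so an operation is definable if its graph is; the value sits in
    variable 0 and the arguments move up by one. Constructions are functions [M -> M], and
    separation, replacement and recursion ask for such an instance. *)
Class DefinableTerm {M : set_structure} (t : (nat -> M) -> M) : Prop :=
  definable_term : Definable (fun e => e 0 = t (fun i => e (S i))).

Notation DefinableFun1 F :=
  (forall t, DefinableTerm t -> DefinableTerm (fun e => F (t e))).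
Notation DefinableFun2 F :=
  (forall t u, DefinableTerm t -> DefinableTerm u -> DefinableTerm (fun e => F (t e) (u e))).
Notation DefinableRel1 P :=
  (forall t, DefinableTerm t -> Definable (fun e => P (t e))).
Notation DefinableRel2 P :=
  (forall t u, DefinableTerm t -> DefinableTerm u -> Definable (fun e => P (t e) (u e))).
Notation Def1 P := (Definable (fun e => P (e 0))).
Notation Def2 P := (Definable (fun e => P (e 0) (e 1))).
Notation Fun1 F := (DefinableTerm (fun e => F (e 0))).
Notation Fun2 F := (DefinableTerm (fun e => F (e 0) (e 1))).

#[global] Hint Mode Definable - ! : typeclass_instances.
#[global] Hint Mode DefinableTerm - ! : typeclass_instances.

(** * Closure of definability under connectives, quantifiers and substitution *)

Section Definability.
Context {M : set_structure}.
Implicit Types (P Q : (nat -> M) -> Prop) (t u : (nat -> M) -> M).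

Lemma Definable_iff P Q : (forall e, P e <-> Q e) -> Definable P -> Definable Q.
Proof.
  intros H (phi & r & K); exists phi, r; intros e; rewrite <- H; apply K.
Qed.

Lemma Definable_rename P (f : nat -> nat) :
  Definable P -> Definable (fun e => P (fun i => e (f i))).
Proof.
  intros (phi & r & K).
  exists (rename (by_parity (fun i => f i + f i) (fun i => S (i + i))) phi), r; intros e.
  rewrite K. symmetry. apply sat_rename. intros j.
  destruct (parity_cases j) as [i [-> | ->]].
  - now rewrite by_parity_even, !mix_even.
  - now rewrite by_parity_odd, !mix_odd.
Qed.

Lemma Definable_binary (c : formula -> formula -> formula) (o : Prop -> Prop -> Prop) P Q :
  (forall e p q, sat (M := M) e (c p q) <-> o (sat e p) (sat e q)) ->
  (forall a b a' b', (a <-> a') -> (b <-> b') -> (o a b <-> o a' b')) ->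
  Definable P -> Definable Q -> Definable (fun e => o (P e) (Q e)).
Proof.
  intros Hc Ho (p & r & Kp) (q & s & Kq).
  (* The two parameter lists are interleaved: parameter i of the first formula becomes number
     [i + i] of [mix r s], that of the second number [S (i + i)]. *)
  exists (c (rename (by_parity (fun i => i + i) (fun i => S ((i + i) + (i + i)))) p)
            (rename (by_parity (fun i => i + i) (fun i => S (S (i + i) + S (i + i)))) q)),
         (mix r s).
  intros e. rewrite Hc. apply Ho.
  - rewrite Kp. symmetry. apply sat_rename. intros j.
    destruct (parity_cases j) as [i [-> | ->]].
    + now rewrite by_parity_even, !mix_even.
    + now rewrite by_parity_odd, !mix_odd, mix_even.
  - rewrite Kq. symmetry. apply sat_rename. intros j.
    destruct (parity_cases j) as [i [-> | ->]].
    + now rewrite by_parity_even, !mix_even.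
    + now rewrite by_parity_odd, !mix_odd.
Qed.

#[global] Instance Definable_and P Q :
  Definable P -> Definable Q -> Definable (fun e => P e /\ Q e).
Proof. apply (Definable_binary And); simpl; tauto. Qed.

#[global] Instance Definable_or P Q :
  Definable P -> Definable Q -> Definable (fun e => P e \/ Q e).
Proof. apply (Definable_binary Or or); simpl; tauto. Qed.

#[global] Instance Definable_imp P Q :
  Definable P -> Definable Q -> Definable (fun e => P e -> Q e).
Proof. apply (Definable_binary Imp (fun a b => a -> b)); simpl; tauto. Qed.

(** A binder pushes its value on the interleaved environment, while the formula for the body expects
    it pushed on the variables alone; the renaming mediates. *)
Lemma sat_quantifier_env (e r : nat -> M) (x : M) (phi : formula) :
  sat (scons x (mix e r))
      (rename (by_parity (fun i => match i with 0 => 0 | S k => S (k + k) end)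
                         (fun i => S (S (i + i)))) phi)
  <-> sat (mix (scons x e) r) phi.
Proof.
  apply sat_rename. intros j.
  destruct (parity_cases j) as [i [-> | ->]].
  - rewrite by_parity_even, mix_even. destruct i; simpl; [reflexivity|apply mix_even].
  - rewrite by_parity_odd, mix_odd. simpl. apply mix_odd.
Qed.

#[global] Instance Definable_all (Q : M -> (nat -> M) -> Prop) :
  Definable (fun e => Q (e 0) (fun i => e (S i))) -> Definable (fun e => forall x, Q x e).
Proof.
  intros (phi & r & K).
  eexists (All (rename _ phi)), r; intros e; simpl.
  split; intros H x; specialize (H x).
  - apply sat_quantifier_env, K. exact H.
  - apply (K (scons x e)), sat_quantifier_env. exact H.
Qed.

#[global] Instance Definable_ex (Q : M -> (nat -> M) -> Prop) :
  Definable (fun e => Q (e 0) (fun i => e (S i))) -> Definable (fun e => exists x, Q x e).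
Proof.
  intros (phi & r & K).
  eexists (Ex (rename _ phi)), r; intros e; simpl.
  split; intros [x H]; exists x.
  - apply sat_quantifier_env, K. exact H.
  - apply (K (scons x e)), sat_quantifier_env. exact H.
Qed.

Lemma Definable_mem_var (i j : nat) : inhabited M -> Definable (M := M) (fun e => e i ∈ e j).
Proof.
  intros [c]; exists (Mem (i + i) (j + j)), (fun _ => c); intros e; simpl.
  now rewrite !mix_even.
Qed.

Lemma Definable_eq_var (i j : nat) : inhabited M -> Definable (M := M) (fun e => e i = e j).
Proof.
  intros [c]; exists (Eq (i + i) (j + j)), (fun _ => c); intros e; simpl.
  now rewrite !mix_even.
Qed.

(** Formulas contain no terms, so a term is substituted by naming its value with a quantifier. *)
Lemma Definable_app1 (P : M -> Prop) t :
  Def1 P -> DefinableTerm t -> Definable (fun e => P (t e)).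
Proof.
  intros HP Ht.
  apply (Definable_iff (fun e => exists x, x = t e /\ P x)).
  - intros e; split; [intros (x & -> & H); exact H|eauto].
  - apply Definable_ex, Definable_and; [exact Ht|exact HP].
Qed.

Lemma Definable_app2 (P : M -> M -> Prop) t u :
  Def2 P -> DefinableTerm t -> DefinableTerm u -> Definable (fun e => P (t e) (u e)).
Proof.
  intros HP Ht Hu.
  apply (Definable_iff (fun e => exists y, y = u e /\ exists x, x = t e /\ P x y)).
  - intros e; split; [intros (y & -> & x & -> & H); exact H|eauto 6].
  - apply Definable_ex, Definable_and; [exact Hu|].
    apply (Definable_ex (fun x e => x = t (fun i => e (S i)) /\ P x (e 0))).
    apply Definable_and; [|exact HP].
    exact (Definable_rename _ (fun i => match i with 0 => 0 | S k => S (S k) end) Ht).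
Qed.

End Definability.

Existing Class ZF.

Section Terms.
Context {M : set_structure} {zf : ZF M}.
Implicit Types (P Q : (nat -> M) -> Prop) (t u v : (nat -> M) -> M).

Lemma carrier_inhabited : inhabited M.
Proof. destruct (zf_infinity zf) as [w _]. now constructor. Qed.

(** A metatheoretic proposition that ignores the environment is true or false, so a constant formula
    defines it, whatever its content. *)
#[global] Instance Definable_const (Q : Prop) : Definable (M := M) (fun _ => Q) | 1.
Proof.
  destruct carrier_inhabited as [c].
  destruct (classic Q) as [H|H].
  - exists (Imp Bot Bot), (fun _ => c); simpl; tauto.
  - exists Bot, (fun _ => c); simpl; tauto.
Qed.

#[global] Instance Definable_not P : Definable P -> Definable (fun e => ~ P e).
Proof. intros H; unfold not; exact _. Qed.

#[global] Instance Definable_equiv P Q :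
  Definable P -> Definable Q -> Definable (fun e => P e <-> Q e).
Proof. intros H K; unfold iff; exact _. Qed.

#[global] Instance DefinableTerm_var (i : nat) : DefinableTerm (M := M) (fun e => e i) | 0.
Proof. apply (Definable_eq_var 0 (S i) carrier_inhabited). Qed.

#[global] Instance DefinableTerm_const (c : M) : DefinableTerm (M := M) (fun _ => c) | 0.
Proof.
  exists (Eq 0 1), (fun _ => c); intros e; simpl; tauto.
Qed.

#[global] Instance Definable_mem t u :
  DefinableTerm t -> DefinableTerm u -> Definable (fun e => t e ∈ u e).
Proof.
  apply (Definable_app2 (fun x y => x ∈ y)). apply Definable_mem_var, carrier_inhabited.
Qed.

#[global] Instance Definable_eq t u :
  DefinableTerm t -> DefinableTerm u -> Definable (fun e => t e = u e).
Proof.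
  apply (Definable_app2 (fun x y => x = y)). apply Definable_eq_var, carrier_inhabited.
Qed.

Lemma DefinableTerm_app1 (F : M -> M) t :
  Fun1 F -> DefinableTerm t -> DefinableTerm (fun e => F (t e)).
Proof.
  intros HF Ht. unfold DefinableTerm.
  apply (Definable_app2 (fun x y => y = F x) (fun e => t (fun i => e (S i))) (fun e => e 0)).
  - exact (Definable_rename _ (fun i => match i with 0 => 1 | 1 => 0 | S k => S k end) HF).
  - exact (Definable_rename _ (fun i => match i with 0 => 0 | S k => S (S k) end) Ht).
  - exact _.
Qed.

Lemma DefinableTerm_app2 (F : M -> M -> M) t u :
  Fun2 F -> DefinableTerm t -> DefinableTerm u -> DefinableTerm (fun e => F (t e) (u e)).
Proof.
  intros HF Ht Hu. unfold DefinableTerm.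
  apply (Definable_iff (fun e => exists y, y = u (fun i => e (S i)) /\
    exists x, x = t (fun i => e (S i)) /\ e 0 = F x y)).
  - intros e; split; [intros (y & -> & x & -> & H); exact H|eauto 6].
  - apply Definable_ex, Definable_and.
    { exact (Definable_rename _ (fun i => match i with 0 => 0 | S k => S (S k) end) Hu). }
    apply (Definable_ex (fun x e => x = t (fun i => e (S (S i))) /\ e 1 = F x (e 0))).
    apply Definable_and.
    + exact (Definable_rename _ (fun i => match i with 0 => 0 | S k => S (S (S k)) end) Ht).
    + exact (Definable_rename _ (fun i => match i with 0 => 2 | 1 => 0 | 2 => 1 | S k => S k end) HF).
Qed.

(** This and the next lemmas serve bodies of binders, which keep an abstract environment behind
    their arguments; under further binders that environment reappears reindexed by some [g]. *)
Lemma DefinableTerm_tail0 t (g : nat -> nat) :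
  DefinableTerm t -> DefinableTerm (fun e => t (fun i => e (g i))).
Proof.
  exact (Definable_rename _ (fun i => match i with 0 => 0 | S k => S (g k) end)).
Qed.

Lemma DefinableTerm_tail1 (F : M -> (nat -> M) -> M) t (g : nat -> nat) :
  DefinableTerm (fun e => F (e 0) (fun i => e (S i))) -> DefinableTerm t ->
  DefinableTerm (fun e => F (t e) (fun i => e (g i))).
Proof.
  intros HF Ht. unfold DefinableTerm.
  apply (Definable_iff (fun e => exists x, x = t (fun i => e (S i)) /\ e 0 = F x (fun i => e (S (g i))))).
  - intros e; split; [intros (x & -> & H); exact H|eauto].
  - apply Definable_ex, Definable_and.
    + exact (Definable_rename _ (fun i => match i with 0 => 0 | S k => S (S k) end) Ht).
    + exact (Definable_rename _
        (fun i => match i with 0 => 1 | 1 => 0 | S (S k) => S (S (g k)) end) HF).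
Qed.

Lemma DefinableTerm_tail2 (F : M -> M -> (nat -> M) -> M) t u (g : nat -> nat) :
  DefinableTerm (fun e => F (e 0) (e 1) (fun i => e (S (S i)))) ->
  DefinableTerm t -> DefinableTerm u -> DefinableTerm (fun e => F (t e) (u e) (fun i => e (g i))).
Proof.
  intros HF Ht Hu.
  refine (DefinableTerm_tail1 (fun x e => F x (u e) (fun i => e (g i))) t (fun i => i) _ Ht).
  refine (DefinableTerm_tail1 (fun y e => F (e 0) y (fun i => e (S (g i))))
            (fun e => u (fun i => e (S i))) (fun i => i) _ _).
  - exact (Definable_rename _
      (fun i => match i with 0 => 0 | 1 => 2 | 2 => 1 | S (S (S k)) => S (S (S (g k))) end) HF).
  - exact (DefinableTerm_tail0 u S Hu).
Qed.

Lemma Definable_tail1 (P : M -> (nat -> M) -> Prop) t (g : nat -> nat) :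
  Definable (fun e => P (e 0) (fun i => e (S i))) -> DefinableTerm t ->
  Definable (fun e => P (t e) (fun i => e (g i))).
Proof.
  intros HP Ht.
  apply (Definable_iff (fun e => exists x, x = t e /\ P x (fun i => e (g i)))).
  - intros e; split; [intros (x & -> & H); exact H|eauto].
  - apply Definable_ex, Definable_and; [exact Ht|].
    exact (Definable_rename _ (fun i => match i with 0 => 0 | S k => S (g k) end) HP).
Qed.

Lemma Definable_tail2 (P : M -> M -> (nat -> M) -> Prop) t u (g : nat -> nat) :
  Definable (fun e => P (e 0) (e 1) (fun i => e (S (S i)))) ->
  DefinableTerm t -> DefinableTerm u -> Definable (fun e => P (t e) (u e) (fun i => e (g i))).
Proof.
  intros HP Ht Hu.
  refine (Definable_tail1 (fun x e => P x (u e) (fun i => e (g i))) t (fun i => i) _ Ht).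
  refine (Definable_tail1 (fun y e => P (e 0) y (fun i => e (S (g i))))
            (fun e => u (fun i => e (S i))) (fun i => i) _ _).
  - exact (Definable_rename _
      (fun i => match i with 0 => 1 | 1 => 0 | S (S k) => S (S (g k)) end) HP).
  - exact (DefinableTerm_tail0 u S Hu).
Qed.

End Terms.


Tactic Notation "definable_by" reference(F) :=
  intros; first [ apply DefinableTerm_app1 | apply DefinableTerm_app2
                | apply Definable_app1 | apply Definable_app2 ];
  try assumption; unfold F; exact _.

#[global] Hint Extern 0 (Definable _) => progress cbv beta : typeclass_instances.
#[global] Hint Extern 0 (DefinableTerm _) => progress cbv beta : typeclass_instances.

(* These hints use definability hypotheses from the context. [is_var] restricts them to variables,
   whose arguments a higher-order pattern then recovers. *)
#[global] Hint Extern 3 (Definable (fun e => _)) =>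
  match goal with
  | H : Definable (fun e => ?P (e 0)) |- Definable (fun e => ?P (@?t e)) =>
      is_var P; apply (Definable_app1 P t H)
  | H : Definable (fun e => ?P (e 0) (e 1)) |- Definable (fun e => ?P (@?t e) (@?u e)) =>
      is_var P; apply (Definable_app2 P t u H)
  | H : Definable ?P |- Definable (fun e => ?P _) => is_var P; apply (Definable_rename P _ H)
  | H : Definable (fun e => ?P (e 0) (fun i => e (S i))) |- Definable (fun e => ?P _ _) =>
      is_var P; apply (Definable_tail1 P _ _ H)
  | H : Definable (fun e => ?P (e 0) (e 1) (fun i => e (S (S i)))) |- Definable (fun e => ?P _ _ _) =>
      is_var P; apply (Definable_tail2 P _ _ _ H)
  end : typeclass_instances.

#[global] Hint Extern 3 (DefinableTerm (fun e => _)) =>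
  match goal with
  | H : DefinableTerm (fun e => ?F (e 0)) |- DefinableTerm (fun e => ?F (@?t e)) =>
      is_var F; apply (DefinableTerm_app1 F t H)
  | H : DefinableTerm (fun e => ?F (e 0) (e 1)) |- DefinableTerm (fun e => ?F (@?t e) (@?u e)) =>
      is_var F; apply (DefinableTerm_app2 F t u H)
  | H : DefinableTerm ?t |- DefinableTerm (fun e => ?t _) =>
      is_var t; apply (DefinableTerm_tail0 t _ H)
  | H : DefinableTerm (fun e => ?F (e 0) (fun i => e (S i))) |- DefinableTerm (fun e => ?F _ _) =>
      is_var F; apply (DefinableTerm_tail1 F _ _ H)
  | H : DefinableTerm (fun e => ?F (e 0) (e 1) (fun i => e (S (S i))))
      |- DefinableTerm (fun e => ?F _ _ _) =>
      is_var F; apply (DefinableTerm_tail2 F _ _ _ H)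
  end : typeclass_instances.

(** * Sets, pairs and functions *)

#[global] Hint Extern 4 (Definable (fun e => @subset _ _ _)) => unfold subset : typeclass_instances.
#[global] Hint Extern 4 (Definable (fun e => is_empty _)) => unfold is_empty : typeclass_instances.
#[global] Hint Extern 4 (Definable (fun e => is_succ _ _)) => unfold is_succ : typeclass_instances.
#[global] Hint Extern 4 (Definable (fun e => is_upair _ _ _)) => unfold is_upair : typeclass_instances.
#[global] Hint Extern 4 (Definable (fun e => is_opair _ _ _)) => unfold is_opair : typeclass_instances.
#[global] Hint Extern 4 (Definable (fun e => app _ _ _)) => unfold app : typeclass_instances.
#[global] Hint Extern 4 (Definable (fun e => function _ _ _)) => unfold function : typeclass_instances.
#[global] Hint Extern 4 (Definable (fun e => injection _ _ _)) => unfold injection : typeclass_instances.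
#[global] Hint Extern 4 (Definable (fun e => bijection _ _ _)) => unfold bijection : typeclass_instances.
#[global] Hint Extern 4 (Definable (fun e => equipotent _ _)) => unfold equipotent : typeclass_instances.
#[global] Hint Extern 4 (Definable (fun e => card_lt _ _)) => unfold card_lt : typeclass_instances.
#[global] Hint Extern 4 (Definable (fun e => ordinal _)) => unfold ordinal : typeclass_instances.
#[global] Hint Extern 4 (Definable (fun e => natural _)) => unfold natural : typeclass_instances.
#[global] Hint Extern 4 (Definable (fun e => infinite _)) => unfold infinite : typeclass_instances.
#[global] Hint Extern 4 (Definable (fun e => cardinal _)) => unfold cardinal : typeclass_instances.
#[global] Hint Extern 4 (Definable (fun e => infinite_cardinal _)) => unfold infinite_cardinal : typeclass_instances.
#[global] Hint Extern 4 (Definable (fun e => cofinal_map _ _ _)) => unfold cofinal_map : typeclass_instances.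

Section Sets.
Context {M : set_structure} {zf : ZF M}.
Implicit Types (a b c d f p x y z : M) (t u : (nat -> M) -> M).

#[global] Instance Definable_unique (Q : M -> (nat -> M) -> Prop) :
  Definable (fun e => Q (e 0) (fun i => e (S i))) -> Definable (fun e => exists! x, Q x e).
Proof.
  intros H. unfold unique.
  exact _.
Qed.

Lemma set_ext x y : (forall z, z ∈ x <-> z ∈ y) -> x = y.
Proof. apply (zf_extensionality zf). Qed.

Lemma empty_exists : exists z : M, is_empty z.
Proof. destruct (zf_infinity zf) as (w & (z & Hz & _) & _). now exists z. Qed.

(** The metatheoretic epsilon only names an object that is already determined, with the empty set as
    default. Hence the graph is first-order by [the_iff], and no choice enters the model. *)
Definition the (P : M -> Prop) : M :=
  epsilon carrier_inhabited
    (fun y => ((exists! x, P x) /\ P y) \/ (~ (exists! x, P x) /\ is_empty y)).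

Lemma the_iff (P : M -> Prop) y :
  y = the P <-> ((exists! x, P x) /\ P y) \/ (~ (exists! x, P x) /\ is_empty y).
Proof.
  assert (H : ((exists! x, P x) /\ P (the P)) \/ (~ (exists! x, P x) /\ is_empty (the P))).
  { apply (epsilon_spec carrier_inhabited (fun y => ((exists! x, P x) /\ P y) \/ (~ (exists! x, P x) /\ is_empty y))).
    destruct (classic (exists! x, P x)) as [H|H].
    - destruct H as (x & Hx & U). exists x. left; split; [exists x; split|]; assumption.
    - destruct empty_exists as [z Hz]. exists z; right; split; assumption. }
  split; [intros ->; exact H|].
  intros [[(x & Hx & U) Py]|[N Ey]]; destruct H as [[H1 H2]|[H1 H2]].
  - rewrite <- (U _ Py). symmetry. rewrite <- (U _ H2). reflexivity.
  - exfalso; apply H1; exists x; split; assumption.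
  - contradiction.
  - apply set_ext; intros z; split; intros K; exfalso; [apply (Ey z K)|apply (H2 z K)].
Qed.

Lemma the_spec (P : M -> Prop) : (exists! x, P x) -> P (the P).
Proof.
  intros H. destruct (proj1 (the_iff P (the P)) eq_refl) as [[_ K]|[N _]]; tauto.
Qed.

Lemma the_eq (P : M -> Prop) y : P y -> (forall x, P x -> x = y) -> the P = y.
Proof.
  intros H U. symmetry. apply the_iff. left; split; [|exact H].
  exists y; split; [exact H|]. intros x Hx; symmetry; auto.
Qed.

Lemma the_set_spec (P : M -> Prop) :
  (exists b, forall x, x ∈ b <-> P x) -> forall x, x ∈ the (fun b => forall x, x ∈ b <-> P x) <-> P x.
Proof.
  intros [b Hb]. apply (the_spec (fun b => forall x, x ∈ b <-> P x)).
  exists b; split; [exact Hb|]. intros b' Hb'. apply set_ext; intros x.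
  rewrite Hb, Hb'; tauto.
Qed.

#[global] Instance DefinableTerm_the (P : M -> (nat -> M) -> Prop) :
  Definable (fun e => P (e 0) (fun i => e (S i))) -> DefinableTerm (fun e => the (fun x => P x e)).
Proof.
  intros H. unfold DefinableTerm.
  apply (Definable_iff (fun e => ((exists! x, P x (fun i => e (S i))) /\ P (e 0) (fun i => e (S i)))
     \/ (~ (exists! x, P x (fun i => e (S i))) /\ is_empty (e 0)))).
  { intros e. symmetry. apply (the_iff (fun x => P x (fun i => e (S i)))). }
  exact _.
Qed.

Definition sep a (P : M -> Prop) : M := the (fun b => forall x, x ∈ b <-> x ∈ a /\ P x).

#[global] Instance DefinableTerm_sep t (P : M -> (nat -> M) -> Prop) :
  DefinableTerm t -> Definable (fun e => P (e 0) (fun i => e (S i))) ->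
  DefinableTerm (fun e => sep (t e) (fun x => P x e)).
Proof.
  intros Ht HP. unfold sep. exact _.
Qed.

Lemma in_sep a (P : M -> Prop) {HP : Def1 P} x : x ∈ sep a P <-> x ∈ a /\ P x.
Proof.
  apply (the_set_spec (fun x => x ∈ a /\ P x)).
  destruct HP as (phi & r & H).
  (* All even positions are sent to variable 0, since [P] reads only that variable; parameter i
     becomes variable [S i]. *)
  destruct (zf_separation zf (rename (by_parity (fun _ => 0) S) phi) r a) as [b Hb].
  exists b. intros y. rewrite Hb, (sat_rename M phi _ _ (mix (fun _ => y) r)).
  - now rewrite <- (H (fun _ => y)).
  - intros k. destruct (parity_cases k) as [l [-> | ->]].
    + now rewrite by_parity_even, mix_even.
    + now rewrite by_parity_odd, mix_odd.
Qed.

Definition image a (F : M -> M) : M :=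
  the (fun b => forall y, y ∈ b <-> exists x, x ∈ a /\ y = F x).

#[global] Instance DefinableTerm_image t (F : M -> (nat -> M) -> M) :
  DefinableTerm t -> DefinableTerm (fun e => F (e 0) (fun i => e (S i))) ->
  DefinableTerm (fun e => image (t e) (fun x => F x e)).
Proof.
  intros Ht HF. unfold image. exact _.
Qed.

Lemma in_image a (F : M -> M) {HF : Fun1 F} y : y ∈ image a F <-> exists x, x ∈ a /\ y = F x.
Proof.
  apply (the_set_spec (fun y => exists x, x ∈ a /\ y = F x)).
  destruct HF as (phi & r & H).
  (* In the graph formula the value is variable 0 and the argument variable 1; replacement wants the
     argument first. *)
  set (psi := rename (by_parity (fun i => match i with 0 => 1 | _ => 0 end)
                                (fun i => S (S i))) phi).
  assert (K : forall x y, sat (scons x (scons y r)) psi <-> y = F x).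
  { intros x y'. unfold psi.
    rewrite (sat_rename M phi _ _ (mix (scons y' (fun _ => x)) r)).
    - now rewrite <- (H (scons y' (fun _ => x))).
    - intros k. destruct (parity_cases k) as [l [-> | ->]].
      + rewrite by_parity_even, mix_even. now destruct l.
      + now rewrite by_parity_odd, mix_odd. }
  destruct (@zf_replacement M zf psi r a) as [b Hb].
  - intros x y1 y2 _. rewrite !K. congruence.
  - exists b. intros z. rewrite Hb. setoid_rewrite K. reflexivity.
Qed.

Definition void : M := the is_empty.
Definition upair x y : M := the (fun p => is_upair p x y).
Definition bigcup a : M := the (fun b => forall z, z ∈ b <-> exists y, y ∈ a /\ z ∈ y).
Definition power a : M := the (fun p => forall z, z ∈ p <-> subset z a).
Definition single x : M := upair x x.
Definition cup a b : M := bigcup (upair a b).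
Definition cap a b : M := sep a (fun x => x ∈ b).
Definition diff a b : M := sep a (fun x => x ∉ b).
Definition adj x a : M := cup a (single x).
Definition del x a : M := diff a (single x).
Definition opair x y : M := upair (single x) (upair x y).
Definition succ x : M := adj x x.

#[global] Instance definable_upair : DefinableFun2 upair.
Proof. definable_by upair. Qed.
#[global] Instance definable_bigcup : DefinableFun1 bigcup.
Proof. definable_by bigcup. Qed.
#[global] Instance definable_power : DefinableFun1 power.
Proof. definable_by power. Qed.
#[global] Instance definable_single : DefinableFun1 single.
Proof. definable_by single. Qed.
#[global] Instance definable_cup : DefinableFun2 cup.
Proof. definable_by cup. Qed.
#[global] Instance definable_cap : DefinableFun2 cap.
Proof. definable_by cap. Qed.
#[global] Instance definable_diff : DefinableFun2 diff.
Proof. definable_by diff. Qed.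
#[global] Instance definable_adj : DefinableFun2 adj.
Proof. definable_by adj. Qed.
#[global] Instance definable_del : DefinableFun2 del.
Proof. definable_by del. Qed.
#[global] Instance definable_opair : DefinableFun2 opair.
Proof. definable_by opair. Qed.
#[global] Instance definable_succ : DefinableFun1 succ.
Proof. definable_by succ. Qed.

Lemma in_void x : x ∈ void <-> False.
Proof.
  split; [|tauto]. apply (the_spec is_empty).
  destruct empty_exists as [z Hz]. exists z; split; [exact Hz|].
  intros z' Hz'. apply set_ext; intros y; split; intros K; exfalso; [apply (Hz y K)|apply (Hz' y K)].
Qed.

Lemma in_upair x y z : z ∈ upair x y <-> z = x \/ z = y.
Proof. exact (the_set_spec _ (zf_pairing zf x y) z). Qed.
Lemma in_bigcup a z : z ∈ bigcup a <-> exists y, y ∈ a /\ z ∈ y.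
Proof. exact (the_set_spec _ (zf_union zf a) z). Qed.
Lemma in_power a z : z ∈ power a <-> subset z a.
Proof. exact (the_set_spec _ (zf_powerset zf a) z). Qed.
Lemma in_single x z : z ∈ single x <-> z = x.
Proof. unfold single. rewrite in_upair. tauto. Qed.
Lemma in_cup a b z : z ∈ cup a b <-> z ∈ a \/ z ∈ b.
Proof.
  unfold cup. rewrite in_bigcup. split.
  - intros (y & Hy & Hz). apply in_upair in Hy as [-> | ->]; auto.
  - intros [H|H]; [exists a|exists b]; rewrite in_upair; auto.
Qed.
Lemma in_cap a b z : z ∈ cap a b <-> z ∈ a /\ z ∈ b.
Proof. unfold cap. rewrite in_sep by exact _. tauto. Qed.
Lemma in_diff a b z : z ∈ diff a b <-> z ∈ a /\ z ∉ b.
Proof. unfold diff. rewrite in_sep by exact _. tauto. Qed.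
Lemma in_adj x a z : z ∈ adj x a <-> z ∈ a \/ z = x.
Proof. unfold adj. rewrite in_cup, in_single; tauto. Qed.
Lemma in_del x a z : z ∈ del x a <-> z ∈ a /\ z <> x.
Proof. unfold del. rewrite in_diff, in_single; tauto. Qed.
Lemma in_succ x z : z ∈ succ x <-> z ∈ x \/ z = x.
Proof. exact (in_adj x x z). Qed.

Lemma is_empty_eq z : is_empty z -> z = void.
Proof. intros H; apply set_ext; intros x; rewrite in_void; split; [apply H|tauto]. Qed.

Lemma is_succ_eq s x : is_succ s x -> s = succ x.
Proof. intros H; apply set_ext; intros z; rewrite in_succ; apply H. Qed.

Lemma is_upair_eq p x y : is_upair p x y <-> p = upair x y.
Proof.
  split; [|intros ->; intros z; apply in_upair].
  intros H; apply set_ext; intros z; rewrite in_upair; apply H.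
Qed.

Lemma is_opair_eq p x y : is_opair p x y <-> p = opair x y.
Proof.
  unfold is_opair, opair. setoid_rewrite is_upair_eq.
  split; [|intros ->; intros z; apply in_upair].
  intros H; apply set_ext; intros z; rewrite in_upair; apply H.
Qed.

Lemma upair_inj x y x' y' : upair x y = upair x' y' ->
  (x = x' /\ y = y') \/ (x = y' /\ y = x').
Proof.
  intros H.
  assert (H1 := proj1 (in_upair x' y' x)); assert (H2 := proj1 (in_upair x' y' y)).
  assert (H3 := proj1 (in_upair x y x')); assert (H4 := proj1 (in_upair x y y')).
  rewrite <- H in H1, H2. rewrite H in H3, H4.
  rewrite !in_upair in *. intuition congruence.
Qed.

Lemma opair_inj x y x' y' : opair x y = opair x' y' -> x = x' /\ y = y'.
Proof.
  intros H. apply upair_inj in H as [[H1 H2]|[H1 H2]];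
    apply upair_inj in H1; apply upair_inj in H2; intuition congruence.
Qed.

Lemma app_opair f x y : app f x y <-> opair x y ∈ f.
Proof.
  unfold app. setoid_rewrite is_opair_eq. split; [intros (p & -> & H); exact H|eauto].
Qed.

Lemma nonempty_ex a : a <> void -> exists x, x ∈ a.
Proof.
  intros H. apply NNPP; intros N. apply H, is_empty_eq. intros x Hx. eauto.
Qed.

Lemma subset_antisym a b : subset a b -> subset b a -> a = b.
Proof. intros H K; apply set_ext; split; auto. Qed.

Definition graph a (F : M -> M) : M := image a (fun x => opair x (F x)).
Definition ap f x : M := the (app f x).
Definition cprod a b : M := bigcup (image a (fun x => image b (fun y => opair x y))).

#[global] Instance DefinableTerm_graph t (F : M -> (nat -> M) -> M) :
  DefinableTerm t -> DefinableTerm (fun e => F (e 0) (fun i => e (S i))) ->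
  DefinableTerm (fun e => graph (t e) (fun x => F x e)).
Proof. unfold graph. exact _. Qed.
#[global] Instance definable_ap : DefinableFun2 ap.
Proof. definable_by ap. Qed.
#[global] Instance definable_cprod : DefinableFun2 cprod.
Proof. definable_by cprod. Qed.

Lemma in_cprod a b p : p ∈ cprod a b <-> exists x y, x ∈ a /\ y ∈ b /\ p = opair x y.
Proof.
  unfold cprod. rewrite in_bigcup. split.
  - intros (s & Hs & Hp). rewrite in_image in Hs by exact _. destruct Hs as (x & Hx & ->).
    rewrite in_image in Hp by exact _. destruct Hp as (y & Hy & ->). eauto.
  - intros (x & y & Hx & Hy & ->). exists (image b (fun y => opair x y)).
    rewrite !in_image by exact _. split; [exists x|exists y]; auto.
Qed.

Lemma app_graph a (F : M -> M) {HF : Fun1 F} x y : app (graph a F) x y <-> x ∈ a /\ y = F x.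
Proof.
  rewrite app_opair. unfold graph. rewrite in_image by exact _. split.
  - intros (x' & H & K). apply opair_inj in K as [-> ->]. auto.
  - intros [H ->]. eauto.
Qed.

Lemma ap_graph a (F : M -> M) {HF : Fun1 F} x : x ∈ a -> ap (graph a F) x = F x.
Proof.
  intros H. apply the_eq.
  - apply app_graph; [exact _|auto].
  - intros y K. apply app_graph in K as [_ ->]; [reflexivity|exact _].
Qed.

Lemma ap_of_app f a b x y : function f a b -> app f x y -> x ∈ a /\ y ∈ b /\ ap f x = y.
Proof.
  intros [H1 H2] K.
  assert (Hxy : x ∈ a /\ y ∈ b).
  { apply app_opair in K. destruct (H1 _ K) as (x' & y' & Hx & Hy & E).
    apply is_opair_eq, opair_inj in E as [-> ->]. auto. }
  destruct Hxy as [Hx Hy]. split; [exact Hx|split; [exact Hy|]].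
  apply the_eq; [exact K|]. intros y' K'.
  destruct (H2 x Hx) as (w & _ & U). now rewrite <- (U _ K), <- (U _ K').
Qed.

Lemma app_ap f a b x : function f a b -> x ∈ a -> app f x (ap f x) /\ ap f x ∈ b.
Proof.
  intros H Hx. destruct (proj2 H x Hx) as (y & K & _).
  destruct (ap_of_app f a b x y H K) as (_ & Hy & E). rewrite E; auto.
Qed.

Lemma graph_function a b (F : M -> M) {HF : Fun1 F} :
  (forall x, x ∈ a -> F x ∈ b) -> function (graph a F) a b.
Proof.
  intros H. split.
  - intros p Hp. unfold graph in Hp. rewrite in_image in Hp by exact _. destruct Hp as (x & Hx & ->).
    exists x, (F x). rewrite is_opair_eq. auto.
  - intros x Hx. exists (F x). split; [apply app_graph; [exact _|auto]|].
    intros y K. apply app_graph in K as [_ ->]; [reflexivity|exact _].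
Qed.

Definition embeds a b : Prop := exists f, injection f a b.

(** Injections are handled as definable class functions: replacement makes a set of the model out of
    one, and [embeds_elim] goes back. *)
Lemma embeds_intro a b (F : M -> M) {HF : Fun1 F} :
  (forall x, x ∈ a -> F x ∈ b) ->
  (forall x x', x ∈ a -> x' ∈ a -> F x = F x' -> x = x') -> embeds a b.
Proof.
  intros H K. exists (graph a F). split; [now apply graph_function|].
  intros x x' y. rewrite !app_graph by exact _. intros [Hx ->] [Hx' E]. auto.
Qed.

Lemma embeds_elim a b : embeds a b -> exists F : M -> M, Fun1 F /\
  (forall x, x ∈ a -> F x ∈ b) /\
  (forall x x', x ∈ a -> x' ∈ a -> F x = F x' -> x = x').
Proof.
  intros [f [Hf I]]. exists (ap f). split; [exact _|split].
  - intros x Hx. now apply (app_ap f a b).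
  - intros x x' Hx Hx' E. apply (I x x' (ap f x)); [|rewrite E]; eapply app_ap; eauto.
Qed.

Lemma equipotent_intro a b (F : M -> M) {HF : Fun1 F} :
  (forall x, x ∈ a -> F x ∈ b) ->
  (forall x x', x ∈ a -> x' ∈ a -> F x = F x' -> x = x') ->
  (forall y, y ∈ b -> exists x, x ∈ a /\ y = F x) -> equipotent a b.
Proof.
  intros H K S. exists (graph a F). split; [split; [now apply graph_function|]|].
  - intros x x' y. rewrite !app_graph by exact _. intros [Hx ->] [Hx' E]. auto.
  - intros y Hy. destruct (S y Hy) as (x & Hx & ->). exists x. rewrite app_graph by exact _; auto.
Qed.

Lemma equipotent_elim a b : equipotent a b -> exists F : M -> M, Fun1 F /\
  (forall x, x ∈ a -> F x ∈ b) /\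
  (forall x x', x ∈ a -> x' ∈ a -> F x = F x' -> x = x') /\
  (forall y, y ∈ b -> exists x, x ∈ a /\ y = F x).
Proof.
  intros [f [[Hf I] S]]. exists (ap f). split; [exact _|split; [|split]].
  - intros x Hx. now apply (app_ap f a b).
  - intros x x' Hx Hx' E. apply (I x x' (ap f x)); [|rewrite E]; eapply app_ap; eauto.
  - intros y Hy. destruct (S y Hy) as (x & Hx & K). exists x; split; [exact Hx|].
    symmetry. now apply (ap_of_app f a b).
Qed.

Definition inverse a (F : M -> M) y : M := the (fun x => x ∈ a /\ y = F x).

#[global] Instance DefinableTerm_inverse t u (F : M -> (nat -> M) -> M) :
  DefinableTerm t -> DefinableTerm u -> DefinableTerm (fun e => F (e 0) (fun i => e (S i))) ->
  DefinableTerm (fun e => inverse (t e) (fun x => F x e) (u e)).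
Proof.
  intros Ht Hu HF. unfold inverse. exact _.
Qed.

Lemma inverse_eq a (F : M -> M) x :
  (forall x x', x ∈ a -> x' ∈ a -> F x = F x' -> x = x') -> x ∈ a -> inverse a F (F x) = x.
Proof. intros I Hx. apply the_eq; [auto|]. intros x' [H E]; auto. Qed.

Lemma equipotent_refl a : equipotent a a.
Proof. apply (equipotent_intro a a (fun x => x)); eauto. Qed.

Lemma equipotent_sym a b : equipotent a b -> equipotent b a.
Proof.
  intros H. destruct (equipotent_elim a b H) as (F & HF & H1 & H2 & H3).
  apply (equipotent_intro b a (inverse a F)).
  - intros y Hy. destruct (H3 y Hy) as (x & Hx & ->). now rewrite inverse_eq.
  - intros y y' Hy Hy'. destruct (H3 y Hy) as (x & Hx & ->). destruct (H3 y' Hy') as (x' & Hx' & ->).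
    rewrite !inverse_eq by assumption. congruence.
  - intros x Hx. exists (F x). rewrite inverse_eq; auto.
Qed.

Lemma embeds_trans a b c : embeds a b -> embeds b c -> embeds a c.
Proof.
  intros H K. destruct (embeds_elim a b H) as (F & HF & H1 & H2).
  destruct (embeds_elim b c K) as (G & HG & K1 & K2).
  apply (embeds_intro a c (fun x => G (F x))); auto.
Qed.

Lemma equipotent_trans a b c : equipotent a b -> equipotent b c -> equipotent a c.
Proof.
  intros H K. destruct (equipotent_elim a b H) as (F & HF & H1 & H2 & H3).
  destruct (equipotent_elim b c K) as (G & HG & K1 & K2 & K3).
  apply (equipotent_intro a c (fun x => G (F x))); auto.
  intros z Hz. destruct (K3 z Hz) as (y & Hy & ->). destruct (H3 y Hy) as (x & Hx & ->). eauto.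
Qed.

Lemma subset_embeds a b : subset a b -> embeds a b.
Proof. intros H. apply (embeds_intro a b (fun x => x)); auto. Qed.

Lemma equipotent_embeds a b : equipotent a b -> embeds a b.
Proof. intros (f & H & _). now exists f. Qed.

Lemma image_equipotent a (F : M -> M) {HF : Fun1 F} :
  (forall x x', x ∈ a -> x' ∈ a -> F x = F x' -> x = x') -> equipotent a (image a F).
Proof.
  intros I. apply (equipotent_intro _ _ F); auto.
  - intros x Hx. rewrite in_image by exact _. eauto.
  - intros y Hy. now rewrite in_image in Hy by exact _.
Qed.

End Sets.

#[global] Hint Extern 4 (Definable (fun e => embeds _ _)) => unfold embeds : typeclass_instances.
#[global] Opaque the sep image void upair bigcup power single cup cap diff adj del opair succ
  graph ap cprod inverse.

Ltac set_step :=
  first [ rewrite in_sep by exact _ | rewrite in_image by exact _ | rewrite in_void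
        | rewrite in_upair | rewrite in_bigcup | rewrite in_power | rewrite in_single
        | rewrite in_cup | rewrite in_cap | rewrite in_diff | rewrite in_adj | rewrite in_del
        | rewrite in_succ ].
Ltac set_step_in H :=
  first [ rewrite in_sep in H by exact _ | rewrite in_image in H by exact _ | rewrite in_void in H
        | rewrite in_upair in H | rewrite in_bigcup in H | rewrite in_power in H
        | rewrite in_single in H | rewrite in_cup in H | rewrite in_cap in H
        | rewrite in_diff in H | rewrite in_adj in H | rewrite in_del in H | rewrite in_succ in H ].
Tactic Notation "sets" := repeat set_step.
Tactic Notation "sets" "in" hyp(H) := repeat set_step_in H.

(* The instances above expect a functional argument in eta-expanded form. *)
#[global] Hint Extern 2 (DefinableTerm (fun e => image _ _)) =>
  match goal with |- DefinableTerm (fun e => image (@?t e) ?F) =>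
    apply (DefinableTerm_image t (fun x _ => F x)) end : typeclass_instances.
#[global] Hint Extern 2 (DefinableTerm (fun e => graph _ _)) =>
  match goal with |- DefinableTerm (fun e => graph (@?t e) ?F) =>
    apply (DefinableTerm_graph t (fun x _ => F x)) end : typeclass_instances.
#[global] Hint Extern 2 (DefinableTerm (fun e => sep _ _)) =>
  match goal with |- DefinableTerm (fun e => sep (@?t e) ?F) =>
    apply (DefinableTerm_sep t (fun x _ => F x)) end : typeclass_instances.
#[global] Hint Extern 2 (DefinableTerm (fun e => inverse _ _ _)) =>
  match goal with |- DefinableTerm (fun e => inverse (@?t e) ?F (@?u e)) =>
    apply (DefinableTerm_inverse t u (fun x _ => F x)) end : typeclass_instances.

(** * Recursion, ordinals and finite sets *)

Section Recursion.
Context {M : set_structure} {zf : ZF M}.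
Implicit Types (a b c d f p q x y z : M) (t u : (nat -> M) -> M).

Definition ite (P : Prop) x y : M := the (fun z => (P /\ z = x) \/ (~ P /\ z = y)).

#[global] Instance DefinableTerm_ite (P : (nat -> M) -> Prop) t u :
  Definable P -> DefinableTerm t -> DefinableTerm u ->
  DefinableTerm (fun e => ite (P e) (t e) (u e)).
Proof.
  intros HP Ht Hu. unfold ite.
  exact _.
Qed.

Lemma ite_true (P : Prop) x y : P -> ite P x y = x.
Proof. intros H; apply the_eq; [tauto|]. intros z [[_ K]|[K _]]; tauto. Qed.

Lemma ite_false (P : Prop) x y : ~ P -> ite P x y = y.
Proof. intros H; apply the_eq; [tauto|]. intros z [[K _]|[_ K]]; tauto. Qed.

Lemma graph_ext a (F G : M -> M) {HF : Fun1 F} {HG : Fun1 G} :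
  (forall x, x ∈ a -> F x = G x) -> graph a F = graph a G.
Proof.
  intros H. apply set_ext; intros p. Transparent graph. unfold graph. Opaque graph. sets.
  split; intros (x & Hx & ->); exists x; rewrite H by exact Hx; auto.
Qed.

(** * Well-founded recursion *)

Section WellFounded.
Variables (P : M -> Prop) (pr : M -> M) (G : M -> M -> M).
Context {HP : Def1 P} {Hpr : Fun1 pr} {HG : Fun2 G}.
Hypothesis pr_closed : forall p q, P p -> q ∈ pr p -> P q /\ subset (pr q) (pr p).
Hypothesis pr_wf : forall s, (forall p, p ∈ s -> P p) -> (exists p, p ∈ s) ->
  exists p, p ∈ s /\ forall q, q ∈ s -> q ∉ pr p.

(** Minimal elements are available for sets only. As [pr] is transitive, the counterexamples among p
    and its predecessors form a sufficient set. *)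
Lemma wf_ind (phi : M -> Prop) {Hphi : Def1 phi} :
  (forall p, P p -> (forall q, q ∈ pr p -> phi q) -> phi p) -> forall p, P p -> phi p.
Proof.
  intros step p Hp. apply NNPP; intros N.
  destruct (pr_wf (sep (adj p (pr p)) (fun q => ~ phi q))) as (m & Hm & Km).
  - intros q Hq. sets in Hq. destruct Hq as [[Hq| ->] _]; [now apply (pr_closed p)|exact Hp].
  - exists p. sets. auto.
  - sets in Hm. destruct Hm as [Hm Nm].
    assert (Pm : P m) by (destruct Hm as [Hm| ->]; [now apply (pr_closed p)|exact Hp]).
    assert (Sm : subset (pr m) (pr p)).
    { destruct Hm as [Hm| ->]; [now apply (pr_closed p)|intros q; auto]. }
    apply Nm, step; [exact Pm|]. intros q Hq. apply NNPP; intros Nq.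
    apply (Km q); [|exact Hq]. sets. auto.
Qed.

(** A partial solution of the recursion. The first clause makes it a bare graph, so that partial
    solutions with equal values are equal as sets. *)
Definition attempt a f : Prop :=
  f = graph a (fun q => ap f q) /\
  forall q, q ∈ a -> ap f q = G q (graph (pr q) (fun r => ap f r)).

(** Partial solutions are unique, so [the] can read off the value; this keeps recursively defined
    operations definable. *)
Definition wfrec p : M := the (fun v => exists f, attempt (pr p) f /\ v = G p f).

Lemma attempt_unique p f f' : P p -> attempt (pr p) f -> attempt (pr p) f' -> f = f'.
Proof.
  intros Hp [E A] [E' A'].
  assert (K : forall q, P q -> q ∈ pr p -> ap f q = ap f' q).
  { apply (wf_ind (fun q => q ∈ pr p -> ap f q = ap f' q)).
    intros q Hq IH Kq. rewrite A, A' by assumption. f_equal.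
    apply graph_ext; try exact _. intros r Hr. apply IH; [exact Hr|].
    now apply (pr_closed p q). }
  rewrite E, E'. apply graph_ext; try exact _.
  intros q Hq. apply K; [|exact Hq]. now apply (pr_closed p).
Qed.

Lemma wfrec_eq_aux p : P p -> wfrec p = G p (graph (pr p) wfrec).
Proof.
  assert (HW : Fun1 wfrec) by (unfold wfrec, attempt; exact _).
  revert p. apply (wf_ind (fun p => wfrec p = G p (graph (pr p) wfrec))).
  intros p Hp IH.
  (* By the induction hypothesis [wfrec] itself restricts to a partial solution below p, so none has
     to be glued. *)
  assert (A : attempt (pr p) (graph (pr p) wfrec)).
  { split.
    - apply graph_ext; try exact _. intros q Hq. rewrite ap_graph; auto.
    - intros q Hq. rewrite ap_graph by auto. rewrite IH by exact Hq. f_equal.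
      apply graph_ext; try exact _. intros r Hr. rewrite ap_graph; auto.
      apply (pr_closed p q); assumption. }
  apply the_eq; [eauto|]. intros v (f & Hf & ->).
  now rewrite (attempt_unique p _ _ Hp Hf A).
Qed.
End WellFounded.

#[global] Instance DefinableTerm_wfrec t (pr : M -> (nat -> M) -> M) (G : M -> M -> (nat -> M) -> M) :
  DefinableTerm t -> DefinableTerm (fun e => pr (e 0) (fun i => e (S i))) ->
  DefinableTerm (fun e => G (e 0) (e 1) (fun i => e (S (S i)))) ->
  DefinableTerm (fun e => wfrec (fun p => pr p e) (fun p f => G p f e) (t e)).
Proof. intros Ht Hpr HG. unfold wfrec, attempt. exact _. Qed.

Lemma wfrec_eq (P : M -> Prop) (pr : M -> M) (G : M -> M -> M)
    {HP : Def1 P} {Hpr : Fun1 pr} {HG : Fun2 G} :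
  (forall p q, P p -> q ∈ pr p -> P q /\ subset (pr q) (pr p)) ->
  (forall s, (forall p, p ∈ s -> P p) -> (exists p, p ∈ s) ->
    exists p, p ∈ s /\ forall q, q ∈ s -> q ∉ pr p) ->
  forall p, P p -> wfrec pr G p = G p (graph (pr p) (wfrec pr G)).
Proof. intros H K p Hp. now apply (wfrec_eq_aux P). Qed.

End Recursion.
#[global] Opaque ite wfrec.

#[global] Hint Extern 2 (DefinableTerm (fun e => wfrec _ _ _)) =>
  match goal with |- DefinableTerm (fun e => wfrec ?pr (@?G e) (@?t e)) =>
    apply (DefinableTerm_wfrec t (fun p _ => pr p) (fun p f e => G e p f)) end : typeclass_instances.

(** * Ordinals and natural numbers *)

Section OrdinalTheory.
Context {M : set_structure} {zf : ZF M}.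
Implicit Types (a b c d f p q x y z m n : M).

Lemma mem_irrefl x : x ∉ x.
Proof.
  intros H. destruct (@zf_foundation M zf (single x)) as (y & Hy & K).
  - exists x. now sets.
  - sets in Hy. subst y. apply (K x); [now sets|exact H].
Qed.

Lemma mem_asym x y : x ∈ y -> y ∉ x.
Proof.
  intros H H'. destruct (@zf_foundation M zf (upair x y)) as (z & Hz & K).
  - exists x. sets. auto.
  - sets in Hz. destruct Hz as [-> | ->].
    + apply (K y); [sets; auto|exact H'].
    + apply (K x); [sets; auto|exact H].
Qed.

Lemma ordinal_trans a x y : ordinal a -> y ∈ x -> x ∈ a -> y ∈ a.
Proof. intros [H _] Hy Hx. eapply H; eauto. Qed.

Lemma ordinal_subset a x : ordinal a -> x ∈ a -> subset x a.
Proof. intros H Hx y Hy. eapply ordinal_trans; eauto. Qed.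

Lemma ordinal_mem a x : ordinal a -> x ∈ a -> ordinal x.
Proof.
  intros (H1 & H2 & H3 & H4 & H5) Hx.
  assert (K : forall y, y ∈ x -> y ∈ a) by (intros y; now apply H1).
  split; [|split; [|split; [|split]]].
  - intros y z Hy Hz. apply (H3 z y x); auto. apply (H1 y z); auto.
  - auto.
  - intros p q r Hp Hq Hr. apply H3; auto.
  - auto.
  - intros b Hb. apply H5. intros y Hy; auto.
Qed.

(** The intersection of two ordinals is equal to or a member of each of them, and it cannot be a
    member of both. *)
Lemma ordinal_trichotomy a b : ordinal a -> ordinal b -> a ∈ b \/ a = b \/ b ∈ a.
Proof.
  assert (key : forall a b, ordinal a -> ordinal b -> cap a b = a \/ cap a b ∈ a).
  { clear. intros a b Ha Hb.
    destruct (classic (exists x, x ∈ diff a b)) as [N|N].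
    - right. destruct Ha as (H1 & H2 & H3 & H4 & H5).
      destruct (H5 (diff a b)) as (m & Hm & Km).
      + intros x Hx. sets in Hx; tauto.
      + exact N.
      + sets in Hm. destruct Hm as [Hm Nm].
        replace (cap a b) with m; [exact Hm|].
        apply set_ext; intros x. sets. split.
        * intros Hx. assert (Hxa : x ∈ a) by (apply (H1 m); auto).
          split; [exact Hxa|]. apply NNPP; intros Nx.
          destruct (Km x) as [-> | K]; [now sets|now apply (H2 m Hm)|].
          now apply (mem_asym x m).
        * intros [Hx Hx']. destruct (H4 x m Hx Hm) as [K|[-> |K]]; [exact K|tauto|].
          exfalso. apply Nm. now apply (ordinal_trans b x).
    - left. apply set_ext; intros x. sets. split; [tauto|]. intros Hx; split; [exact Hx|].
      apply NNPP; intros Nx. apply N. exists x. now sets. }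
  intros Ha Hb. destruct (key a b Ha Hb) as [E|E].
  - destruct (key b a Hb Ha) as [E'|E'];
      replace (cap b a) with (cap a b) in E' by (apply set_ext; intros x; sets; tauto).
    + right; left. congruence.
    + left. now rewrite E in E'.
  - destruct (key b a Hb Ha) as [E'|E'];
      replace (cap b a) with (cap a b) in E' by (apply set_ext; intros x; sets; tauto).
    + right; right. now rewrite E' in E.
    + exfalso. apply (mem_irrefl (cap a b)). sets. auto.
Qed.

Lemma ordinal_intro a :
  (forall x y, x ∈ a -> y ∈ x -> y ∈ a) -> (forall x, x ∈ a -> ordinal x) -> ordinal a.
Proof.
  intros H K. split; [exact H|split; [|split; [|split]]].
  - intros x _. apply mem_irrefl.
  - intros x y z _ _ Hz Hx Hy. eapply ordinal_trans; eauto.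
  - intros x y Hx Hy. apply ordinal_trichotomy; auto.
  - intros b Hb N. destruct (zf_foundation zf N) as (x & Hx & Nx).
    exists x; split; [exact Hx|]. intros y Hy.
    destruct (ordinal_trichotomy x y) as [L|[L|L]]; auto.
    exfalso. now apply (Nx y).
Qed.

Lemma ordinal_le_or_lt a b : ordinal a -> ordinal b -> subset a b \/ b ∈ a.
Proof.
  intros Ha Hb. destruct (ordinal_trichotomy a b Ha Hb) as [H|[-> |H]]; auto.
  - left. now apply ordinal_subset.
  - left. intros x; auto.
Qed.

Lemma ordinal_le_cases a b : ordinal a -> ordinal b -> subset a b -> a ∈ b \/ a = b.
Proof.
  intros Ha Hb H. destruct (ordinal_trichotomy a b Ha Hb) as [K|[K|K]]; auto.
  exfalso. apply (mem_irrefl b); auto.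
Qed.

Lemma ordinal_le_lt_trans a b c : ordinal a -> ordinal c -> subset a b -> b ∈ c -> a ∈ c.
Proof.
  intros Ha Hc H K. assert (Hb := ordinal_mem c b Hc K).
  destruct (ordinal_le_cases a b Ha Hb H) as [L| ->]; [|exact K].
  now apply (ordinal_trans c b).
Qed.

Lemma not_lt_le a b : ordinal a -> ordinal b -> b ∉ a -> subset a b.
Proof. intros Ha Hb N. destruct (ordinal_le_or_lt a b Ha Hb); tauto. Qed.

Lemma ordinal_succ a : ordinal a -> ordinal (succ a).
Proof.
  intros H. apply ordinal_intro.
  - intros x y Hx Hy. sets in Hx. sets. left. destruct Hx as [Hx| ->]; [|exact Hy].
    now apply (ordinal_trans a x).
  - intros x Hx. sets in Hx. destruct Hx as [Hx| ->]; [|exact H]. now apply (ordinal_mem a).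
Qed.

Lemma ordinal_void : ordinal void.
Proof. apply ordinal_intro; intros x; [intros y|]; intros H; now sets in H. Qed.

Lemma ordinal_wf s : (forall p, p ∈ s -> ordinal p) -> (exists p, p ∈ s) ->
  exists p, p ∈ s /\ forall q, q ∈ s -> q ∉ p.
Proof. intros _ N. exact (zf_foundation zf N). Qed.

Lemma ordinal_pr p q : ordinal p -> q ∈ p -> ordinal q /\ subset q p.
Proof. intros H K. split; [now apply (ordinal_mem p)|now apply ordinal_subset]. Qed.

Lemma ordinal_ind (phi : M -> Prop) {Hphi : Def1 phi} :
  (forall a, ordinal a -> (forall x, x ∈ a -> phi x) -> phi a) -> forall a, ordinal a -> phi a.
Proof.
  intros H. apply (wf_ind ordinal (fun a => a)); [exact ordinal_pr|exact ordinal_wf|exact _|exact H].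
Qed.

Lemma least_exists (phi : M -> Prop) {Hphi : Def1 phi} a : ordinal a -> phi a ->
  exists m, ordinal m /\ phi m /\ forall x, x ∈ m -> ~ phi x.
Proof.
  intros Ha. revert a Ha.
  apply (ordinal_ind (fun a => phi a -> exists m, ordinal m /\ phi m /\ forall x, x ∈ m -> ~ phi x)).
  intros a Ha IH Pa. destruct (classic (exists x, x ∈ a /\ phi x)) as [(x & Hx & Px)|N].
  - now apply (IH x).
  - exists a. split; [exact Ha|split; [exact Pa|]]. intros x Hx Px. eauto.
Qed.

Definition least (phi : M -> Prop) : M :=
  the (fun m => ordinal m /\ phi m /\ forall x, x ∈ m -> ~ phi x).

#[global] Instance DefinableTerm_least (phi : M -> (nat -> M) -> Prop) :
  Definable (fun e => phi (e 0) (fun i => e (S i))) ->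
  DefinableTerm (fun e => least (fun x => phi x e)).
Proof. intros H. unfold least. exact _. Qed.

Lemma least_spec (phi : M -> Prop) {Hphi : Def1 phi} a : ordinal a -> phi a ->
  ordinal (least phi) /\ phi (least phi) /\ subset (least phi) a /\
  (forall x, x ∈ least phi -> ~ phi x).
Proof.
  intros Ha Pa.
  assert (K : ordinal (least phi) /\ phi (least phi) /\ forall x, x ∈ least phi -> ~ phi x).
  { apply (the_spec (fun m => ordinal m /\ phi m /\ forall x, x ∈ m -> ~ phi x)). destruct (least_exists phi a Ha Pa) as (m & Hm & Pm & Lm).
    exists m; split; [auto|]. intros m' (Hm' & Pm' & Lm').
    destruct (ordinal_trichotomy m m' Hm Hm') as [E|[E|E]]; [|exact E|].
    - now apply Lm' in E.
    - now apply Lm in E. }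
  destruct K as (H1 & H2 & H3).
  split; [exact H1|split; [exact H2|split; [|exact H3]]].
  apply not_lt_le; auto. intros L. now apply (H3 a).
Qed.

Lemma natural_ordinal n : natural n -> ordinal n.
Proof. now intros [H _]. Qed.

Lemma natural_mem n m : natural n -> m ∈ n -> natural m.
Proof.
  intros [H K] Hm. split; [now apply (ordinal_mem n)|].
  intros k Hk. apply K. left. destruct Hk as [Hk| ->]; [|exact Hm].
  now apply (ordinal_trans n m).
Qed.

Lemma natural_void : natural void.
Proof.
  split; [exact ordinal_void|]. intros m [H| ->]; left; intros x; rewrite ?in_void; try tauto.
  now rewrite in_void in H.
Qed.

Lemma natural_succ n : natural n -> natural (succ n).
Proof.
  intros [H K]. split; [now apply ordinal_succ|].
  intros m [Hm| ->].
  - apply K. now sets in Hm.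
  - right. exists n. intros z. now sets.
Qed.

Lemma natural_cases n : natural n -> n = void \/ exists m, natural m /\ n = succ m.
Proof.
  intros H. destruct (proj2 H n (or_intror eq_refl)) as [E|[m E]].
  - left. now apply is_empty_eq.
  - right. exists m. apply is_succ_eq in E. split; [|exact E].
    apply (natural_mem n); [exact H|]. rewrite E. sets. auto.
Qed.

Lemma natural_ind (phi : M -> Prop) {Hphi : Def1 phi} :
  phi void -> (forall n, natural n -> phi n -> phi (succ n)) -> forall n, natural n -> phi n.
Proof.
  intros H0 HS n Hn.
  apply (ordinal_ind (fun n => natural n -> phi n)); [|now apply natural_ordinal|exact Hn].
  intros a Ha IH Na. destruct (natural_cases a Na) as [-> |(m & Hm & ->)]; [exact H0|].
  apply HS; [exact Hm|]. apply IH; [sets; auto|exact Hm].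
Qed.

Definition omega : M := the is_omega.

Lemma in_omega n : n ∈ omega <-> natural n.
Proof.
  apply (the_set_spec natural).
  destruct (zf_infinity zf) as (w & (z & Ez & Hz) & Hs).
  exists (sep w natural). intros x. sets. split; [tauto|]. intros Hx; split; [|exact Hx].
  revert x Hx. apply (natural_ind (fun x => x ∈ w)).
  - now rewrite <- (is_empty_eq z Ez).
  - intros k _ Hk. destruct (Hs k Hk) as (s & Es & Hs'). now rewrite <- (is_succ_eq _ _ Es).
Qed.

Lemma is_omega_eq w : is_omega w -> w = omega.
Proof. intros H; apply set_ext; intros x. now rewrite (H x), in_omega. Qed.

Lemma ordinal_omega : ordinal omega.
Proof.
  apply ordinal_intro; intros x.
  - intros y H K. rewrite in_omega in H. apply in_omega. now apply (natural_mem x).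
  - rewrite in_omega. apply natural_ordinal.
Qed.

Lemma not_natural_le a : ordinal a -> ~ natural a -> subset omega a.
Proof.
  intros Ha N. apply not_lt_le; [exact ordinal_omega|exact Ha|]. now rewrite in_omega.
Qed.

End OrdinalTheory.
#[global] Opaque least omega.

(** * Finite sets and the pigeonhole principle *)

Section Finite.
Context {M : set_structure} {zf : ZF M}.
Implicit Types (a b c d f p q x y z m n : M).

Definition finite x : Prop := exists n, natural n /\ equipotent x n.

#[global] Instance definable_finite : DefinableRel1 finite.
Proof. definable_by finite. Qed.

Lemma finite_natural n : natural n -> finite n.
Proof. intros H; exists n; split; [exact H|apply equipotent_refl]. Qed.

Lemma finite_void : finite void.
Proof. apply finite_natural, natural_void. Qed.

Lemma equipotent_adj x b a : a ∉ x -> equipotent x b -> equipotent (adj a x) (succ b).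
Proof.
  intros H E. assert (N := mem_irrefl b). destruct (equipotent_elim x b E) as (F & HF & H1 & H2 & H3).
  assert (T : ite (a = a) b (F a) = b) by now apply ite_true.
  assert (U : forall z, z ∈ x -> ite (z = a) b (F z) = F z).
  { intros z Hz. apply ite_false. now intros ->. }
  assert (L : forall z, z ∈ x -> F z <> b).
  { intros z Hz K. apply N. rewrite <- K at 1. auto. }
  apply (equipotent_intro _ _ (fun z => ite (z = a) b (F z))).
  - intros z Hz. sets in Hz. sets. destruct Hz as [Hz| ->]; [|now rewrite T; auto].
    rewrite U; auto.
  - intros z z' Hz Hz'. sets in Hz. sets in Hz'.
    destruct Hz as [Hz| ->], Hz' as [Hz'| ->]; rewrite ?T, ?U by assumption; auto.
    + intros K. now apply L in K.
    + intros K. symmetry in K. now apply L in K.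
  - intros z Hz. sets in Hz. destruct Hz as [Hz| ->].
    + destruct (H3 z Hz) as (x0 & Hx0 & ->). exists x0. rewrite U by exact Hx0. sets. auto.
    + exists a. rewrite T. sets. auto.
Qed.

Lemma finite_adj x a : finite x -> finite (adj a x).
Proof.
  intros (n & Hn & E). destruct (classic (a ∈ x)) as [H|H].
  - replace (adj a x) with x; [exists n; auto|].
    apply set_ext; intros z. sets. split; [auto|]. intros [K| ->]; auto.
  - exists (succ n). split; [now apply natural_succ|].
    now apply equipotent_adj.
Qed.

Lemma adj_del x a : a ∈ x -> adj a (del a x) = x.
Proof.
  intros H. apply set_ext; intros z. sets. split; [intros [[K _]| ->]; auto|].
  intros K. destruct (classic (z = a)); auto.
Qed.

Lemma finite_ind (phi : M -> Prop) {Hphi : Def1 phi} :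
  phi void -> (forall x a, finite x -> phi x -> a ∉ x -> phi (adj a x)) ->
  forall x, finite x -> phi x.
Proof.
  intros H0 HS.
  assert (K : forall n, natural n -> forall x, equipotent x n -> phi x).
  { apply (natural_ind (fun n => forall x, equipotent x n -> phi x)).
    - intros x E. replace x with (void : M); [exact H0|]. symmetry. apply is_empty_eq.
      intros y Hy. destruct (equipotent_elim x void E) as (F & _ & H1 & _).
      apply (in_void (F y)). auto.
    - intros n Hn IH x E. destruct (equipotent_elim x (succ n) E) as (F & HF & H1 & H2 & H3).
      destruct (H3 n) as (a & Ha & En); [sets; auto|].
      assert (E' : equipotent (del a x) n).
      { apply (equipotent_intro _ _ F).
        - intros y Hy. sets in Hy. destruct Hy as [Hy Ny].
          specialize (H1 y Hy). sets in H1. destruct H1 as [H1|H1]; [exact H1|].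
          exfalso. apply Ny, H2; auto. congruence.
        - intros y y' Hy Hy'. sets in Hy. sets in Hy'. apply H2; tauto.
        - intros y Hy. destruct (H3 y) as (z & Hz & ->); [sets; auto|]. exists z. sets.
          split; [split; [exact Hz|]|reflexivity]. intros ->. rewrite <- En in Hy.
          now apply mem_irrefl in Hy. }
      rewrite <- (adj_del x a Ha). apply HS.
      + exists n; auto.
      + now apply IH.
      + sets. tauto. }
  intros x (n & Hn & E). now apply (K n).
Qed.

Lemma finite_subset x y : finite x -> subset y x -> finite y.
Proof.
  intros Hx. revert x Hx y.
  apply (finite_ind (fun x => forall y, subset y x -> finite y)).
  - intros y H. replace y with (void : M); [exact finite_void|].
    apply set_ext; intros z. split; [rewrite in_void; tauto|apply H].
  - intros x a Hx IH Na y Hy. destruct (classic (a ∈ y)) as [K|K].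
    + rewrite <- (adj_del y a K). apply finite_adj, IH.
      intros z Hz. sets in Hz. destruct Hz as [Hz N]. specialize (Hy z Hz). sets in Hy; tauto.
    + apply IH. intros z Hz. specialize (Hy z Hz). sets in Hy.
      destruct Hy as [Hy| ->]; [exact Hy|contradiction].
Qed.

Lemma finite_cup x y : finite x -> finite y -> finite (cup x y).
Proof.
  intros Hx Hy. revert x Hx. apply (finite_ind (fun x => finite (cup x y))).
  - replace (cup void y) with y; [exact Hy|]. apply set_ext; intros z. sets. tauto.
  - intros x a _ IH _. replace (cup (adj a x) y) with (adj a (cup x y)); [now apply finite_adj|].
    apply set_ext; intros z. sets. tauto.
Qed.

Lemma finite_image x (F : M -> M) {HF : Fun1 F} : finite x -> finite (image x F).
Proof.
  revert x. apply (finite_ind (fun x => finite (image x F))).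
  - replace (image void F) with (void : M); [exact finite_void|].
    apply set_ext; intros z. sets. split; [tauto|]. intros (x & Hx & _). now sets in Hx.
  - intros x a _ IH _. replace (image (adj a x) F) with (adj (F a) (image x F)); [now apply finite_adj|].
    apply set_ext; intros z. sets. split.
    + intros [(y & Hy & ->)| ->]; [exists y|exists a]; sets; auto.
    + intros (y & Hy & ->). sets in Hy. destruct Hy as [Hy| ->]; [left; eauto|auto].
Qed.

Lemma finite_bigcup x : finite x -> (forall y, y ∈ x -> finite y) -> finite (bigcup x).
Proof.
  intros Hx. revert x Hx.
  apply (finite_ind (fun x => (forall y, y ∈ x -> finite y) -> finite (bigcup x))).
  - intros _. replace (bigcup void) with (void : M); [exact finite_void|].
    apply set_ext; intros z. sets. split; [tauto|]. intros (y & Hy & _). now sets in Hy.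
  - intros x a _ IH _ H. replace (bigcup (adj a x)) with (cup (bigcup x) a).
    + apply finite_cup; [apply IH; intros y Hy|]; apply H; sets; auto.
    + apply set_ext; intros z. sets. split.
      * intros [(y & Hy & Hz)|Hz]; [exists y|exists a]; sets; auto.
      * intros (y & Hy & Hz). sets in Hy. destruct Hy as [Hy| ->]; eauto.
Qed.

Lemma finite_union x (F : M -> M) {HF : Fun1 F} :
  finite x -> (forall y, y ∈ x -> finite (F y)) -> finite (bigcup (image x F)).
Proof.
  intros Hx H. apply finite_bigcup; [now apply finite_image|].
  intros y Hy. sets in Hy. destruct Hy as (z & Hz & ->). auto.
Qed.

Lemma finite_single x : finite (single x).
Proof.
  apply (finite_subset (adj x void)); [apply finite_adj, finite_void|].
  intros z Hz. sets in Hz. sets. auto.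
Qed.

Lemma finite_power x : finite x -> finite (power x).
Proof.
  revert x. apply (finite_ind (fun x => finite (power x))).
  - apply (finite_subset (single void)); [apply finite_single|].
    intros z Hz. rewrite in_power in Hz. rewrite in_single. apply is_empty_eq.
    intros y Hy. apply Hz in Hy. now sets in Hy.
  - intros x a _ IH _.
    apply (finite_subset (cup (power x) (image (power x) (fun y => adj a y)))).
    + apply finite_cup; [exact IH|]. apply (finite_image (power x) (fun y => adj a y)). exact IH.
    + intros y Hy. sets in Hy. sets. destruct (classic (a ∈ y)) as [K|K].
      * right. exists (del a y). sets. split; [|now rewrite adj_del].
        intros z Hz. sets in Hz. destruct Hz as [Hz N]. specialize (Hy z Hz). sets in Hy; tauto.
      * left. intros z Hz. specialize (Hy z Hz). sets in Hy. destruct Hy as [Hy| ->]; tauto.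
Qed.

Lemma finite_embeds x y : embeds x y -> finite y -> finite x.
Proof.
  intros E Hy. destruct (embeds_elim x y E) as (F & HF & H1 & H2).
  apply (finite_subset (image y (inverse x F))); [apply (finite_image _ (fun z => inverse x F z)); exact Hy|].
  intros z Hz. sets. exists (F z). rewrite inverse_eq; auto.
Qed.

Lemma pigeonhole n : natural n -> forall m, m ∈ n -> ~ embeds n m.
Proof.
  revert n. apply (natural_ind (fun n => forall m, m ∈ n -> ~ embeds n m)).
  - intros m Hm. now sets in Hm.
  - intros n Hn IH m Hm E.
    assert (Nm : natural m) by (apply (natural_mem (succ n)); [now apply natural_succ|exact Hm]).
    destruct (embeds_elim _ _ E) as (F & HF & H1 & H2).
    destruct (natural_cases m Nm) as [-> |(k & Hk & ->)].
    { apply (in_void (F n)). apply H1. sets. auto. }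
    apply (IH k).
    { sets in Hm. destruct Hm as [Hm| <-]; [|sets; auto].
      apply (ordinal_trans n (succ k)); [now apply natural_ordinal|sets; auto|exact Hm]. }
    assert (T : forall x, x ∈ n -> F x = k -> ite (F x = k) (F n) (F x) = F n).
    { intros x _ Ex. now apply ite_true. }
    assert (U : forall x, x ∈ n -> F x <> k -> ite (F x = k) (F n) (F x) = F x).
    { intros x _ Ex. now apply ite_false. }
    assert (L : forall x, x ∈ n -> F x <> F n).
    { intros x Hx K. assert (E' : x = n) by (apply H2; sets; auto).
      subst x. now apply mem_irrefl in Hx. }
    (* The point that F maps to the last element k of [succ k] is redirected to [F n], a value no
       longer taken on n. This leaves an injection of n into k. *)
    apply (embeds_intro _ _ (fun x => ite (F x = k) (F n) (F x))).
    + intros x Hx. destruct (classic (F x = k)) as [Ex|Ex].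
      * rewrite T by assumption. assert (K : F n ∈ succ k) by (apply H1; sets; auto).
        sets in K. destruct K as [K|K]; [exact K|]. exfalso. apply (L x Hx). congruence.
      * rewrite U by assumption. assert (K : F x ∈ succ k) by (apply H1; sets; auto).
        sets in K. destruct K as [K|K]; [exact K|contradiction].
    + intros x x' Hx Hx'. 
      destruct (classic (F x = k)) as [Ex|Ex], (classic (F x' = k)) as [Ex'|Ex'];
        rewrite ?(T x), ?(T x'), ?(U x), ?(U x') by assumption; intros K.
      * apply H2; sets; auto. congruence.
      * exfalso. symmetry in K. now apply (L x' Hx') in K.
      * exfalso. now apply (L x Hx) in K.
      * apply H2; sets; auto.
Qed.

Lemma natural_equipotent_eq x n m : natural n -> natural m ->
  equipotent x n -> equipotent x m -> n = m.
Proof.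
  intros Hn Hm E E'.
  destruct (ordinal_trichotomy n m) as [L|[L|L]]; try now apply natural_ordinal.
  - exfalso. apply (pigeonhole m Hm n L), equipotent_embeds, (equipotent_trans _ x); auto.
    now apply equipotent_sym.
  - exact L.
  - exfalso. apply (pigeonhole n Hn m L), equipotent_embeds, (equipotent_trans _ x); auto.
    now apply equipotent_sym.
Qed.

Lemma succ_inj x y : succ x = succ y -> x = y.
Proof.
  intros E. assert (H1 : x ∈ succ y) by (rewrite <- E; sets; auto).
  assert (H2 : y ∈ succ x) by (rewrite E; sets; auto). sets in H1. sets in H2.
  destruct H1 as [H1|H1]; [|exact H1]. destruct H2 as [H2|H2]; [|now symmetry].
  exfalso. now apply (mem_asym x y).
Qed.

Lemma finite_no_embeds x a : finite x -> a ∈ x -> ~ embeds x (del a x).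
Proof.
  intros Hx Ha E.
  assert (Hd : finite (del a x)).
  { apply (finite_subset x); [exact Hx|]. intros z Hz. sets in Hz; tauto. }
  destruct Hd as (n & Hn & En). destruct (equipotent_elim _ _ En) as (F & HF & H1 & H2 & H3).
  apply (pigeonhole (succ n) (natural_succ n Hn) n); [sets; auto|].
  apply (embeds_trans _ x); [|apply (embeds_trans _ (del a x)); [exact E|now apply equipotent_embeds]].
  assert (E' := equipotent_sym _ _ En). destruct (equipotent_elim _ _ E') as (G & HG & G1 & G2 & G3).
  (* The additional point n goes to a, which the enumeration G of [del a x] misses; so [succ n]
     would embed in n. *)
  apply (embeds_intro _ _ (fun y => ite (y = n) a (G y))).
  - intros y Hy. sets in Hy. destruct Hy as [Hy| ->].
    + rewrite ite_false by (intros ->; now apply mem_irrefl in Hy). specialize (G1 y Hy). sets in G1; tauto.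
    + now rewrite ite_true.
  - assert (L : forall y, y ∈ n -> ite (y = n) a (G y) = G y).
    { intros y Hy. apply ite_false. intros ->; now apply mem_irrefl in Hy. }
    assert (N : forall y, y ∈ n -> G y <> a).
    { intros y Hy K. specialize (G1 y Hy). rewrite K in G1. sets in G1; tauto. }
    intros y y' Hy Hy'. sets in Hy. sets in Hy'.
    destruct Hy as [Hy| ->], Hy' as [Hy'| ->]; rewrite ?(ite_true (n = n)) by reflexivity.
    + rewrite (L y), (L y') by assumption. auto.
    + rewrite (L y) by assumption. intros K. now apply N in K.
    + rewrite (L y') by assumption. intros K. symmetry in K. now apply N in K.
    + auto.
Qed.

Lemma omega_infinite : ~ finite omega.
Proof.
  intros (n & Hn & E).
  apply (pigeonhole (succ n) (natural_succ n Hn) n); [sets; auto|].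
  apply (embeds_trans _ omega); [|now apply equipotent_embeds].
  apply subset_embeds. intros x Hx. apply in_omega.
  apply (natural_mem (succ n)); [now apply natural_succ|exact Hx].
Qed.

End Finite.

(** * Order types and finite sets of ordinals *)

Section OrderTypes.
Context {M : set_structure} {zf : ZF M}.
Implicit Types (a b c d f p q r s x y z m n : M).

(* The order type of s ∩ a. *)
Definition idx s a : M := wfrec (fun b => b) (fun b f => image (cap s b) (fun z => ap f z)) a.

#[global] Instance definable_idx : DefinableFun2 idx.
Proof. definable_by idx. Qed.

Lemma in_idx s a y : ordinal a -> y ∈ idx s a <-> exists z, z ∈ s /\ z ∈ a /\ y = idx s z.
Proof.
  intros Ha. unfold idx.
  rewrite (wfrec_eq ordinal (fun b => b) _ ordinal_pr ordinal_wf a Ha) at 1.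
  fold (idx s). sets. split.
  - intros (z & Hz & ->). sets in Hz. exists z. rewrite ap_graph; tauto || exact _.
  - intros (z & Hs & Hz & ->). exists z. sets. rewrite ap_graph; tauto || exact _.
Qed.

Lemma idx_ordinal s a : ordinal a -> ordinal (idx s a).
Proof.
  revert a. apply (ordinal_ind (fun a => ordinal (idx s a))).
  intros a Ha IH. apply ordinal_intro.
  - intros x y Hx Hy. rewrite in_idx in Hx by exact Ha. destruct Hx as (z & Hs & Hz & ->).
    rewrite in_idx in Hy by (now apply (ordinal_mem a)). destruct Hy as (w & Hs' & Hw & ->).
    rewrite in_idx by exact Ha. exists w. split; [exact Hs'|split; [|reflexivity]].
    now apply (ordinal_trans a z).
  - intros x Hx. rewrite in_idx in Hx by exact Ha. destruct Hx as (z & Hs & Hz & ->). auto.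
Qed.

Lemma idx_le s a : ordinal a -> subset (idx s a) a.
Proof.
  revert a. apply (ordinal_ind (fun a => subset (idx s a) a)).
  intros a Ha IH y Hy. rewrite in_idx in Hy by exact Ha. destruct Hy as (z & Hs & Hz & ->).
  apply (ordinal_le_lt_trans _ z); auto. apply idx_ordinal. now apply (ordinal_mem a).
Qed.

Lemma idx_lt s a z : ordinal a -> z ∈ s -> z ∈ a -> idx s z ∈ idx s a.
Proof. intros Ha Hs Hz. rewrite in_idx by exact Ha. eauto. Qed.

Lemma idx_mono s s' a : subset s s' -> ordinal a -> subset (idx s a) (idx s' a).
Proof.
  intros H. revert a. apply (ordinal_ind (fun a => subset (idx s a) (idx s' a))).
  intros a Ha IH y Hy. rewrite in_idx in Hy by exact Ha. destruct Hy as (z & Hs & Hz & ->).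
  assert (Oz : ordinal z) by now apply (ordinal_mem a).
  apply (ordinal_le_lt_trans _ (idx s' z)).
  - now apply idx_ordinal.
  - now apply idx_ordinal.
  - now apply IH.
  - apply idx_lt; auto.
Qed.

Lemma idx_inj s x y : ordinal x -> ordinal y -> x ∈ s -> y ∈ s -> idx s x = idx s y -> x = y.
Proof.
  intros Ox Oy Hx Hy E. destruct (ordinal_trichotomy x y Ox Oy) as [H|[H|H]]; [|exact H|].
  - apply (idx_lt s y x Oy Hx) in H. rewrite E in H. now apply mem_irrefl in H.
  - apply (idx_lt s x y Ox Hy) in H. rewrite E in H. now apply mem_irrefl in H.
Qed.

Lemma idx_equipotent s a : ordinal a -> equipotent (cap s a) (idx s a).
Proof.
  intros Ha. apply (equipotent_intro _ _ (idx s)).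
  - intros x Hx. sets in Hx. apply idx_lt; tauto.
  - intros x y Hx Hy. sets in Hx. sets in Hy.
    apply idx_inj; try tauto; apply (ordinal_mem a); tauto.
  - intros y Hy. rewrite in_idx in Hy by exact Ha. destruct Hy as (z & Hs & Hz & ->).
    exists z. sets. auto.
Qed.

Lemma idx_subset_equipotent s a : ordinal a -> subset s a -> equipotent s (idx s a).
Proof.
  intros Ha H. replace s with (cap s a) at 1; [now apply idx_equipotent|].
  apply set_ext; intros x. sets. split; [tauto|auto].
Qed.

Lemma idx_order_type s a : ordinal a -> subset s a -> has_order_type s (idx s a).
Proof.
  intros Ha H.
  assert (I : forall x x', x ∈ s -> x' ∈ s -> idx s x = idx s x' -> x = x').
  { intros x x' Hx Hx'. apply idx_inj; auto; apply (ordinal_mem a); auto. }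
  assert (V : forall y, y ∈ idx s a -> exists x, x ∈ s /\ y = idx s x).
  { intros y Hy. rewrite in_idx in Hy by exact Ha. destruct Hy as (x & Hx & _ & ->). eauto. }
  exists (graph (idx s a) (fun v => inverse s (idx s) v)). split; [split; [split|]|].
  - apply graph_function; [exact _|]. intros y Hy. destruct (V y Hy) as (x & Hx & ->).
    now rewrite inverse_eq.
  - intros x x' y. rewrite !app_graph by exact _. intros [Hx ->] [Hx' E].
    destruct (V x Hx) as (z & Hz & ->). destruct (V x' Hx') as (z' & Hz' & ->).
    rewrite !inverse_eq in E by assumption. congruence.
  - intros y Hy. exists (idx s y). rewrite app_graph by exact _.
    rewrite inverse_eq by assumption. split; [|split]; auto; apply idx_lt; auto.
  - intros x x' y y'. rewrite !app_graph by exact _. intros [Hx ->] [Hx' ->] L.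
    destruct (V x Hx) as (z & Hz & ->). destruct (V x' Hx') as (z' & Hz' & ->).
    rewrite !inverse_eq by assumption.
    assert (Oz : ordinal z) by (apply (ordinal_mem a); auto).
    assert (Oz' : ordinal z') by (apply (ordinal_mem a); auto).
    destruct (ordinal_trichotomy z z' Oz Oz') as [K|[-> |K]]; [exact K| |].
    + now apply mem_irrefl in L.
    + exfalso. apply (mem_asym _ _ L). now apply idx_lt.
Qed.

Lemma idx_ext s s' a : ordinal a -> (forall x, x ∈ a -> (x ∈ s <-> x ∈ s')) -> idx s a = idx s' a.
Proof.
  revert a. apply (ordinal_ind (fun a => (forall x, x ∈ a -> (x ∈ s <-> x ∈ s')) -> idx s a = idx s' a)).
  intros a Ha IH H.
  assert (K : forall z, z ∈ a -> idx s z = idx s' z).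
  { intros z Hz. apply IH; [exact Hz|]. intros x Hx. apply H. now apply (ordinal_trans a z). }
  apply set_ext; intros y. rewrite !in_idx by exact Ha.
  split; intros (z & Hs & Hz & ->); exists z; rewrite K by exact Hz; (split; [now apply H|auto]).
Qed.

Lemma idx_mono_r s a b : ordinal b -> ordinal a -> subset a b -> subset (idx s a) (idx s b).
Proof.
  intros Hb Ha S y Hy. rewrite in_idx in Hy by exact Ha. destruct Hy as (z & Hs & Hz & ->).
  apply idx_lt; auto.
Qed.

(** For an infinite set of ordinals these are its first omega elements, a canonical subset of order
    type omega. *)
Definition initial s : M := sep s (fun x => finite (cap s x)).

#[global] Instance definable_initial : DefinableFun1 initial.
Proof. definable_by initial. Qed.

Lemma in_initial s x : x ∈ initial s <-> x ∈ s /\ finite (cap s x).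
Proof. unfold initial. now sets. Qed.

Lemma initial_cap_finite s x : x ∈ initial s -> finite (cap (initial s) x).
Proof.
  intros H. apply in_initial in H. apply (finite_subset (cap s x)); [apply H|].
  intros y Hy. sets in Hy. destruct Hy as [Hy K]. apply in_initial in Hy. sets. tauto.
Qed.

(** If the initial part were finite, the least element outside it would have only elements of the
    initial part below it, and so would belong to it. *)
Lemma initial_infinite s a : ordinal a -> subset s a -> ~ finite s -> ~ finite (initial s).
Proof.
  intros Ha S N F. destruct (nonempty_ex (diff s (initial s))) as [x Hx].
  { intros Z. apply N, (finite_subset (initial s)); [exact F|].
    intros y Hy. apply NNPP; intros Ny. apply (in_void y). rewrite <- Z. now sets. }
  sets in Hx. destruct Hx as [Hx Nx].
  destruct (least_exists (fun x => x ∈ s /\ x ∉ initial s) x) as (m & Om & [Hm Nm] & Lm).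
  { apply (ordinal_mem a); [exact Ha|]. now apply S. }
  { split; assumption. }
  apply Nm, in_initial. split; [exact Hm|]. apply (finite_subset (initial s)); [exact F|].
  intros y Hy. sets in Hy. apply NNPP; intros Ny. apply (Lm y); tauto.
Qed.

Lemma finite_ordinal_natural a : ordinal a -> finite a -> natural a.
Proof.
  intros Ha Fa. apply NNPP; intros N. apply omega_infinite.
  apply (finite_subset a); [exact Fa|]. now apply not_natural_le.
Qed.

Lemma idx_omega s a : ordinal a -> ~ finite (cap s a) ->
  (forall x, x ∈ s -> x ∈ a -> finite (cap s x)) -> idx s a = omega.
Proof.
  intros Ha N F. apply subset_antisym.
  - intros y Hy. rewrite in_idx in Hy by exact Ha. destruct Hy as (z & Hs & Hz & ->).
    assert (Oz : ordinal z) by now apply (ordinal_mem a).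
    apply in_omega, finite_ordinal_natural; [now apply idx_ordinal|].
    apply (finite_embeds _ (cap s z)); [|now apply F].
    now apply equipotent_embeds, equipotent_sym, idx_equipotent.
  - apply not_natural_le; [now apply idx_ordinal|]. intros K. apply N.
    exists (idx s a). split; [exact K|now apply idx_equipotent].
Qed.

Lemma embeds_ordinal x b : ordinal b -> embeds x b ->
  exists c, ordinal c /\ subset c b /\ equipotent x c.
Proof.
  intros Hb E. destruct (embeds_elim x b E) as (F & HF & H1 & H2).
  exists (idx (image x F) b). split; [now apply idx_ordinal|split; [now apply idx_le|]].
  apply (equipotent_trans _ (image x F)); [now apply image_equipotent|].
  apply idx_subset_equipotent; [exact Hb|]. intros y Hy. sets in Hy. destruct Hy as (z & Hz & ->).
  auto.
Qed.

Lemma card_lt_ordinal x b : ordinal b -> card_lt x b -> exists c, c ∈ b /\ equipotent x c.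
Proof.
  intros Hb [E N]. destruct (embeds_ordinal x b Hb E) as (c & Hc & L & K).
  exists c. split; [|exact K]. destruct (ordinal_le_cases c b Hc Hb L) as [H| ->]; [exact H|].
  contradiction.
Qed.

Lemma card_lt_omega x : card_lt x omega <-> finite x.
Proof.
  split.
  - intros H. destruct (card_lt_ordinal x omega ordinal_omega H) as (n & Hn & E).
    exists n. now rewrite <- in_omega.
  - intros H. destruct H as (n & Hn & E). split.
    + apply (embeds_trans _ n); [now apply equipotent_embeds|].
      apply subset_embeds, ordinal_subset; [exact ordinal_omega|]. now apply in_omega.
    + intros K. apply omega_infinite. exists n. split; [exact Hn|].
      apply (equipotent_trans _ x); [now apply equipotent_sym|exact E].
Qed.

Lemma card_lt_natural x n : natural n -> card_lt x n <-> exists m, m ∈ n /\ equipotent x m.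
Proof.
  intros Hn. split.
  - apply card_lt_ordinal. now apply natural_ordinal.
  - intros (m & Hm & E). split.
    + apply (embeds_trans _ m); [now apply equipotent_embeds|].
      apply subset_embeds, ordinal_subset; [now apply natural_ordinal|exact Hm].
    + intros K. apply (pigeonhole n Hn m Hm). apply equipotent_embeds.
      apply (equipotent_trans _ x); [now apply equipotent_sym|exact E].
Qed.

Lemma card_lt_natural_mono x y n : natural n -> subset y x -> card_lt x n -> card_lt y n.
Proof.
  intros Hn S H. apply (card_lt_natural x n Hn) in H. destruct H as (m & Hm & E).
  assert (Om : ordinal m) by (apply (ordinal_mem n); [now apply natural_ordinal|exact Hm]).
  destruct (embeds_ordinal y m Om) as (c & Hc & L & K).
  - apply (embeds_trans _ x); [now apply subset_embeds|now apply equipotent_embeds].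
  - apply card_lt_natural; [exact Hn|]. exists c; split; [|exact K].
    apply (ordinal_le_lt_trans _ m); auto. now apply natural_ordinal.
Qed.

Lemma card_lt_natural_finite x n : natural n -> card_lt x n -> finite x.
Proof.
  intros Hn H. apply (card_lt_natural x n Hn) in H. destruct H as (m & Hm & E).
  exists m; split; [now apply (natural_mem n)|exact E].
Qed.

(** Having at least n elements is witnessed by a finite subset. This is what passes from a directed
    union of hulls down to a single hull. *)
Lemma not_card_lt_finite x n : natural n -> ~ card_lt x n ->
  exists y, finite y /\ subset y x /\ ~ card_lt y n.
Proof.
  intros Hn N. destruct (classic (finite x)) as [H|H].
  - exists x. split; [exact H|split; [|exact N]]. intros z; auto.
  - assert (K : exists y, subset y x /\ equipotent y n).
    { revert n Hn N. apply (natural_ind (fun n => ~ card_lt x n -> exists y, subset y x /\ equipotent y n)).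
      - intros _. exists void. split; [intros z Hz; now sets in Hz|apply equipotent_refl].
      - intros n Hn IH _. destruct IH as (y & Hy & E).
        { intros K. now apply H, (card_lt_natural_finite x n). }
        destruct (classic (exists z, z ∈ diff x y)) as [(z & Hz)|Nz].
        + sets in Hz. destruct Hz as [Hz Nz].
          exists (adj z y). split.
          { intros w Hw. sets in Hw. destruct Hw as [Hw| ->]; auto. }
          now apply equipotent_adj.
        + exfalso. apply H. exists n. split; [exact Hn|].
          replace x with y; [exact E|]. apply set_ext; intros z. split; [apply Hy|].
          intros Hz. apply NNPP; intros Nz'. apply Nz. exists z. now sets. }
    destruct K as (y & Hy & E). exists y. split; [now exists n|split; [exact Hy|]].
    intros K. destruct K as [_ K]. contradiction.
Qed.

End OrderTypes.
#[global] Opaque idx.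

(** * The well-order of the finite sets of ordinals *)

Section FiniteSubsets.
Context {M : set_structure} {zf : ZF M}.
Implicit Types (a b c d f p q r s x y z m n : M).

Definition Fin a : M := sep (power a) finite.

#[global] Instance definable_Fin : DefinableFun1 Fin.
Proof. definable_by Fin. Qed.

Lemma in_Fin a p : p ∈ Fin a <-> subset p a /\ finite p.
Proof. unfold Fin. now sets. Qed.

Lemma Fin_ordinal a p x : ordinal a -> p ∈ Fin a -> x ∈ p -> ordinal x.
Proof. intros Ha Hp Hx. apply in_Fin in Hp. apply (ordinal_mem a); [exact Ha|]. now apply Hp. Qed.

Lemma Fin_void a : void ∈ Fin a.
Proof. apply in_Fin. split; [intros x Hx; now sets in Hx|apply finite_void]. Qed.

Lemma Fin_adj a p x : p ∈ Fin a -> x ∈ a -> adj x p ∈ Fin a.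
Proof.
  rewrite !in_Fin. intros [H K] Hx. split; [|now apply finite_adj].
  intros y Hy. sets in Hy. destruct Hy as [Hy| ->]; auto.
Qed.

Lemma Fin_subset a p q : p ∈ Fin a -> subset q p -> q ∈ Fin a.
Proof.
  rewrite !in_Fin. intros [H K] Hq. split; [intros x; auto|now apply (finite_subset p)].
Qed.

Lemma finite_max s : finite s -> (forall x, x ∈ s -> ordinal x) -> (exists x, x ∈ s) ->
  exists m, m ∈ s /\ subset s (succ m).
Proof.
  intros Hs. revert s Hs.
  apply (finite_ind (fun s => (forall x, x ∈ s -> ordinal x) -> (exists x, x ∈ s) ->
    exists m, m ∈ s /\ subset s (succ m))).
  - intros _ [x Hx]. now sets in Hx.
  - intros s a _ IH _ H _. destruct (classic (exists x, x ∈ s)) as [N|N].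
    + destruct IH as (m & Hm & K); [intros x Hx; apply H; sets; auto|exact N|].
      assert (Om : ordinal m) by (apply H; sets; auto).
      assert (Oa : ordinal a) by (apply H; sets; auto).
      destruct (ordinal_trichotomy a m Oa Om) as [L|[-> |L]].
      * exists m. sets. split; [auto|]. intros x Hx. sets in Hx. destruct Hx as [Hx| ->]; [auto|].
        sets. auto.
      * exists m. sets. split; [auto|]. intros x Hx. sets in Hx. destruct Hx as [Hx| ->]; [auto|].
        sets. auto.
      * exists a. sets. split; [auto|]. intros x Hx. sets in Hx. sets. destruct Hx as [Hx| ->]; [|auto].
        left. specialize (K x Hx). sets in K. destruct K as [K| ->]; [|exact L].
        now apply (ordinal_trans a m).
    + exists a. sets. split; [auto|]. intros x Hx. sets in Hx. sets.
      destruct Hx as [Hx| ->]; [exfalso; eauto|auto].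
Qed.

(** This is the order of the ordinals with base 2 expansion given by p, that is, of the sums of the
    powers 2^x for x in p. *)
Definition fin_lt q p : Prop :=
  exists a, a ∈ p /\ a ∉ q /\ forall b, a ∈ b -> (b ∈ q <-> b ∈ p).

#[global] Instance definable_fin_lt : DefinableRel2 fin_lt.
Proof. definable_by fin_lt. Qed.

Lemma fin_lt_irrefl p : ~ fin_lt p p.
Proof. intros (a & H & K & _). contradiction. Qed.

Lemma fin_lt_trans d p q r : ordinal d -> p ∈ Fin d -> q ∈ Fin d -> r ∈ Fin d ->
  fin_lt p q -> fin_lt q r -> fin_lt p r.
Proof.
  intros Hd Hp Hq Hr (a & Ha & Na & Ka) (b & Hb & Nb & Kb).
  assert (Oa : ordinal a) by now apply (Fin_ordinal d q).
  assert (Ob : ordinal b) by now apply (Fin_ordinal d r).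
  assert (T : forall x y z, z ∈ p \/ z ∈ q \/ z ∈ r -> x ∈ y -> y ∈ z -> x ∈ z).
  { intros x y z Hz Hx Hy. apply (ordinal_trans z y); auto.
    destruct Hz as [Hz|[Hz|Hz]]; [apply (Fin_ordinal d p)|apply (Fin_ordinal d q)|apply (Fin_ordinal d r)]; assumption. }
  destruct (ordinal_trichotomy a b Oa Ob) as [L|[-> |L]]; [| contradiction |].
  - exists b. split; [exact Hb|split].
    + intros K. apply Nb. now apply Ka.
    + intros c Hc. split; intros K.
      * apply (Kb c Hc), Ka; eauto.
      * apply Ka; [|now apply Kb]. eauto.
  - exists a. split; [now apply Kb|split; [exact Na|]].
    intros c Hc. split; intros K.
    + apply Kb; [|now apply Ka]. eauto.
    + apply (Ka c Hc), Kb; eauto.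
Qed.

Lemma fin_lt_total d p q : ordinal d -> p ∈ Fin d -> q ∈ Fin d ->
  fin_lt p q \/ p = q \/ fin_lt q p.
Proof.
  intros Hd Hp Hq.
  set (s := cup (diff p q) (diff q p)).
  assert (Os : forall x, x ∈ s -> ordinal x).
  { intros x Hx. unfold s in Hx. sets in Hx.
    destruct Hx as [[Hx _]|[Hx _]]; [apply (Fin_ordinal d p)|apply (Fin_ordinal d q)]; assumption. }
  destruct (classic (exists x, x ∈ s)) as [N|N].
  - destruct (finite_max s) as (m & Hm & K); auto.
    { apply finite_cup; [apply (finite_subset p)|apply (finite_subset q)];
        try (now apply in_Fin in Hp); try (now apply in_Fin in Hq); intros x Hx; sets in Hx; tauto. }
    assert (A : forall b, m ∈ b -> (b ∈ p <-> b ∈ q)).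
    { intros b Hb. apply NNPP; intros Nb.
      assert (Hs : b ∈ s) by (unfold s; sets; tauto).
      apply K in Hs. sets in Hs. destruct Hs as [Hs| ->].
      - now apply (mem_asym m b).
      - now apply mem_irrefl in Hb. }
    unfold s in Hm. sets in Hm. destruct Hm as [[Hm Nm]|[Hm Nm]].
    + right; right. exists m. split; [exact Hm|split; [exact Nm|]].
      intros b Hb. symmetry; auto.
    + left. exists m. auto.
  - right; left. apply set_ext; intros x. apply NNPP; intros Nx. apply N. exists x.
    unfold s. sets. tauto.
Qed.

(** A minimal member must have the least possible maximum a. Deleting a from the members with this
    maximum leaves finite subsets of a, to which the induction hypothesis applies. *)
Lemma fin_lt_wf d : ordinal d -> forall s, (forall p, p ∈ s -> p ∈ Fin d) -> (exists p, p ∈ s) ->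
  exists p, p ∈ s /\ forall q, q ∈ s -> ~ fin_lt q p.
Proof.
  revert d. apply (ordinal_ind (fun d => forall s, (forall p, p ∈ s -> p ∈ Fin d) ->
    (exists p, p ∈ s) -> exists p, p ∈ s /\ forall q, q ∈ s -> ~ fin_lt q p)).
  intros d Hd IH s Hs [p0 Hp0].
  destruct (classic (void ∈ s)) as [V|V].
  { exists void. split; [exact V|]. intros q _ (a & Ha & _). now sets in Ha. }
  assert (Mx : forall p, p ∈ s -> exists a, a ∈ p /\ a ∈ d /\ subset p (succ a)).
  { intros p Hp. destruct (finite_max p) as (m & Hm & K).
    - now apply in_Fin with d, Hs.
    - intros x Hx. apply (Fin_ordinal d p); auto.
    - apply nonempty_ex. intros ->. contradiction.
    - exists m. split; [exact Hm|split; [|exact K]]. apply Hs in Hp. apply in_Fin in Hp. now apply Hp. }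
  destruct (Mx p0 Hp0) as (a0 & Ha0 & Hd0 & Sa0).
  destruct (least_exists (fun a => exists p, p ∈ s /\ a ∈ p /\ subset p (succ a)) a0)
    as (a & Oa & (p1 & Hp1 & Ha1 & Sa1) & La).
  { now apply (ordinal_mem d). }
  { exists p0; auto. }
  assert (Had : a ∈ d). { apply Hs in Hp1. apply in_Fin in Hp1. now apply Hp1. }
  set (s' := sep s (fun p => a ∈ p /\ subset p (succ a))).
  destruct (IH a Had (image s' (fun p => del a p))) as (t & Ht & Kt).
  - intros t Ht. sets in Ht. destruct Ht as (p & Hp & ->). unfold s' in Hp. sets in Hp.
    destruct Hp as (Hp & Hap & Sp). apply in_Fin. split.
    + intros x Hx. sets in Hx. destruct Hx as [Hx Nx]. apply Sp in Hx. sets in Hx. tauto.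
    + apply (finite_subset p); [now apply in_Fin with d, Hs|]. intros x Hx. sets in Hx. tauto.
  - exists (del a p1). sets. exists p1. split; [|reflexivity]. unfold s'. sets. auto.
  - sets in Ht. destruct Ht as (p & Hp & ->). unfold s' in Hp. sets in Hp.
    destruct Hp as (Hp & Hap & Sp). exists p. split; [exact Hp|].
    intros q Hq (b & Hb & Nb & Kb).
    assert (Hb' := Sp b Hb). sets in Hb'. destruct Hb' as [Hb'| ->].
    + assert (Haq : a ∈ q) by now apply Kb.
      assert (Sq : subset q (succ a)).
      { intros x Hx. apply NNPP; intros Nx. sets in Nx.
        assert (Ox : ordinal x) by (apply (Fin_ordinal d q); auto).
        destruct (ordinal_trichotomy x a Ox Oa) as [L|[L|L]]; [tauto|tauto|].
        assert (Hxp : x ∈ p). { apply Kb; [|exact Hx]. now apply (ordinal_trans x a). }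
        apply Sp in Hxp. sets in Hxp. tauto. }
      apply (Kt (del a q)).
      * sets. exists q. split; [|reflexivity]. unfold s'. sets. auto.
      * exists b. sets. split; [|split; [tauto|]].
        -- split; [exact Hb|]. intros ->. now apply mem_irrefl in Hb'.
        -- intros c Hc. sets. rewrite (Kb c Hc). tauto.
    + destruct (Mx q Hq) as (c & Hc & Hcd & Sc).
      assert (Oc : ordinal c) by now apply (ordinal_mem d).
      apply (La c); [|eauto]. destruct (ordinal_trichotomy c a Oc Oa) as [L|[-> |L]]; [exact L|contradiction|].
      exfalso. assert (Hcp : c ∈ p) by now apply Kb.
      apply Sp in Hcp. sets in Hcp. destruct Hcp as [Hcp| ->]; [|contradiction].
      now apply (mem_asym c a).
Qed.

End FiniteSubsets.
#[global] Opaque Fin.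

(** * Coding finite sets below an infinite cardinal *)

Section Coding.
Context {M : set_structure} {zf : ZF M}.
Implicit Types (a b c d f p q r s x y z m n : M).

Lemma cardinal_no_embeds k b : cardinal k -> b ∈ k -> ~ embeds k b.
Proof.
  intros [Hk K] Hb E.
  assert (Ob : ordinal b) by now apply (ordinal_mem k).
  destruct (embeds_ordinal k b Ob E) as (c & Oc & L & Q).
  apply (K c); [|now apply equipotent_sym]. now apply (ordinal_le_lt_trans c b).
Qed.

Lemma infinite_ordinal_omega a : ordinal a -> ~ finite a -> subset omega a.
Proof.
  intros Ha N. apply not_natural_le; [exact Ha|]. intros K. now apply N, finite_natural.
Qed.

(** Points go to singletons and the new top to the empty set. It shows that an infinite cardinal is
    not a successor ordinal. *)
Lemma succ_embeds b : embeds (Fin b) b -> embeds (succ b) b.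
Proof.
  intros E. apply (embeds_trans _ (Fin b)); [|exact E].
  assert (T : ite (b = b) void (single b) = void) by now apply ite_true.
  assert (U : forall x, x ∈ b -> ite (x = b) void (single x) = single x).
  { intros x Hx. apply ite_false. intros ->. now apply mem_irrefl in Hx. }
  assert (N : forall x, single x <> void).
  { intros x K. apply (in_void x). rewrite <- K. now sets. }
  apply (embeds_intro _ _ (fun x => ite (x = b) void (single x))).
  - intros x Hx. sets in Hx. destruct Hx as [Hx| ->].
    + rewrite U by exact Hx. apply in_Fin. split; [|apply finite_single].
      intros y Hy. sets in Hy. now subst y.
    + rewrite T. apply Fin_void.
  - intros x y Hx Hy. sets in Hx. sets in Hy. destruct Hx as [Hx| ->], Hy as [Hy| ->].
    + rewrite (U x), (U y) by assumption. intros K.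
      assert (L : x ∈ single y) by (rewrite <- K; now sets). now sets in L.
    + rewrite T, (U x) by assumption. intros K. now apply N in K.
    + rewrite T, (U y) by assumption. intros K. symmetry in K. now apply N in K.
    + reflexivity.
Qed.

Lemma embeds_Fin a b : embeds a b -> embeds (Fin a) (Fin b).
Proof.
  intros E. destruct (embeds_elim a b E) as (F & HF & H1 & H2).
  assert (L : forall p q, p ∈ Fin a -> q ∈ Fin a -> image p F = image q F -> subset p q).
  { intros p q Hp Hq Ex x Hx. apply in_Fin in Hp. apply in_Fin in Hq.
    assert (K : F x ∈ image q F) by (rewrite <- Ex; sets; eauto).
    sets in K. destruct K as (y & Hy & Exy). apply H2 in Exy; [subst y; exact Hy| |].
    - now apply Hp. - now apply Hq. }
  apply (embeds_intro _ _ (fun p => image p F)).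
  - intros p Hp. apply in_Fin in Hp. destruct Hp as [Hp Fp]. apply in_Fin. split.
    + intros y Hy. sets in Hy. destruct Hy as (x & Hx & ->). auto.
    + now apply (finite_image p F).
  - intros p q Hp Hq Ex. apply subset_antisym; apply L; auto.
Qed.

(** Only an infinite cardinal d needs an argument, other ordinals being equipotent to smaller ones.
    There [fin_lt] has order type at most d, because an initial segment consists of finite subsets
    of one ordinal below d and is controlled by the induction hypothesis. *)
Theorem Fin_embeds d : ordinal d -> ~ finite d -> embeds (Fin d) d.
Proof.
  revert d. apply (ordinal_ind (fun d => ~ finite d -> embeds (Fin d) d)).
  intros d Hd IH I.
  destruct (classic (exists b, b ∈ d /\ equipotent b d)) as [(b & Hb & E)|N].
  { apply (embeds_trans _ (Fin b)).
    - apply embeds_Fin, equipotent_embeds, equipotent_sym, E.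
    - apply (embeds_trans _ b).
      + apply IH; [exact Hb|]. intros (n & Hn & E'). apply I. exists n. split; [exact Hn|].
        apply (equipotent_trans _ b); [now apply equipotent_sym|exact E'].
      + apply subset_embeds, ordinal_subset; auto. }
  assert (C : cardinal d).
  { split; [exact Hd|]. intros b Hb E. apply N. exists b; auto. }
  set (pr := fun p => sep (Fin d) (fun q => fin_lt q p)).
  assert (Hpr : Fun1 pr) by (unfold pr; exact _).
  assert (in_pr : forall p q, q ∈ pr p <-> q ∈ Fin d /\ fin_lt q p).
  { intros p q. unfold pr. now sets. }
  (* The rank of a finite set in [fin_lt]. *)
  set (r := wfrec pr (fun p f => image (pr p) (fun q => ap f q))).
  assert (Hr : Fun1 r) by (unfold r; exact _).
  assert (cl : forall p q, p ∈ Fin d -> q ∈ pr p -> q ∈ Fin d /\ subset (pr q) (pr p)).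
  { intros p q Hp Hq. rewrite in_pr in Hq. destruct Hq as [Hq L]. split; [exact Hq|].
    intros t Ht. rewrite in_pr in Ht |- *. split; [tauto|].
    now apply (fin_lt_trans d t q p). }
  assert (wf : forall s, (forall p, p ∈ s -> p ∈ Fin d) -> (exists p, p ∈ s) ->
     exists p, p ∈ s /\ forall q, q ∈ s -> q ∉ pr p).
  { intros s Hs Ns. destruct (fin_lt_wf d Hd s Hs Ns) as (p & Hp & K).
    exists p. split; [exact Hp|]. intros q Hq. rewrite in_pr. intros [_ L]. now apply (K q). }
  assert (in_r : forall p v, p ∈ Fin d -> v ∈ r p <-> exists q, q ∈ Fin d /\ fin_lt q p /\ v = r q).
  { intros p v Hp. unfold r.
    rewrite (wfrec_eq (fun p => p ∈ Fin d) pr _ cl wf p Hp) at 1. fold r. sets. split.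
    - intros (q & Hq & ->). rewrite ap_graph by (exact _ || exact Hq). rewrite in_pr in Hq.
      exists q; tauto.
    - intros (q & Hq & L & ->). assert (K : q ∈ pr p) by now rewrite in_pr.
      exists q. split; [exact K|]. now rewrite ap_graph. }
  assert (r_ord : forall p, p ∈ Fin d -> ordinal (r p)).
  { apply (wf_ind (fun p => p ∈ Fin d) pr cl wf (fun p => ordinal (r p))).
    intros p Hp IHp. apply ordinal_intro.
    - intros x y Hx Hy. apply in_r in Hx; [|exact Hp]. destruct Hx as (q & Hq & L & ->).
      apply in_r in Hy; [|exact Hq]. destruct Hy as (t & Ht & L' & ->). apply in_r; [exact Hp|].
      exists t. split; [exact Ht|split; [|reflexivity]]. now apply (fin_lt_trans d t q p).
    - intros x Hx. apply in_r in Hx; [|exact Hp]. destruct Hx as (q & Hq & L & ->).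
      apply IHp. now rewrite in_pr. }
  assert (r_lt : forall p q, p ∈ Fin d -> q ∈ Fin d -> fin_lt q p -> r q ∈ r p).
  { intros p q Hp Hq L. apply in_r; [exact Hp|]. eauto. }
  assert (r_inj : forall p q, p ∈ Fin d -> q ∈ Fin d -> r p = r q -> p = q).
  { intros p q Hp Hq E. destruct (fin_lt_total d p q Hd Hp Hq) as [L|[L|L]]; [|exact L|].
    - apply r_lt in L; auto. rewrite E in L. now apply mem_irrefl in L.
    - apply r_lt in L; auto. rewrite E in L. now apply mem_irrefl in L. }
  apply (embeds_intro _ _ r); [|exact r_inj].
  (* If the rank of p reached d, then d would embed in the set of predecessors of p, which are
     finite subsets of [succ b] for the maximum b of p. *)
  intros p Hp. apply NNPP; intros Np.
  assert (L : subset d (r p)) by (apply not_lt_le; auto).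
  assert (E : embeds d (pr p)).
  { apply (embeds_intro _ _ (fun v => inverse (pr p) r v)).
    - intros v Hv. apply L, in_r in Hv; [|exact Hp]. destruct Hv as (q & Hq & Lq & ->).
      assert (K : q ∈ pr p) by (rewrite in_pr; auto).
      rewrite inverse_eq; auto. intros x x' Hx Hx'. rewrite in_pr in Hx, Hx'. apply r_inj; tauto.
    - intros v v' Hv Hv'. apply L, in_r in Hv; [|exact Hp]. apply L, in_r in Hv'; [|exact Hp].
      destruct Hv as (q & Hq & Lq & ->). destruct Hv' as (q' & Hq' & Lq' & ->).
      rewrite !inverse_eq; try (rewrite in_pr; auto);
        try (intros x x' Hx Hx'; rewrite in_pr in Hx, Hx'; apply r_inj; tauto).
      now intros ->. }
  assert (Fp := proj2 (proj1 (in_Fin d p) Hp)).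
  destruct (finite_max p Fp) as (b & Hb & Sb).
  { intros x Hx. now apply (Fin_ordinal d p). }
  { apply nonempty_ex. intros ->. apply I. apply (finite_embeds d (pr void) E).
    apply (finite_subset void); [apply finite_void|].
    intros q Hq. apply in_pr in Hq. destruct Hq as (_ & a & Ha & _). now sets in Ha. }
  assert (Hbd : b ∈ d). { apply in_Fin in Hp. now apply Hp. }
  assert (Os : ordinal (succ b)) by now apply ordinal_succ, (ordinal_mem d).
  assert (Hsd : succ b ∈ d).
  { destruct (ordinal_le_cases (succ b) d Os Hd) as [L'|E']; [|exact L'|].
    - intros x Hx. sets in Hx. destruct Hx as [Hx| ->]; [|exact Hbd]. now apply (ordinal_trans d b).
    - exfalso. apply (cardinal_no_embeds d b C Hbd). rewrite <- E' at 1.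
      apply succ_embeds, IH; [exact Hbd|]. intros Fb. apply I. rewrite <- E'.
      exact (finite_adj b b Fb). }
  assert (S : subset (pr p) (Fin (succ b))).
  { intros q Hq. rewrite in_pr in Hq. destruct Hq as [Hq (a & Ha & Na & Ka)].
    apply in_Fin. split; [|now apply in_Fin in Hq].
    intros x Hx. apply NNPP; intros Nx.
    assert (Ox : ordinal x) by now apply (Fin_ordinal d q).
    assert (Ob : ordinal b) by now apply (ordinal_mem d).
    assert (Hbx : b ∈ x).
    { destruct (ordinal_trichotomy x b Ox Ob) as [K|[K|K]]; [| |exact K]; exfalso; apply Nx; sets; auto. }
    assert (Hax : a ∈ x).
    { apply Sb in Ha. sets in Ha. destruct Ha as [Ha| ->]; [|exact Hbx]. now apply (ordinal_trans x b). }
    apply Nx, Sb. now apply (Ka x). }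
  assert (E' : embeds d (Fin (succ b))).
  { apply (embeds_trans _ (pr p)); [exact E|now apply subset_embeds]. }
  destruct (classic (finite (succ b))) as [Fb|Fb].
  - apply I. apply (finite_embeds _ _ E'). apply (finite_subset (power (succ b))).
    + now apply finite_power.
    + intros q Hq. apply in_Fin in Hq. sets. tauto.
  - apply (cardinal_no_embeds d (succ b) C Hsd).
    apply (embeds_trans _ _ _ E'). now apply IH.
Qed.

(* Kuratowski pairs over d are sets in Fin (Fin d). *)
Lemma coding_functions d : ordinal d -> ~ finite d ->
  exists (J : M -> M) (J2 : M -> M -> M), Fun1 J /\ Fun2 J2 /\
    (forall p, p ∈ Fin d -> J p ∈ d) /\
    (forall p q, p ∈ Fin d -> q ∈ Fin d -> J p = J q -> p = q) /\
    (forall x y, x ∈ d -> y ∈ d -> J2 x y ∈ d) /\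
    (forall x y x' y', x ∈ d -> y ∈ d -> x' ∈ d -> y' ∈ d ->
       J2 x y = J2 x' y' -> x = x' /\ y = y').
Proof.
  intros Hd I. destruct (embeds_elim _ _ (Fin_embeds d Hd I)) as (J & HJ & J1 & Ji).
  assert (U : forall x y, x ∈ d -> y ∈ d -> upair x y ∈ Fin d).
  { intros x y Hx Hy. apply in_Fin. split.
    - intros z Hz. sets in Hz. destruct Hz as [-> | ->]; auto.
    - apply (finite_subset (adj y (single x))); [apply finite_adj, finite_single|].
      intros z Hz. sets in Hz. sets. tauto. }
  assert (D : Fun2 (fun x y => J (upair (J (upair x x)) (J (upair x y))))) by exact _.
  exists J, (fun x y => J (upair (J (upair x x)) (J (upair x y)))).
  split; [exact HJ|split; [exact D|split; [exact J1|split; [exact Ji|split]]]].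
  - auto 10.
  - intros x y x' y' Hx Hy Hx' Hy' E. apply opair_inj.
    Transparent opair single. unfold opair, single. Opaque opair single.
    apply Ji in E; auto.
    apply upair_inj in E as [[E1 E2]|[E1 E2]]; apply Ji in E1; auto; apply Ji in E2; auto.
    + congruence.
    + rewrite E1, E2. apply set_ext; intros z; sets. tauto.
Qed.

(** The code of y pairs the finite set of codes of the members of [e y] with [c y]. Recursion keeps
    codes below d; by induction the codes of the members determine [e y], and then y. *)
Theorem embeds_by_code d s (pr e c : M -> M) {Hpr : Fun1 pr} {He : Fun1 e} {Hc : Fun1 c} :
  ordinal d -> ~ finite d ->
  (forall p q, p ∈ s -> q ∈ pr p -> q ∈ s /\ subset (pr q) (pr p)) ->
  (forall t, (forall p, p ∈ t -> p ∈ s) -> (exists p, p ∈ t) ->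
    exists p, p ∈ t /\ forall q, q ∈ t -> q ∉ pr p) ->
  (forall y, y ∈ s -> finite (e y) /\ subset (e y) (pr y) /\ c y ∈ d) ->
  (forall y y', y ∈ s -> y' ∈ s -> e y = e y' -> c y = c y' -> y = y') ->
  embeds s d.
Proof.
  intros Hd I cl wf H inj.
  destruct (coding_functions d Hd I) as (J & J2 & HJ & HJ2 & J1 & Ji & J21 & J2i).
  set (g := wfrec pr (fun y f => J2 (J (image (e y) (fun z => ap f z))) (c y))).
  assert (Hg : Fun1 g) by (unfold g; exact _).
  assert (gE : forall y, y ∈ s -> g y = J2 (J (image (e y) g)) (c y)).
  { intros y Hy. unfold g.
    rewrite (wfrec_eq (fun y => y ∈ s) pr _ cl wf y Hy) at 1. fold g. f_equal. f_equal.
    apply set_ext; intros v. sets.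
    assert (K : forall z, z ∈ e y -> ap (graph (pr y) g) z = g z).
    { intros z Hz. apply ap_graph; [exact _|]. now apply (H y Hy). }
    split; intros (z & Hz & ->); exists z; rewrite K by exact Hz; auto. }
  assert (gd : forall y, y ∈ s -> g y ∈ d).
  { apply (wf_ind (fun y => y ∈ s) pr cl wf (fun y => g y ∈ d)).
    intros y Hy IH. rewrite gE by exact Hy. destruct (H y Hy) as (H1 & H2 & H3).
    apply J21; [|exact H3]. apply J1, in_Fin. split; [|now apply (finite_image (e y) g)].
    intros v Hv. sets in Hv. destruct Hv as (z & Hz & ->). auto. }
  apply (embeds_intro _ _ g); [exact gd|].
  intros x x' Hx Hx'. revert x' Hx'. revert x Hx.
  apply (wf_ind (fun y => y ∈ s) pr cl wf (fun y => forall x', x' ∈ s -> g y = g x' -> y = x')).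
  intros y Hy IH x' Hx' E. rewrite !gE in E by assumption.
  destruct (H y Hy) as (H1 & H2 & H3). destruct (H x' Hx') as (H1' & H2' & H3').
  assert (S : forall y, y ∈ s -> image (e y) g ∈ Fin d).
  { intros z Hz. destruct (H z Hz) as (K1 & K2 & _). apply in_Fin.
    split; [|now apply (finite_image (e z) g)].
    intros v Hv. sets in Hv. destruct Hv as (w & Hw & ->). apply gd. apply (cl z); auto. }
  apply J2i in E; auto. destruct E as [E Ec]. apply Ji in E; auto.
  apply inj; auto. apply set_ext; intros z. split; intros Hz.
  - assert (K : g z ∈ image (e x') g) by (rewrite <- E; sets; eauto).
    sets in K. destruct K as (w & Hw & Ew). apply IH in Ew; [now subst w|auto|].
    apply (cl x'); auto.
  - assert (K : g z ∈ image (e y) g) by (rewrite E; sets; eauto).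
    sets in K. destruct K as (w & Hw & Ew). symmetry in Ew. apply IH in Ew; [now subst w|auto|].
    apply (cl x'); auto.
Qed.

End Coding.

(** * Sets smaller than an infinite cardinal *)

Section Small.
Context {M : set_structure} {zf : ZF M}.
Implicit Types (a b c d f p q r s x y z m n : M).

Definition small k x : Prop := exists b, b ∈ k /\ embeds x b.

#[global] Instance definable_small : DefinableRel2 small.
Proof. definable_by small. Qed.

Variable k : M.
Hypothesis Hk : infinite_cardinal k.

Lemma k_ordinal : ordinal k.
Proof. apply Hk. Qed.

Lemma k_infinite : ~ finite k.
Proof. apply Hk. Qed.

Lemma omega_le_k : subset omega k.
Proof. apply infinite_ordinal_omega; [exact k_ordinal|exact k_infinite]. Qed.

Lemma k_succ b : b ∈ k -> succ b ∈ k.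
Proof.
  intros Hb. assert (Ob := ordinal_mem k b k_ordinal Hb).
  destruct (classic (finite b)) as [Fb|Nb].
  - apply omega_le_k, in_omega, finite_ordinal_natural; [now apply ordinal_succ|].
    exact (finite_adj b b Fb).
  - destruct (ordinal_le_cases (succ b) k (ordinal_succ b Ob) k_ordinal) as [L|E]; [|exact L|].
    + intros x Hx. sets in Hx. destruct Hx as [Hx| ->]; [|exact Hb].
      now apply (ordinal_trans k b); [exact k_ordinal| |].
    + exfalso. apply (cardinal_no_embeds k b (proj1 Hk) Hb). rewrite <- E at 1.
      now apply succ_embeds, Fin_embeds.
Qed.

Lemma k_mem_ordinal x : x ∈ k -> ordinal x.
Proof. apply ordinal_mem, k_ordinal. Qed.

Lemma k_not_small : ~ small k k.
Proof. intros (b & Hb & E). now apply (cardinal_no_embeds k b (proj1 Hk)). Qed.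

Lemma small_embeds x y : embeds x y -> small k y -> small k x.
Proof. intros E (b & Hb & E'). exists b. split; [exact Hb|]. now apply (embeds_trans x y). Qed.

Lemma small_subset x y : subset x y -> small k y -> small k x.
Proof. intros S. now apply small_embeds, subset_embeds. Qed.

Lemma small_mem b : b ∈ k -> small k b.
Proof. intros H; exists b; split; [exact H|]. apply subset_embeds. intros x; auto. Qed.

Lemma small_finite x : finite x -> small k x.
Proof.
  intros (n & Hn & E). exists n. split; [|now apply equipotent_embeds].
  apply omega_le_k. now apply in_omega.
Qed.

Lemma small_idx h : subset h k -> small k h <-> idx h k ∈ k.
Proof.
  intros S. assert (E := idx_subset_equipotent h k k_ordinal S). split.
  - intros (b & Hb & B).
    destruct (ordinal_le_cases (idx h k) k (idx_ordinal h k k_ordinal) k_ordinal (idx_le h k k_ordinal)) as [L|L]; [exact L|].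
    exfalso. apply (cardinal_no_embeds k b (proj1 Hk) Hb).
    apply (embeds_trans _ h); [|exact B]. rewrite <- L at 1.
    now apply equipotent_embeds, equipotent_sym.
  - intros H. exists (idx h k). split; [exact H|now apply equipotent_embeds].
Qed.

Lemma not_small_equipotent h : subset h k -> ~ small k h -> equipotent h k.
Proof.
  intros S N. rewrite (small_idx h S) in N.
  destruct (ordinal_le_cases (idx h k) k (idx_ordinal h k k_ordinal) k_ordinal (idx_le h k k_ordinal)) as [L|L]; [contradiction|].
  rewrite <- L. apply idx_subset_equipotent; [exact k_ordinal|exact S].
Qed.

Lemma max_in_k b c : b ∈ k -> c ∈ k -> exists d, d ∈ k /\ subset b d /\ subset c d.
Proof.
  intros Hb Hc. destruct (ordinal_le_or_lt b c) as [L|L]; try now apply k_mem_ordinal.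
  - exists c. split; [exact Hc|split; [exact L|intros x; auto]].
  - exists b. split; [exact Hb|split; [intros x; auto|]]. apply ordinal_subset; [now apply k_mem_ordinal|exact L].
Qed.

(** Pairs with entries below b and c are coded in the larger of the two, or are finitely many if
    that one is finite. *)
Lemma small_pair z b c (F G : M -> M) {HF : Fun1 F} {HG : Fun1 G} : b ∈ k -> c ∈ k ->
  (forall x, x ∈ z -> F x ∈ b /\ G x ∈ c) ->
  (forall x y, x ∈ z -> y ∈ z -> F x = F y -> G x = G y -> x = y) -> small k z.
Proof.
  intros Hb Hc H I. destruct (max_in_k b c Hb Hc) as (d & Hd & Sb & Sc).
  destruct (classic (finite d)) as [Fd|Nd].
  - apply small_finite. apply (finite_embeds _ (cprod d d)).
    + apply (embeds_intro _ _ (fun x => opair (F x) (G x))).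
      * intros x Hx. apply in_cprod. destruct (H x Hx). exists (F x), (G x). auto.
      * intros x y Hx Hy E. apply opair_inj in E as [E1 E2]. auto.
    + Transparent cprod. unfold cprod. Opaque cprod.
      apply (finite_union d (fun x => image d (fun y => opair x y))); [exact Fd|].
      intros x _. now apply (finite_image d (fun y => opair x y)).
  - destruct (coding_functions d (k_mem_ordinal d Hd) Nd) as (J & J2 & HJ & HJ2 & _ & _ & J21 & J2i).
    exists d. split; [exact Hd|]. apply (embeds_intro _ _ (fun x => J2 (F x) (G x))).
    + intros x Hx. destruct (H x Hx). auto.
    + intros x y Hx Hy E. destruct (H x Hx), (H y Hy). apply J2i in E; auto. now apply I.
Qed.

Lemma void_in_k : void ∈ k.
Proof. apply omega_le_k, in_omega, natural_void. Qed.

Lemma small_cup x y : small k x -> small k y -> small k (cup x y).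
Proof.
  intros (b & Hb & Eb) (c & Hc & Ec). destruct (max_in_k b c Hb Hc) as (d & Hd & Sb & Sc).
  destruct (embeds_elim _ _ Eb) as (F & HF & F1 & Fi).
  destruct (embeds_elim _ _ Ec) as (G & HG & G1 & Gi).
  apply (small_pair _ (succ (succ void)) d (fun u => ite (u ∈ x) void (succ void))
           (fun u => ite (u ∈ x) (F u) (G u))).
  - apply k_succ, k_succ, void_in_k.
  - exact Hd.
  - intros u Hu. sets in Hu. destruct (classic (u ∈ x)) as [K|K].
    + rewrite !ite_true by exact K. sets. auto.
    + rewrite !ite_false by exact K. sets. destruct Hu; [contradiction|auto].
  - assert (N : void <> (succ void : M)).
    { intros E. apply (in_void void). rewrite E at 2. sets. auto. }
    intros u v Hu Hv. sets in Hu. sets in Hv.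
    destruct (classic (u ∈ x)) as [K|K], (classic (v ∈ x)) as [L|L];
      rewrite ?(ite_true (u ∈ x)), ?(ite_true (v ∈ x)), ?(ite_false (u ∈ x)), ?(ite_false (v ∈ x))
        by assumption; intros E1 E2; auto.
    + contradiction.
    + symmetry in E1. contradiction.
    + destruct Hu, Hv; try contradiction. auto.
Qed.

(** Embeddings of the members cannot be chosen simultaneously, but positions in the order of the
    ordinals are canonical. This is what the common bound d on the order types is for: y is coded by
    an index and a position below d. *)
Lemma small_union s (S : M -> M) {HS : Fun1 S} d : small k s -> d ∈ k ->
  (forall x, x ∈ s -> subset (S x) k /\ subset (idx (S x) k) d) ->
  small k (bigcup (image s S)).
Proof.
  intros (b & Hb & Eb) Hd H. destruct (embeds_elim _ _ Eb) as (F & HF & F1 & Fi).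
  (* The least code of an index whose member contains y; [w y] is that index. *)
  set (v := fun y => least (fun v => exists x, x ∈ s /\ y ∈ S x /\ v = F x)).
  assert (Hv : Fun1 v) by (unfold v; exact _).
  set (w := fun y => inverse s F (v y)).
  assert (Hw : Fun1 w) by (unfold w; exact _).
  assert (K : forall y, y ∈ bigcup (image s S) -> v y ∈ b /\ w y ∈ s /\ y ∈ S (w y) /\ v y = F (w y)).
  { intros y Hy. sets in Hy. destruct Hy as (t & Ht & Hy). sets in Ht.
    destruct Ht as (x & Hx & ->).
    destruct (least_spec (fun v => exists x, x ∈ s /\ y ∈ S x /\ v = F x) (F x)) as (_ & L & _).
    { apply (ordinal_mem b); [now apply k_mem_ordinal|auto]. }
    { eauto. }
    fold (v y) in L. destruct L as (x' & Hx' & Hy' & E).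
    assert (W : w y = x') by (unfold w; rewrite E; now apply inverse_eq).
    rewrite W, E. auto. }
  apply (small_pair _ b d v (fun y => idx (S (w y)) y)); auto.
  - intros y Hy. destruct (K y Hy) as (K1 & K2 & K3 & K4). split; [exact K1|].
    apply (H (w y) K2). apply idx_lt; [exact k_ordinal|exact K3|]. now apply (H (w y) K2).
  - intros y y' Hy Hy' E1 E2.
    destruct (K y Hy) as (K1 & K2 & K3 & K4). destruct (K y' Hy') as (K1' & K2' & K3' & K4').
    assert (E : w y = w y') by (unfold w; now rewrite E1).
    rewrite E in *. apply idx_inj in E2; auto; apply k_mem_ordinal; now apply (H (w y') K2').
Qed.

End Small.

(** * Hulls of finite sets *)

Section FinLeast.
Context {M : set_structure} {zf : ZF M}.
Implicit Types (a b c d f p q r s t x y z m n : M).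

Definition fin_least d (phi : M -> Prop) : M :=
  the (fun p => p ∈ Fin d /\ phi p /\ forall q, q ∈ Fin d -> fin_lt q p -> ~ phi q).

#[global] Instance DefinableTerm_fin_least (t : (nat -> M) -> M) (phi : M -> (nat -> M) -> Prop) :
  DefinableTerm t -> Definable (fun e => phi (e 0) (fun i => e (S i))) ->
  DefinableTerm (fun e => fin_least (t e) (fun p => phi p e)).
Proof. intros Ht H. unfold fin_least. exact _. Qed.

Lemma fin_least_spec d (phi : M -> Prop) {Hphi : Def1 phi} p : ordinal d -> p ∈ Fin d -> phi p ->
  fin_least d phi ∈ Fin d /\ phi (fin_least d phi) /\
  forall q, q ∈ Fin d -> fin_lt q (fin_least d phi) -> ~ phi q.
Proof.
  intros Hd Hp Pp.
  apply (the_spec (fun p => p ∈ Fin d /\ phi p /\ forall q, q ∈ Fin d -> fin_lt q p -> ~ phi q)).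
  destruct (fin_lt_wf d Hd (sep (Fin d) phi)) as (m & Hm & K).
  - intros q Hq. sets in Hq. tauto.
  - exists p. now sets.
  - sets in Hm. destruct Hm as [Hm Pm]. exists m. split.
    + split; [exact Hm|split; [exact Pm|]]. intros q Hq L Pq. apply (K q); [now sets|exact L].
    + intros m' (Hm' & Pm' & K'). destruct (fin_lt_total d m m' Hd Hm Hm') as [L|[L|L]]; [|exact L|].
      * now apply K' in L.
      * exfalso. apply (K m'); [now sets|exact L].
Qed.

Definition above a p : M := sep p (fun x => a ∈ x).
(** A finite set that contains every q whose largest difference from p is a natural number a in p:
    below a only the natural numbers less than a are left. *)
Definition low p : M := cup p (bigcup (sep p natural)).

#[global] Instance definable_above : DefinableFun2 above.
Proof. definable_by above. Qed.
#[global] Instance definable_low : DefinableFun1 low.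
Proof. definable_by low. Qed.

Lemma low_finite p : finite p -> finite (low p).
Proof.
  intros Hp. unfold low. apply finite_cup; [exact Hp|]. apply finite_bigcup.
  - apply (finite_subset p); [exact Hp|]. intros x Hx. sets in Hx. tauto.
  - intros x Hx. sets in Hx. now apply finite_natural.
Qed.

(** Sort q by its largest difference a from p. A finite a leaves finitely many q; an infinite a
    leaves the part of p above a together with a finite subset of a. *)
Lemma fin_le_cases d p q : ordinal d -> p ∈ Fin d -> q ∈ Fin d -> q = p \/ fin_lt q p ->
  q ∈ power (low p) \/
  exists a, a ∈ p /\ ~ finite a /\ q = cup (above a p) (cap q a).
Proof.
  intros Hd Hp Hq [-> |(a & Ha & Na & Ka)].
  { left. sets. intros x Hx. unfold low. sets. auto. }
  assert (Oa : ordinal a) by now apply (Fin_ordinal d p).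
  assert (Cq : forall x, x ∈ q -> x ∈ a \/ a ∈ x).
  { intros x Hx. assert (Ox : ordinal x) by now apply (Fin_ordinal d q).
    destruct (ordinal_trichotomy x a Ox Oa) as [L|[-> |L]]; tauto. }
  destruct (classic (finite a)) as [Fa|Fa].
  - left. sets. intros x Hx. unfold low. sets.
    destruct (Cq x Hx) as [L|L]; [|left; now apply Ka].
    right. exists a. sets. split; [|exact L]. split; [exact Ha|now apply finite_ordinal_natural].
  - right. exists a. split; [exact Ha|split; [exact Fa|]].
    apply set_ext; intros x. unfold above. sets. split.
    + intros Hx. destruct (Cq x Hx) as [L|L]; [tauto|]. left. split; [now apply Ka|exact L].
    + intros [[Hx L]|[Hx _]]; [now apply Ka|exact Hx].
Qed.

Lemma fin_lt_above a p t : a ∈ p -> (forall x, x ∈ p -> ordinal x) -> t ∈ Fin a ->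
  fin_lt (cup (above a p) t) p.
Proof.
  intros Ha O Ht. exists a. apply in_Fin in Ht. destruct Ht as [Ht _].
  split; [exact Ha|split].
  - unfold above. sets. intros [[_ L]|L]; [|apply Ht in L]; now apply mem_irrefl in L.
  - intros b Hb. unfold above. sets. split; [|tauto]. intros [H|H]; [tauto|].
    exfalso. apply (mem_asym a b); auto.
Qed.

End FinLeast.
#[global] Opaque fin_least.

(** * Hulls and their directed unions *)

Section Hull.
Context {M : set_structure} {zf : ZF M}.
Implicit Types (a b c d f p q r s t x y z m n : M).
Variables (k : M) (Phi : M -> M).
Hypothesis Ok : ordinal k.
Context {HPhi : Fun1 Phi}.
Hypothesis Phi_Fin : forall x, x ∈ Fin k -> Phi x ∈ Fin k.
Hypothesis Phi_ext : forall x, x ∈ Fin k -> subset x (Phi x).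
Hypothesis Phi_mono : forall x y, x ∈ Fin k -> y ∈ Fin k -> subset x y -> subset (Phi x) (Phi y).

(** The recursion visits only subsets missing one point, but it needs transitive sets of
    predecessors. *)
Definition proper p : M := del p (power p).

(** Closing p under [Phi] might give an infinite set. Here every new point of p allows one more
    application of [Phi], so hulls stay finite while their unions over the finite subsets of an
    infinite set become closed. *)
Definition hull p : M :=
  wfrec proper (fun p f => cup p (bigcup (image p (fun x => Phi (ap f (del x p)))))) p.

#[global] Instance definable_proper : DefinableFun1 proper.
Proof. definable_by proper. Qed.

Lemma hull_definable : Fun1 hull.
Proof. unfold hull. exact _. Qed.

#[global] Instance DefinableTerm_hull (t : (nat -> M) -> M) :
  DefinableTerm t -> DefinableTerm (fun e => hull (t e)).
Proof. apply DefinableTerm_app1, hull_definable. Qed.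

Lemma proper_closed p q : p ∈ Fin k -> q ∈ proper p -> q ∈ Fin k /\ subset (proper q) (proper p).
Proof.
  intros Hp Hq. unfold proper in *. sets in Hq. destruct Hq as [Hq Nq].
  split; [now apply (Fin_subset k p)|].
  intros t Ht. sets in Ht. destruct Ht as [Ht Nt]. sets. split; [intros x; auto|].
  intros ->. apply Nq. now apply subset_antisym.
Qed.

Lemma proper_wf s : (forall p, p ∈ s -> p ∈ Fin k) -> (exists p, p ∈ s) ->
  exists p, p ∈ s /\ forall q, q ∈ s -> q ∉ proper p.
Proof.
  intros Hs Ns. destruct (fin_lt_wf k Ok s Hs Ns) as (p & Hp & K).
  exists p. split; [exact Hp|]. intros q Hq L. apply (K q Hq).
  unfold proper in L. sets in L. destruct L as [L N].
  destruct (fin_lt_total k p q Ok) as [H|[H|H]]; auto.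
  - destruct H as (a & Ha & Na & _). exfalso. auto.
  - now symmetry in H.
Qed.

Lemma in_hull p i : p ∈ Fin k ->
  i ∈ hull p <-> i ∈ p \/ exists x, x ∈ p /\ i ∈ Phi (hull (del x p)).
Proof.
  intros Hp. unfold hull.
  rewrite (wfrec_eq (fun p => p ∈ Fin k) proper _ proper_closed proper_wf p Hp) at 1. fold hull.
  assert (K : forall x, x ∈ p -> ap (graph (proper p) hull) (del x p) = hull (del x p)).
  { intros x Hx. apply ap_graph; [exact _|]. unfold proper. sets. split.
    - intros y Hy. sets in Hy. tauto.
    - intros E. rewrite <- E in Hx. sets in Hx. tauto. }
  sets. split; (intros [H|H]; [auto|right]).
  - destruct H as (y & Hy & Hi). sets in Hy. destruct Hy as (x & Hx & ->).
    exists x. rewrite K in Hi; auto.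
  - destruct H as (x & Hx & Hi). exists (Phi (hull (del x p))). sets. split; [|exact Hi].
    exists x. rewrite K; auto.
Qed.

Opaque hull.

Lemma hull_Fin p : p ∈ Fin k -> hull p ∈ Fin k.
Proof.
  revert p. apply (wf_ind (fun p => p ∈ Fin k) proper proper_closed proper_wf (fun p => hull p ∈ Fin k)).
  intros p Hp IH.
  assert (K : forall x, x ∈ p -> Phi (hull (del x p)) ∈ Fin k).
  { intros x Hx. apply Phi_Fin, IH. unfold proper. sets. split.
    - intros y Hy. sets in Hy. tauto.
    - intros E. rewrite <- E in Hx. sets in Hx. tauto. }
  apply in_Fin. split.
  - intros i Hi. apply in_hull in Hi; [|exact Hp]. destruct Hi as [Hi|(x & Hx & Hi)].
    + apply in_Fin in Hp. now apply Hp.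
    + specialize (K x Hx). apply in_Fin in K. now apply K.
  - apply (finite_subset (cup p (bigcup (image p (fun x => Phi (hull (del x p))))))).
    + apply in_Fin in Hp. destruct Hp as [_ Fp]. apply finite_cup; [exact Fp|].
      apply (finite_union p (fun x => Phi (hull (del x p)))); [exact Fp|].
      intros x Hx. now apply in_Fin with k, K.
    + intros i Hi. apply in_hull in Hi; [|exact Hp]. sets. destruct Hi as [Hi|(x & Hx & Hi)]; [auto|].
      right. exists (Phi (hull (del x p))). sets. eauto.
Qed.

Lemma hull_step p x : p ∈ Fin k -> x ∈ k -> x ∉ p -> subset (Phi (hull p)) (hull (adj x p)).
Proof.
  intros Hp Hx Nx i Hi. apply in_hull; [now apply Fin_adj|]. right. exists x. sets.
  split; [auto|]. replace (del x (adj x p)) with p; [exact Hi|].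
  apply set_ext; intros y. sets. split; [|tauto]. intros Hy. split; [auto|]. now intros ->.
Qed.

(** The points of q are added to p one at a time; each addition enlarges the hull by [hull_step],
    because [Phi] is extensive. *)
Lemma hull_mono p q : p ∈ Fin k -> q ∈ Fin k -> subset p q -> subset (hull p) (hull q).
Proof.
  intros Hp Hq S.
  assert (K : forall r, finite r -> subset r k -> subset (hull p) (hull (cup p r)) /\ cup p r ∈ Fin k).
  { apply (finite_ind (fun r => subset r k -> subset (hull p) (hull (cup p r)) /\ cup p r ∈ Fin k)).
    - intros _. replace (cup p void) with p; [split; [intros x; auto|exact Hp]|].
      apply set_ext; intros x. sets. tauto.
    - intros r a _ IH Na Sr. destruct IH as [IH Hc]; [intros x Hx; apply Sr; sets; auto|].
      assert (Ha : a ∈ k) by (apply Sr; sets; auto).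
      replace (cup p (adj a r)) with (adj a (cup p r)) by (apply set_ext; intros x; sets; tauto).
      split; [|now apply Fin_adj].
      destruct (classic (a ∈ cup p r)) as [H|H].
      + replace (adj a (cup p r)) with (cup p r); [exact IH|].
        apply set_ext; intros x. rewrite in_adj. split; [auto|]. intros [K| ->]; auto.
      + intros x Hx. apply hull_step; auto. apply Phi_ext; [|now apply IH]. now apply hull_Fin. }
  replace q with (cup p q); [|apply set_ext; intros x; sets; split; [intros [H|H]; auto|auto]].
  apply in_Fin in Hq. apply K; tauto.
Qed.

Lemma hull_ext p : p ∈ Fin k -> subset p (hull p).
Proof. intros Hp i Hi. apply in_hull; auto. Qed.

(** With [above a p] in the place of e, this collects the hulls of all sets that agree with p above
    a, omit a and are arbitrary finite below it. All of these precede p if a is in p. *)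
Definition cone e a : M := bigcup (image (Fin a) (fun t => hull (cup e t))).

#[global] Instance definable_cone : DefinableFun2 cone.
Proof. definable_by cone. Qed.

Lemma in_cone e a i : i ∈ cone e a <-> exists t, t ∈ Fin a /\ i ∈ hull (cup e t).
Proof.
  unfold cone. sets. split.
  - intros (y & Hy & Hi). sets in Hy. destruct Hy as (t & Ht & ->). eauto.
  - intros (t & Ht & Hi). exists (hull (cup e t)). sets. eauto.
Qed.

Opaque cone.

Section Cone.
Variables e a : M.
Hypothesis He : e ∈ Fin k.
Hypothesis Ha : subset a k.

Lemma cup_Fin t : t ∈ Fin a -> cup e t ∈ Fin k.
Proof.
  intros Ht. rewrite in_Fin in *. destruct He as [E1 E2], Ht as [T1 T2]. split.
  - intros x Hx. sets in Hx. destruct Hx; auto.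
  - now apply finite_cup.
Qed.

Lemma cone_directed y : finite y -> subset y (cone e a) ->
  exists t, t ∈ Fin a /\ subset y (hull (cup e t)).
Proof.
  intros Fy. revert y Fy.
  apply (finite_ind (fun y => subset y (cone e a) -> exists t, t ∈ Fin a /\ subset y (hull (cup e t)))).
  - intros _. exists void. split; [apply Fin_void|]. intros x Hx. now sets in Hx.
  - intros y x _ IH _ H. destruct IH as (t & Ht & Kt); [intros z Hz; apply H; sets; auto|].
    assert (Hx : x ∈ cone e a) by (apply H; sets; auto). apply in_cone in Hx.
    destruct Hx as (t' & Ht' & Kt').
    assert (Hc : cup t t' ∈ Fin a).
    { rewrite in_Fin in *. destruct Ht, Ht'. split; [|now apply finite_cup].
      intros z Hz. sets in Hz. destruct Hz; auto. }
    exists (cup t t'). split; [exact Hc|]. intros z Hz. sets in Hz. destruct Hz as [Hz| ->].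
    + apply (hull_mono (cup e t)); try now apply cup_Fin; auto.
      * intros w Hw. sets in Hw. sets. tauto.
      * now apply Kt.
    + apply (hull_mono (cup e t')); try now apply cup_Fin; auto.
      * intros w Hw. sets in Hw. sets. tauto.
      * exact Kt'.
Qed.

(** As a is infinite, it has a point outside [cup e t]; adding this point to t applies [Phi] to the
    hull once more. *)
Lemma cone_closed x t : ~ finite a -> t ∈ Fin a -> x ∈ Fin k -> subset x (hull (cup e t)) ->
  subset (Phi x) (cone e a).
Proof.
  intros Na Ht Hx S.
  assert (Hc := cup_Fin t Ht).
  destruct (classic (exists b, b ∈ diff a (cup e t))) as [(b & Hb)|N].
  - sets in Hb. destruct Hb as [Hb Nb]. intros i Hi. apply in_cone. exists (adj b t).
    split; [now apply Fin_adj|].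
    replace (cup e (adj b t)) with (adj b (cup e t)) by (apply set_ext; intros y; sets; tauto).
    apply hull_step; auto.
    + sets. tauto.
    + apply (Phi_mono x); auto. now apply hull_Fin.
  - exfalso. apply Na. apply (finite_subset (cup e t)); [now apply in_Fin in Hc|].
    intros y Hy. apply NNPP; intros Ny. apply N. exists y. now rewrite in_diff.
Qed.

End Cone.

Definition lows p : M := cap (power (low p)) (Fin k).

#[global] Instance definable_lows : DefinableFun1 lows.
Proof. definable_by lows. Qed.

Lemma lows_finite p : p ∈ Fin k -> finite (lows p).
Proof.
  intros Hp. apply (finite_subset (power (low p))).
  - now apply finite_power, low_finite, in_Fin with k.
  - intros q Hq. unfold lows in Hq. sets in Hq. sets. tauto.
Qed.

Lemma fin_le_hull p q : p ∈ Fin k -> q ∈ Fin k -> q = p \/ fin_lt q p ->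
  q ∈ lows p \/ exists a t, a ∈ p /\ ~ finite a /\ subset a k /\ above a p ∈ Fin k /\ t ∈ Fin a /\
    q = cup (above a p) t.
Proof.
  intros Hp Hq L. destruct (fin_le_cases k p q Ok Hp Hq L) as [H|(a & Ha & Na & E)].
  - left. unfold lows. sets in H. sets. auto.
  - right. exists a, (cap q a). split; [exact Ha|split; [exact Na|split; [|split; [|split]]]].
    + apply ordinal_subset; [exact Ok|]. apply in_Fin in Hp. now apply Hp.
    + apply (Fin_subset k p); [exact Hp|]. intros x Hx. unfold above in Hx. sets in Hx. tauto.
    + apply in_Fin. split; [intros x Hx; sets in Hx; tauto|].
      apply (finite_subset q); [now apply in_Fin in Hq|]. intros x Hx. sets in Hx. tauto.
    + exact E.
Qed.

End Hull.
#[global] Opaque hull cone.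

(** * Free sets *)

Section SetMapping.
Context {M : set_structure} {zf : ZF M}.
Implicit Types (a b c d p q r s t x y z m n i j : M).
Variables (k : M) (F : M -> M).
Hypothesis Ok : ordinal k.
Context {HF : Fun1 F}.
Hypothesis F_Fin : forall x, x ∈ k -> F x ∈ Fin k.

Definition closure_step x : M := cup x (bigcup (image x F)).

#[global] Instance definable_closure_step : DefinableFun1 closure_step.
Proof. definable_by closure_step. Qed.

Lemma in_closure_step x i : i ∈ closure_step x <-> i ∈ x \/ exists j, j ∈ x /\ i ∈ F j.
Proof.
  unfold closure_step. sets. split; (intros [H|H]; [auto|right]).
  - destruct H as (y & Hy & Hi). sets in Hy. destruct Hy as (j & Hj & ->). eauto.
  - destruct H as (j & Hj & Hi). exists (F j). sets. eauto.
Qed.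

Lemma closure_step_Fin x : x ∈ Fin k -> closure_step x ∈ Fin k.
Proof.
  rewrite !in_Fin. intros [S Fx]. split.
  - intros i Hi. apply in_closure_step in Hi. destruct Hi as [Hi|(j & Hj & Hi)]; [auto|].
    apply S, F_Fin, in_Fin in Hj. now apply Hj.
  - unfold closure_step. apply finite_cup; [exact Fx|]. apply (finite_union x F); [exact Fx|].
    intros y Hy. apply S, F_Fin, in_Fin in Hy. tauto.
Qed.

Lemma closure_step_mono x y : x ∈ Fin k -> y ∈ Fin k -> subset x y ->
  subset (closure_step x) (closure_step y).
Proof.
  intros _ _ S i. rewrite !in_closure_step. intros [H|(j & Hj & H)]; eauto.
Qed.

Local Notation D := (hull closure_step).

Definition support i : M := fin_least k (fun p => i ∈ D p).

#[global] Instance definable_support : DefinableFun1 support.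
Proof. definable_by support. Qed.

Lemma support_spec i : i ∈ k -> support i ∈ Fin k /\ i ∈ D (support i) /\
  forall q, q ∈ Fin k -> fin_lt q (support i) -> i ∉ D q.
Proof.
  intros Hi. unfold support.
  assert (K : adj i void ∈ Fin k) by (apply Fin_adj; [apply Fin_void|exact Hi]).
  apply (fin_least_spec k (fun p => i ∈ D p) (adj i void)); auto.
  apply (hull_ext k closure_step Ok); [exact K|]. sets. auto.
Qed.

(** All points with a given support lie in its finite hull; membership only breaks ties among
    these. *)
Definition before j i : Prop :=
  fin_lt (support j) (support i) \/ (support j = support i /\ j ∈ i).

#[global] Instance definable_before : DefinableRel2 before.
Proof. definable_by before. Qed.

Lemma before_irrefl i : ~ before i i.
Proof. intros [H|[_ H]]; [now apply fin_lt_irrefl in H|now apply mem_irrefl in H]. Qed.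

Lemma before_trans i j l : i ∈ k -> j ∈ k -> l ∈ k -> before i j -> before j l -> before i l.
Proof.
  intros Hi Hj Hl. destruct (support_spec i Hi) as [Si _].
  destruct (support_spec j Hj) as [Sj _]. destruct (support_spec l Hl) as [Sl _].
  intros [H|[E H]] [K|[E' K]]; unfold before.
  - left. now apply (fin_lt_trans k _ (support j)).
  - left. now rewrite <- E'.
  - left. now rewrite E.
  - right. split; [congruence|]. apply (ordinal_trans l j); auto. now apply (ordinal_mem k).
Qed.

Lemma before_total i j : i ∈ k -> j ∈ k -> before i j \/ i = j \/ before j i.
Proof.
  intros Hi Hj. destruct (support_spec i Hi) as [Si _]. destruct (support_spec j Hj) as [Sj _].
  unfold before. destruct (fin_lt_total k (support i) (support j) Ok Si Sj) as [L|[E|L]]; auto.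
  destruct (ordinal_trichotomy i j) as [L|[L|L]]; auto; now apply (ordinal_mem k).
Qed.

Definition predecessors i : M := sep k (fun j => before j i).

#[global] Instance definable_predecessors : DefinableFun1 predecessors.
Proof. definable_by predecessors. Qed.

Lemma in_predecessors i j : j ∈ predecessors i <-> j ∈ k /\ before j i.
Proof.
  unfold predecessors. sets. reflexivity.
Qed.

Lemma predecessors_closed i j : i ∈ k -> j ∈ predecessors i ->
  j ∈ k /\ subset (predecessors j) (predecessors i).
Proof.
  intros Hi Hj. apply in_predecessors in Hj as [Hj L]. split; [exact Hj|].
  intros l. rewrite !in_predecessors. intros [Hl K]. split; [exact Hl|].
  now apply (before_trans l j i).
Qed.

Lemma predecessors_wf s : (forall i, i ∈ s -> i ∈ k) -> (exists i, i ∈ s) ->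
  exists i, i ∈ s /\ forall j, j ∈ s -> j ∉ predecessors i.
Proof.
  intros Hs [i0 Hi0].
  destruct (fin_lt_wf k Ok (image s support)) as (p & Hp & Kp).
  - intros q Hq. sets in Hq. destruct Hq as (i & Hi & ->). now apply support_spec, Hs.
  - exists (support i0). sets. eauto.
  - sets in Hp. destruct Hp as (i1 & Hi1 & ->).
    destruct (ordinal_wf (sep s (fun i => support i = support i1))) as (i & Hi & Ki).
    + intros i Hi. sets in Hi. apply (ordinal_mem k); [exact Ok|]. now apply Hs.
    + exists i1. now sets.
    + sets in Hi. destruct Hi as [Hi E]. exists i. split; [exact Hi|].
      intros j Hj K. apply in_predecessors in K as [_ [K|[K K']]].
      * apply (Kp (support j)); [sets; eauto|now rewrite <- E].
      * apply (Ki j); [sets; split; congruence|exact K'].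
Qed.

Definition neighbours i : M := sep k (fun j => before j i /\ (j ∈ F i \/ i ∈ F j)).

Lemma in_neighbours i j : j ∈ neighbours i <-> j ∈ k /\ before j i /\ (j ∈ F i \/ i ∈ F j).
Proof. unfold neighbours. sets. reflexivity. Qed.

#[global] Instance definable_neighbours : DefinableFun1 neighbours.
Proof. definable_by neighbours. Qed.

(** The points of [F i] are harmless. If i is in [F j], then either the support of j is one of
    finitely many, or j lies in a cone of [support i]. Such a cone is closed under F, so it would
    contain i, and i would occur in a hull before its support. *)
Lemma neighbours_finite i : i ∈ k -> finite (neighbours i).
Proof.
  intros Hi. destruct (support_spec i Hi) as (Si & Di & Li).
  apply (finite_subset (cup (F i) (bigcup (image (lows k (support i)) D)))).
  - apply finite_cup; [now apply F_Fin, in_Fin in Hi|].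
    apply (finite_union (lows k (support i)) (hull closure_step)); [now apply lows_finite|].
    intros q Hq. unfold lows in Hq. sets in Hq. apply in_Fin with k.
    now apply (hull_Fin k closure_step Ok closure_step_Fin).
  - intros j Hj. apply in_neighbours in Hj as (Hj & L & Hij). sets.
    destruct Hij as [Hij|Hij]; [auto|right].
    destruct (support_spec j Hj) as (Sj & Dj & _).
    destruct (fin_le_hull k Ok (support i) (support j) Si Sj) as [K|(a & t & Ha & Na & Sa & Ea & Ht & E)].
    + destruct L as [L|[L _]]; auto.
    + exists (D (support j)). sets. eauto.
    + exfalso.
      assert (K : i ∈ cone closure_step (above a (support i)) a).
      { apply (cone_closed k closure_step Ok closure_step_Fin closure_step_mono
                 (above a (support i)) a Ea Sa (D (support j)) t Na Ht).
        - now apply (hull_Fin k closure_step Ok closure_step_Fin).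
        - rewrite E. intros x; auto.
        - apply in_closure_step. eauto. }
      rewrite in_cone in K by exact _. destruct K as (t' & Ht' & Ki).
      apply (Li (cup (above a (support i)) t')); [now apply (cup_Fin k _ a)| |exact Ki].
      apply fin_lt_above; auto. intros x Hx. now apply (Fin_ordinal k (support i)).
Qed.

(** The points reached from i by passing repeatedly to neighbours, as the intersection of all sets
    closed under that step. This is the lower set of i in the partial order. *)
Definition tree i : M :=
  sep k (fun j => forall z, i ∈ z -> (forall x, x ∈ z -> subset (neighbours x) z) -> j ∈ z).

Lemma in_tree i j : j ∈ tree i <->
  j ∈ k /\ forall z, i ∈ z -> (forall x, x ∈ z -> subset (neighbours x) z) -> j ∈ z.
Proof. unfold tree. sets. reflexivity. Qed.

#[global] Instance definable_tree : DefinableFun1 tree.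
Proof. definable_by tree. Qed.

Lemma tree_refl i : i ∈ k -> i ∈ tree i.
Proof. intros Hi. apply in_tree; auto. Qed.

Lemma tree_neighbours i j : j ∈ tree i -> subset (neighbours j) (tree i).
Proof.
  intros Hj l Hl. apply in_tree in Hj as [Hj K]. apply in_tree.
  split; [now apply in_neighbours in Hl|]. intros z Hz Cz. apply (Cz j); auto.
Qed.

Lemma tree_least i z : i ∈ z -> (forall x, x ∈ z -> subset (neighbours x) z) -> subset (tree i) z.
Proof. intros Hi Cz j Hj. apply in_tree in Hj as [_ K]. auto. Qed.

Lemma tree_trans i j : j ∈ tree i -> subset (tree j) (tree i).
Proof. intros Hj. apply tree_least; [exact Hj|]. intros x. apply tree_neighbours. Qed.

Lemma tree_before i j : i ∈ k -> j ∈ tree i -> j <> i -> before j i.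
Proof.
  intros Hi Hj N.
  assert (K : j ∈ adj i (predecessors i)).
  { revert j Hj N. intros j Hj _. revert j Hj. apply tree_least; [sets; auto|].
    intros x Hx y Hy. apply in_neighbours in Hy as (Hy & L & _). sets. left.
    apply in_predecessors. split; [exact Hy|]. sets in Hx. destruct Hx as [Hx| ->]; [|exact L].
    apply in_predecessors in Hx as [Hx Lx]. now apply (before_trans y x i). }
  sets in K. destruct K as [K|K]; [now apply in_predecessors in K|contradiction].
Qed.

Lemma tree_subset i : subset (tree i) k.
Proof. intros j Hj. now apply in_tree in Hj. Qed.

Lemma tree_antisym i j : i ∈ k -> j ∈ tree i -> i ∈ tree j -> i = j.
Proof.
  intros Hi Hj Hij. assert (Kj := tree_subset i j Hj). apply NNPP; intros N.
  apply (before_irrefl i), (before_trans i j i); auto; apply tree_before; auto.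
Qed.

(** Induction along [before]: the lower set of i consists of i and the lower sets of its finitely
    many neighbours. *)
Lemma tree_finite i : i ∈ k -> finite (tree i).
Proof.
  revert i. apply (wf_ind (fun i => i ∈ k) predecessors predecessors_closed predecessors_wf (fun i => finite (tree i))).
  intros i Hi IH.
  apply (finite_subset (adj i (bigcup (image (neighbours i) tree)))).
  - apply finite_adj, (finite_union (neighbours i) tree); [now apply neighbours_finite|].
    intros j Hj. apply IH, in_predecessors. apply in_neighbours in Hj. tauto.
  - apply tree_least; [sets; auto|]. intros x Hx y Hy. sets in Hx. sets. left.
    destruct Hx as [(w & Hw & Hx)| ->].
    + exists w. split; [exact Hw|]. sets in Hw. destruct Hw as (j & Hj & ->).
      now apply (tree_neighbours j x).
    + exists (tree y). sets. split; [eauto|]. apply tree_refl. now apply in_neighbours in Hy.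
Qed.

Lemma tree_comparable i j : i ∈ k -> j ∈ k -> i <> j -> j ∈ F i -> j ∈ tree i \/ i ∈ tree j.
Proof.
  intros Hi Hj N H. destruct (before_total i j Hi Hj) as [L|[L|L]]; [|contradiction|].
  - right. apply (tree_neighbours j j); [now apply tree_refl|]. apply in_neighbours. auto.
  - left. apply (tree_neighbours i i); [now apply tree_refl|]. apply in_neighbours. auto.
Qed.

Lemma tree_pred_closed i j : i ∈ k -> j ∈ del i (tree i) ->
  j ∈ k /\ subset (del j (tree j)) (del i (tree i)).
Proof.
  intros Hi Hj. sets in Hj. destruct Hj as [Hj N]. assert (Kj := tree_subset i j Hj).
  split; [exact Kj|]. intros l Hl. sets in Hl. destruct Hl as [Hl Nl]. sets.
  split; [now apply (tree_trans i j)|]. intros ->. apply N. symmetry. now apply tree_antisym.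
Qed.

Lemma tree_wf s : (forall i, i ∈ s -> i ∈ k) -> (exists i, i ∈ s) ->
  exists i, i ∈ s /\ forall j, j ∈ s -> j ∉ del i (tree i).
Proof.
  intros Hs Ns. destruct (predecessors_wf s Hs Ns) as (i & Hi & K).
  exists i. split; [exact Hi|]. intros j Hj L. sets in L. apply (K j Hj), in_predecessors.
  split; [auto|]. apply tree_before; tauto || auto.
Qed.

End SetMapping.

(** * Free partitions and large free sets *)

Section Free.
Context {M : set_structure} {zf : ZF M}.
Implicit Types (a b c d p q r s t x y z m n i j h : M).

Definition size x : M := the (fun n => natural n /\ equipotent x n).

#[global] Instance definable_size : DefinableFun1 size.
Proof. definable_by size. Qed.

Lemma size_spec x : finite x -> natural (size x) /\ equipotent x (size x).
Proof.
  intros (n & Hn & E). apply (the_spec (fun n => natural n /\ equipotent x n)).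
  exists n. split; [auto|]. intros m [Hm E']. now apply (natural_equipotent_eq x).
Qed.

Lemma set_mapping_Fin f k : ordinal k -> set_mapping f k omega ->
  (forall x, x ∈ k -> ap f x ∈ Fin k) /\
  (forall x y, app f x y -> y = ap f x).
Proof.
  intros Ok (s & Hs & Hf). split.
  - intros x Hx. destruct (app_ap f k s x Hf Hx) as [_ K]. apply Hs in K as [K1 K2].
    apply in_Fin. split; [exact K1|now apply card_lt_omega].
  - intros x y H. now destruct (ap_of_app f k s x y Hf H) as (_ & _ & ->).
Qed.

Section Mapping.
Variables k f : M.
Hypothesis Ok : ordinal k.
Hypothesis Hf : set_mapping f k omega.

Local Notation T := (tree k (ap f)).

Definition antichain h : Prop := forall i j, i ∈ h -> j ∈ h -> i <> j -> j ∉ T i.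

Lemma antichain_free h : subset h k -> antichain h -> free f h.
Proof.
  intros S A i j c Hi Hj N H Hic. destruct (set_mapping_Fin f k Ok Hf) as [F1 F2].
  apply F2 in H. subst c.
  destruct (tree_comparable k (ap f) Ok j i) as [K|K]; auto.
  - apply (A j i); auto.
  - apply (A i j); auto.
Qed.

(** A point j strictly below i has its lower set inside that of i without i, which is finite and
    strictly smaller. So points on one level are incomparable. *)
Lemma T_size i j : i ∈ k -> j ∈ T i -> size (T i) = size (T j) -> i = j.
Proof.
  intros Hi Hj E. destruct (set_mapping_Fin f k Ok Hf) as [F1 F2].
  assert (Kj : j ∈ k) by (apply (tree_subset k (ap f) i j Hj)).
  apply NNPP; intros N.
  assert (Fi := tree_finite k (ap f) Ok F1 i Hi). assert (Fj := tree_finite k (ap f) Ok F1 j Kj).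
  apply (finite_no_embeds (T i) i); [exact Fi|now apply (tree_refl k (ap f))|].
  apply (embeds_trans _ (T j)).
  - apply equipotent_embeds, (equipotent_trans _ (size (T i))); [now apply size_spec|].
    rewrite E. now apply equipotent_sym, size_spec.
  - apply subset_embeds. intros l Hl. sets. split; [now apply (tree_trans k (ap f) i j)|].
    intros ->. apply N. now apply (tree_antisym k (ap f) Ok).
Qed.

Lemma free_colouring : exists c : M -> M, Fun1 c /\ (forall i, i ∈ k -> c i ∈ omega) /\
  forall n h, subset h k -> (forall i, i ∈ h -> c i = n) -> antichain h.
Proof.
  exists (fun i => size (T i)). split; [exact _|split].
  - intros i Hi. apply in_omega. destruct (set_mapping_Fin f k Ok Hf) as [F1 F2].
    now apply size_spec, (tree_finite k (ap f) Ok F1).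
  - intros n h S H i j Hi Hj N K. apply N. apply T_size; auto. now rewrite !H.
Qed.

End Mapping.

Lemma infinite_subset_omega s : subset s omega -> ~ finite s -> equipotent s omega.
Proof.
  intros S N. assert (E := idx_subset_equipotent s omega ordinal_omega S).
  destruct (ordinal_le_cases (idx s omega) omega (idx_ordinal _ _ ordinal_omega) ordinal_omega
              (idx_le _ _ ordinal_omega)) as [L|L].
  - exfalso. apply N. exists (idx s omega). split; [now apply in_omega|exact E].
  - now rewrite L in E.
Qed.

Lemma finite_naturals_bounded s : subset s omega -> finite s ->
  exists n, natural n /\ subset s n.
Proof.
  intros S Fs. destruct (classic (exists x, x ∈ s)) as [N|N].
  - destruct (finite_max s Fs) as (m & Hm & K); [|exact N|].
    + intros x Hx. apply natural_ordinal, in_omega. auto.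
    + exists (succ m). split; [|exact K]. apply natural_succ, in_omega. auto.
  - exists void. split; [exact natural_void|]. intros x Hx. exfalso; eauto.
Qed.

Theorem FreeUnion_omega k : infinite_cardinal k -> FreeUnion k omega omega.
Proof.
  intros Hk f Hf. assert (Ok := k_ordinal k Hk).
  destruct (free_colouring k f Ok Hf) as (c & Hc & c_omega & c_free).
  assert (K : exists c : M -> M, Fun1 c /\ (forall i, i ∈ k -> c i ∈ omega) /\
    (forall n h, subset h k -> (forall i, i ∈ h -> c i = n) -> antichain k f h) /\
    ~ finite (image k c)).
  { destruct (classic (finite (image k c))) as [Fc|Fc]; [|exists c; auto].
    destruct (finite_naturals_bounded (image k c)) as (N & HN & SN); [|exact Fc|].
    { intros n Hn. sets in Hn. destruct Hn as (i & Hi & ->). auto. }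
    assert (cN : forall i, i ∈ k -> c i ∈ N) by (intros i Hi; apply SN; sets; eauto).
    (* If all colours lie below N, the natural numbers from N on, as points of k, get colours of
       their own. The other classes only shrink, and exactly omega many classes result. *)
    exists (fun i => ite (i ∈ diff omega N) i (c i)).
    split; [exact _|split; [|split]].
    - intros i Hi. destruct (classic (i ∈ diff omega N)) as [H|H].
      + rewrite ite_true by exact H. sets in H. tauto.
      + rewrite ite_false by exact H. auto.
    - intros n h S E. destruct (classic (n ∈ N)) as [Hn|Hn].
      + apply (c_free n); [exact S|]. intros i Hi. specialize (E i Hi).
        destruct (classic (i ∈ diff omega N)) as [H|H].
        * rewrite ite_true in E by exact H. subst i. sets in H. tauto.
        * now rewrite ite_false in E.
      + assert (E' : forall i, i ∈ h -> i = n).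
        { intros i Hi. specialize (E i Hi). destruct (classic (i ∈ diff omega N)) as [H|H].
          - now rewrite ite_true in E.
          - rewrite ite_false in E by exact H. subst n. exfalso. auto. }
        intros i j Hi Hj Nij. exfalso. apply Nij. now rewrite (E' i), (E' j).
    - intros Fi. apply omega_infinite.
      apply (finite_subset (cup N (image k (fun i => ite (i ∈ diff omega N) i (c i))))).
      { apply finite_cup; [now apply finite_natural|exact Fi]. }
      intros n Hn. sets. destruct (classic (n ∈ N)) as [H|H]; [auto|right].
      exists n. split; [now apply (omega_le_k k Hk)|]. rewrite ite_true; [reflexivity|]. sets. auto. }
  clear c Hc c_omega c_free. destruct K as (c & Hc & c_omega & c_free & c_inf).
  assert (P : Fun1 (fun n => sep k (fun i => c i = n))) by exact _.
  exists (image (image k c) (fun n => sep k (fun i => c i = n))). split; [split; [|split]|split].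
  - intros x Hx. sets in Hx. destruct Hx as (n & Hn & ->). split.
    + intros i Hi. sets in Hi. tauto.
    + sets in Hn. destruct Hn as (i & Hi & ->). exists i. now sets.
  - intros x y a Hx Hy Hax Hay. sets in Hx. sets in Hy.
    destruct Hx as (n & _ & ->). destruct Hy as (m & _ & ->). sets in Hax. sets in Hay.
    destruct Hax as [_ <-]. destruct Hay as [_ <-]. reflexivity.
  - intros a Ha. exists (sep k (fun i => c i = c a)). sets. split; [|auto].
    exists (c a). sets. eauto.
  - apply (equipotent_trans _ (image k c)).
    + apply equipotent_sym. apply (image_equipotent _ (fun n => sep k (fun i => c i = n))).
      intros n m Hn Hm E. sets in Hn. destruct Hn as (i & Hi & ->).
      assert (K : i ∈ sep k (fun j => c j = c i)) by now sets.
      rewrite E in K. sets in K. tauto.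
    + apply infinite_subset_omega; [|exact c_inf].
      intros n Hn. sets in Hn. destruct Hn as (i & Hi & ->). auto.
  - intros x Hx. sets in Hx. destruct Hx as (n & Hn & ->).
    assert (S : subset (sep k (fun i => c i = n)) k) by (intros i Hi; sets in Hi; tauto).
    apply (antichain_free k f Ok Hf); [exact S|]. apply (c_free n); [exact S|].
    intros i Hi. sets in Hi. tauto.
Qed.

(** If all antichains were small, so would be each of the countably many levels [X m]. Their union
    is k, but k may have countable cofinality, so the contradiction needs one bound for the order
    types of all levels. That bound is the order type of a single small set containing a longer set
    for each level. *)
Theorem Free_uncountable k : infinite_cardinal k -> omega ∈ k -> Free k omega k.
Proof.
  intros Hk Hw f Hf. assert (Ok := k_ordinal k Hk).
  destruct (set_mapping_Fin f k Ok Hf) as [F1 _].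
  destruct (classic (exists h, subset h k /\ antichain k f h /\ ~ small k h)) as [(h & Sh & Ah & Nh)|N].
  { exists h. split; [exact Sh|split; [now apply (antichain_free k f Ok Hf)|]].
    now apply not_small_equipotent. }
  exfalso.
  assert (A : forall h, subset h k -> antichain k f h -> small k h).
  { intros h Sh Ah. apply NNPP; intros Nh. eauto. }
  clear N. set (T := tree k (ap f)).
  assert (HT : Fun1 T) by (unfold T; exact _).
  set (e := fun y => del y (T y)). assert (He : Fun1 e) by (unfold e; exact _).
  set (Q := fun y => sep k (fun z => e z = e y)). assert (HQ : Fun1 Q) by (unfold Q; exact _).
  set (X := fun m => sep k (fun z => size (T z) = m)). assert (HX : Fun1 X) by (unfold X; exact _).
  assert (SQ : forall y, subset (Q y) k) by (intros y z Hz; unfold Q in Hz; sets in Hz; tauto).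
  assert (SX : forall y, subset (X y) k) by (intros y z Hz; unfold X in Hz; sets in Hz; tauto).
  assert (AX : forall m, small k (X m)).
  { intros m. apply A; [apply SX|]. intros i j Hi Hj Nij K. apply Nij.
    assert (Hi' := Hi). unfold X in Hi, Hj. sets in Hi. sets in Hj. 
    apply (T_size k f Ok Hf); [tauto|exact K|]. unfold T in *. destruct Hi, Hj. congruence. }
  (* Otherwise y would be coded by [e y] and its position in [Q y], and k would embed in a smaller
     ordinal. *)
  assert (unbounded : forall d, d ∈ k -> exists y, y ∈ k /\ ~ subset (idx (Q y) k) d).
  { intros d Hd. apply NNPP; intros N.
    assert (B : forall y, y ∈ k -> subset (idx (Q y) k) d).
    { intros y Hy. apply NNPP; intros Ny. eauto. }
    destruct (max_in_k k Hk d omega Hd Hw) as (d' & Hd' & S1 & S2).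
    apply (cardinal_no_embeds k d' (proj1 Hk) Hd').
    apply (embeds_by_code d' k e e (fun y => idx (Q y) y)).
    - now apply (k_mem_ordinal k Hk).
    - intros Fd. apply omega_infinite. now apply (finite_subset d').
    - intros p q. apply (tree_pred_closed k (ap f) Ok).
    - apply (tree_wf k (ap f) Ok).
    - intros y Hy. split; [|split].
      + apply (finite_subset (T y)); [now apply (tree_finite k (ap f) Ok F1)|].
        intros z Hz. unfold e in Hz. sets in Hz. tauto.
      + intros z; auto.
      + apply S1, (B y Hy). apply idx_lt; [exact Ok| |exact Hy]. unfold Q. now sets.
    - intros y y' Hy Hy' E1 E2.
      assert (EQ : Q y = Q y') by (unfold Q; now rewrite E1). rewrite EQ in E2.
      apply idx_inj in E2; try (now apply (k_mem_ordinal k Hk)); auto; unfold Q; now sets. }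
  set (b := fun m => idx (X m) k). assert (Hb : Fun1 b) by (unfold b; exact _).
  assert (b_k : forall m, b m ∈ k) by (intros m; apply (small_idx k Hk); auto).
  (* For each level a set [Q (y m)] at least as long as the level; taking the least y avoids
     countable choice. *)
  set (y := fun m => least (fun y => y ∈ k /\ ~ subset (idx (Q y) k) (b m))).
  assert (Hy : Fun1 y) by (unfold y; exact _).
  assert (y_spec : forall m, y m ∈ k /\ subset (b m) (idx (Q (y m)) k)).
  { intros m. destruct (unbounded (b m) (b_k m)) as (v & Hv & Nv).
    destruct (least_spec (fun y => y ∈ k /\ ~ subset (idx (Q y) k) (b m)) v) as (_ & (K1 & K2) & _); auto.
    { now apply (k_mem_ordinal k Hk). }
    fold (y m) in K1, K2. split; [exact K1|].
    destruct (ordinal_le_or_lt (idx (Q (y m)) k) (b m)) as [L|L].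
    - now apply idx_ordinal.
    - now apply (k_mem_ordinal k Hk).
    - contradiction.
    - apply ordinal_subset; [now apply idx_ordinal|exact L]. }
  set (U := bigcup (image omega (fun m => Q (y m)))).
  set (E := bigcup (image omega (fun m => e (y m)))).
  assert (SU : subset U k).
  { intros z Hz. unfold U in Hz. sets in Hz. destruct Hz as (w & Hw' & Hz). sets in Hw'.
    destruct Hw' as (m & _ & ->). now apply SQ in Hz. }
  assert (smallE : small k E).
  { unfold E. apply (small_union k Hk omega (fun m => e (y m)) omega); [|exact Hw|].
    - apply small_mem. exact Hw.
    - intros m _. destruct (y_spec m) as [Ym _].
      assert (S : subset (e (y m)) k).
      { intros z Hz. unfold e in Hz. sets in Hz. destruct Hz as [Hz _].
        now apply (tree_subset k (ap f)) in Hz. }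
      split; [exact S|]. apply ordinal_subset; [exact ordinal_omega|]. apply in_omega.
      apply finite_ordinal_natural; [now apply idx_ordinal|].
      apply (finite_embeds _ (e (y m))).
      + now apply equipotent_embeds, equipotent_sym, idx_subset_equipotent.
      + apply (finite_subset (T (y m))); [now apply (tree_finite k (ap f) Ok F1)|].
        intros z Hz. unfold e in Hz. sets in Hz. tauto. }
  assert (smallU : small k U).
  { apply (small_subset k _ (cup (diff U E) E)).
    - intros z Hz. sets. destruct (classic (z ∈ E)); auto.
    - apply (small_cup k Hk); [|exact smallE]. apply A.
      + intros z Hz. sets in Hz. now apply SU.
      (* Whatever lies strictly below a point of [Q (y m)] is in [e (y m)], hence in the deleted set
         E. *)
      + intros i j Hi Hj Nij K. sets in Hi. sets in Hj. destruct Hi as [Hi _], Hj as [_ Hj].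
        apply Hj. unfold U in Hi. sets in Hi. destruct Hi as (w & Hw' & Hi). sets in Hw'.
        destruct Hw' as (m & Hm & ->). unfold Q in Hi. sets in Hi. destruct Hi as [Hi Ei].
        unfold E. sets. exists (e (y m)). sets. split; [eauto|]. rewrite <- Ei.
        unfold e, T. sets. auto. }
  (* The order type of U bounds those of all levels, and k becomes a countable union with a common
     bound. *)
  assert (tau := proj1 (small_idx k Hk U SU) smallU).
  apply (k_not_small k Hk).
  apply (small_subset k _ (bigcup (image omega X))).
  - intros z Hz. sets. exists (X (size (T z))). sets. split.
    + exists (size (T z)). split; [|reflexivity]. apply in_omega, size_spec.
      now apply (tree_finite k (ap f) Ok F1).
    + unfold X. now sets.
  - apply (small_union k Hk omega X (idx U k)); [now apply small_mem|exact tau|].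
    intros m Hm. split; [apply SX|]. intros v Hv.
    apply (idx_mono (Q (y m)) U k).
    + intros z Hz. unfold U. sets. exists (Q (y m)). sets. eauto.
    + exact Ok.
    + now apply (y_spec m).
Qed.

End Free.

(** * Property B *)

Section PropertyB.
Context {M : set_structure} {zf : ZF M}.
Implicit Types (a b c d p q r s t x y z m i j A B : M).

Section OrderTypeOmega.
Variables k n s : M.
Hypothesis Ok : ordinal k.
Hypothesis Hn : natural n.
Hypothesis s_k : forall A, A ∈ s -> subset A k.
Hypothesis s_inf : forall A, A ∈ s -> ~ finite A.
Hypothesis s_fin : forall A x, A ∈ s -> x ∈ A -> finite (cap A x).
Hypothesis s_ad : forall A B, A ∈ s -> B ∈ s -> A <> B -> card_lt (cap A B) n.

Definition big A x : Prop := ~ card_lt (cap A x) n.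
Definition bigs x : M := sep s (fun A => big A x).
(* Adds to x the least missing element of each A that is large on x. *)
Definition next x : M :=
  cup x (sep k (fun i => exists A, A ∈ s /\ big A x /\ i ∈ A /\ i ∉ x /\ subset (cap A i) x)).

#[global] Instance definable_big : DefinableRel2 big.
Proof. definable_by big. Qed.
#[global] Instance definable_bigs : DefinableFun1 bigs.
Proof. definable_by bigs. Qed.
#[global] Instance definable_next : DefinableFun1 next.
Proof. definable_by next. Qed.

Lemma big_mono A x y : subset (cap A x) y -> big A x -> big A y.
Proof.
  intros S H K. apply H. apply (card_lt_natural_mono (cap A y)); auto.
  intros i Hi. assert (Hi' := S i Hi). sets in Hi. sets. tauto.
Qed.

(** Two members with the same trace on x would share at least n points. Thus a finite x has only
    finitely many big members. *)
Lemma big_inj A B x : A ∈ s -> B ∈ s -> big A x -> cap A x = cap B x -> A = B.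
Proof.
  intros HA HB H E. apply NNPP; intros N. apply H.
  apply (card_lt_natural_mono (cap A B)); auto.
  intros i Hi. assert (Hi' := Hi). rewrite E in Hi'. sets in Hi. sets in Hi'. sets. tauto.
Qed.

Lemma bigs_finite x : finite x -> finite (bigs x).
Proof.
  intros Fx. apply (finite_embeds _ (power x)); [|now apply finite_power].
  apply (embeds_intro _ _ (fun A => cap A x)).
  - intros A _. sets. intros i Hi. sets in Hi. tauto.
  - intros A B HA HB. unfold bigs in HA, HB. sets in HA. sets in HB. apply big_inj; tauto.
Qed.

Lemma in_next x i : i ∈ next x <-> i ∈ x \/
  (i ∈ k /\ exists A, A ∈ s /\ big A x /\ i ∈ A /\ i ∉ x /\ subset (cap A i) x).
Proof. unfold next. sets. reflexivity. Qed.

Lemma next_Fin x : x ∈ Fin k -> next x ∈ Fin k.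
Proof.
  rewrite !in_Fin. intros [S Fx]. split.
  - intros i Hi. apply in_next in Hi. destruct Hi as [Hi|[Hi _]]; auto.
  - apply (finite_subset (cup x (image (bigs x)
             (fun A => the (fun i => i ∈ A /\ i ∉ x /\ subset (cap A i) x))))).
    + apply finite_cup; [exact Fx|].
      apply (finite_image (bigs x) (fun A => the (fun i => i ∈ A /\ i ∉ x /\ subset (cap A i) x))).
      now apply bigs_finite.
    + intros i Hi. apply in_next in Hi. sets. destruct Hi as [Hi|[Hi (A & HA & H1 & H2 & H3 & H4)]]; [auto|].
      right. exists A. split; [unfold bigs; now sets|]. symmetry. apply the_eq; [auto|].
      intros j (K2 & K3 & K4).
      destruct (ordinal_trichotomy i j) as [L|[L|L]].
      * now apply (ordinal_mem k).
      * apply (ordinal_mem k); [exact Ok|]. now apply (s_k A).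
      * exfalso. apply H3, K4. sets. auto.
      * now symmetry.
      * exfalso. apply K3, H4. sets. auto.
Qed.

Lemma next_ext x : x ∈ Fin k -> subset x (next x).
Proof. intros _ i Hi. apply in_next. auto. Qed.

(** The least missing point, unlike an arbitrary one, survives an enlargement of x: it is then
    present already or still the least missing one. *)
Lemma next_mono x y : x ∈ Fin k -> y ∈ Fin k -> subset x y -> subset (next x) (next y).
Proof.
  intros _ _ S i. rewrite !in_next. intros [H|[H (A & HA & H1 & H2 & H3 & H4)]]; [auto|].
  destruct (classic (i ∈ y)) as [K|K]; [auto|right]. split; [exact H|].
  exists A. split; [exact HA|split; [|split; [exact H2|split; [exact K|]]]].
  - apply (big_mono A x); [|exact H1]. intros j Hj. sets in Hj. apply S. tauto.
  - intros j Hj. auto.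
Qed.

Local Notation D := (hull next).

(** The analogue of [support]: the first finite set whose hull contains at least n points of A. *)
Definition base A : M := fin_least k (fun p => big A (D p)).

#[global] Instance definable_base : DefinableFun1 base.
Proof. definable_by base. Qed.

Lemma big_finite_subset A x : big A x -> exists y, finite y /\ subset y A /\ subset y x /\ big A y.
Proof.
  intros H. destruct (not_card_lt_finite (cap A x) n Hn H) as (y & Fy & Sy & Ny).
  exists y. split; [exact Fy|]. split; [|split].
  - intros i Hi. apply Sy in Hi. sets in Hi. tauto.
  - intros i Hi. apply Sy in Hi. sets in Hi. tauto.
  - intros K. apply Ny. replace y with (cap A y); [exact K|].
    apply set_ext; intros i. sets. split; [tauto|]. intros Hi. split; [|exact Hi].
    apply Sy in Hi. sets in Hi. tauto.
Qed.

Lemma base_spec A : A ∈ s -> base A ∈ Fin k /\ big A (D (base A)) /\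
  forall q, q ∈ Fin k -> fin_lt q (base A) -> ~ big A (D q).
Proof.
  intros HA.
  destruct (big_finite_subset A A) as (y & Fy & Sy & _ & By).
  { intros K. apply (s_inf A HA). replace A with (cap A A); [now apply (card_lt_natural_finite _ n)|].
    apply set_ext; intros i. sets. tauto. }
  assert (Hy : y ∈ Fin k) by (apply in_Fin; split; [|exact Fy]; intros i Hi; apply (s_k A); auto).
  unfold base. apply (fin_least_spec k (fun p => big A (D p)) y); [exact Ok|exact Hy|].
  apply (big_mono A y); [|exact By]. intros i Hi. sets in Hi.
  apply (hull_ext k next Ok y Hy). tauto.
Qed.

Section ConeOfBase.
Variables e a : M.
Hypothesis He : e ∈ Fin k.
Hypothesis Ha : subset a k.

Lemma big_cone A : big A (cone next e a) -> exists t, t ∈ Fin a /\ big A (D (cup e t)).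
Proof.
  intros H. destruct (big_finite_subset _ _ H) as (y & Fy & Sy & Cy & By).
  destruct (cone_directed k next Ok next_Fin next_ext e a He Ha y Fy Cy) as (t & Ht & St).
  exists t. split; [exact Ht|]. apply (big_mono A y); [|exact By].
  intros i Hi. sets in Hi. apply St. tauto.
Qed.

(** The least point j of A outside the cone would have only finitely many points of A below it. One
    hull contains these and n points of A, so the next step adds j. *)
Lemma big_cone_subset A : ~ finite a -> A ∈ s -> big A (cone next e a) -> subset A (cone next e a).
Proof.
  intros Na HA H i Hi. apply NNPP; intros Ni.
  destruct (big_cone A H) as (t0 & Ht0 & B0).
  destruct (least_exists (fun i => i ∈ A /\ i ∉ cone next e a) i) as (j & Oj & [Hj Nj] & Lj).
  { apply (ordinal_mem k); [exact Ok|]. now apply (s_k A). }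
  { auto. }
  destruct (cone_directed k next Ok next_Fin next_ext e a He Ha (cap A j)) as (t1 & Ht1 & S1).
  { now apply s_fin. }
  { intros l Hl. sets in Hl. apply NNPP; intros Nl. apply (Lj l); tauto. }
  assert (Ht : cup t0 t1 ∈ Fin a).
  { rewrite in_Fin in *. destruct Ht0, Ht1. split; [|now apply finite_cup].
    intros z Hz. sets in Hz. destruct Hz; auto. }
  assert (Hc := cup_Fin k e a He Ha _ Ht).
  assert (M0 : subset (D (cup e t0)) (D (cup e (cup t0 t1)))).
  { apply (hull_mono k next Ok next_Fin next_ext); auto; [now apply (cup_Fin k e a)|].
    intros z Hz. sets in Hz. sets. tauto. }
  assert (M1 : subset (D (cup e t1)) (D (cup e (cup t0 t1)))).
  { apply (hull_mono k next Ok next_Fin next_ext); auto; [now apply (cup_Fin k e a)|].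
    intros z Hz. sets in Hz. sets. tauto. }
  assert (Nc : j ∉ D (cup e (cup t0 t1))).
  { intros K. apply Nj. rewrite in_cone by exact _. eauto. }
  apply Nj. apply (cone_closed k next Ok next_Fin next_mono e a He Ha (D (cup e (cup t0 t1))) (cup t0 t1) Na Ht).
  - now apply (hull_Fin k next Ok next_Fin).
  - intros z; exact (fun H => H).
  - apply in_next. right. split; [now apply (s_k A)|].
    exists A. split; [exact HA|split; [|split; [exact Hj|split; [exact Nc|]]]].
    + apply (big_mono A (D (cup e t0))); [|exact B0]. intros z Hz. sets in Hz. apply M0, Hz.
    + intros z Hz. now apply M1, S1.
Qed.
End ConeOfBase.

(** Members with equal bases count as earlier than each other. Only finitely many share a base, so
    the remainders are still infinite and become disjoint without a tie-break. *)
Definition earlier A : M :=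
  sep s (fun B => B <> A /\ (base B = base A \/ fin_lt (base B) (base A))).

#[global] Instance definable_earlier : DefinableFun1 earlier.
Proof. definable_by earlier. Qed.

Lemma in_earlier A B : B ∈ earlier A <->
  B ∈ s /\ B <> A /\ (base B = base A \/ fin_lt (base B) (base A)).
Proof. unfold earlier. sets. reflexivity. Qed.

(** An earlier B either is one of finitely many, each meeting A in fewer than n points, or is
    contained in one of finitely many cones. A cone meets A in fewer than n points as well, since
    otherwise the base of A would come earlier. *)
Lemma earlier_finite A : A ∈ s -> finite (cap A (bigcup (earlier A))).
Proof.
  intros HA. destruct (base_spec A HA) as (PA & BA & LA).
  assert (FP : finite (base A)) by now apply in_Fin in PA.
  set (p := base A) in *.
  set (Z := del A (bigcup (image (lows k p) (fun q => bigs (D q))))).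
  assert (FZ : finite Z).
  { apply (finite_subset (bigcup (image (lows k p) (fun q => bigs (D q))))).
    - apply (finite_union (lows k p) (fun q => bigs (D q))); [now apply lows_finite|].
      intros q Hq. apply bigs_finite. unfold lows in Hq. sets in Hq.
      apply in_Fin with k. now apply (hull_Fin k next Ok next_Fin).
    - intros B HB. unfold Z in HB. sets in HB. sets. tauto. }
  set (I := sep p (fun a => ~ finite a)).
  apply (finite_subset (cup (bigcup (image I (fun a => cap A (cone next (above a p) a))))
                            (bigcup (image Z (fun B => cap A B))))).
  - apply finite_cup.
    + apply (finite_union I (fun a => cap A (cone next (above a p) a))).
      * apply (finite_subset p); [exact FP|]. intros a Ha. unfold I in Ha. sets in Ha. tauto.
      * intros a Ha. unfold I in Ha. sets in Ha. destruct Ha as [Ha Na].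
        apply (card_lt_natural_finite _ n Hn). apply NNPP; intros K.
        assert (Sa : subset a k).
        { apply ordinal_subset; [exact Ok|]. apply in_Fin in PA. now apply PA. }
        assert (Ea : above a p ∈ Fin k).
        { apply (Fin_subset k p); [exact PA|]. intros x Hx. unfold above in Hx. sets in Hx. tauto. }
        destruct (big_cone (above a p) a Ea Sa A K) as (t & Ht & Bt).
        apply (LA (cup (above a p) t)); [now apply (cup_Fin k _ a)| |exact Bt].
        apply fin_lt_above; auto. intros x Hx. now apply (Fin_ordinal k p).
    + apply (finite_union Z (fun B => cap A B)); [exact FZ|].
      intros B HB. apply (card_lt_natural_finite _ n Hn). unfold Z in HB. sets in HB.
      destruct HB as [(w & Hw & HB) N]. sets in Hw. destruct Hw as (q & Hq & ->).
      unfold bigs in HB. sets in HB. apply s_ad; tauto || (intros ->; tauto).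
  - intros i Hi. sets in Hi. destruct Hi as [Hi (B & HB & HiB)].
    apply in_earlier in HB. destruct HB as (HB & NB & LB). fold p in LB.
    destruct (base_spec B HB) as (PB & BB & _). sets.
    destruct (fin_le_hull k Ok p (base B) PA PB LB) as [K|(a & t & Ha & Na & Sa & Ea & Ht & E)].
    + right. exists (cap A B). sets. split; [|auto]. exists B. split; [|reflexivity].
      unfold Z. sets. split; [|exact NB]. exists (bigs (D (base B))). sets.
      split; [eauto|]. unfold bigs. now sets.
    + left. exists (cap A (cone next (above a p) a)). sets. split.
      * exists a. split; [unfold I; now sets|reflexivity].
      * split; [exact Hi|]. apply (big_cone_subset (above a p) a Ea Sa B Na HB); [|exact HiB].
        apply (big_mono B (D (base B))); [|exact BB]. intros z Hz. sets in Hz.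
        rewrite in_cone by exact _. exists t. split; [exact Ht|]. rewrite <- E. tauto.
Qed.

Lemma property_B_order_type_omega : property_B s.
Proof.
  set (E := fun A => diff A (bigcup (earlier A))). assert (HE : Fun1 E) by (unfold E; exact _).
  set (l := fun A => least (fun x => x ∈ E A)). assert (Hl : Fun1 l) by (unfold l; exact _).
  assert (E_A : forall A x, x ∈ E A -> x ∈ A).
  { intros A x Hx. unfold E in Hx. sets in Hx. tauto. }
  assert (E_inf : forall A, A ∈ s -> ~ finite (E A)).
  { intros A HA F. apply (s_inf A HA).
    apply (finite_subset (cup (E A) (cap A (bigcup (earlier A))))).
    - apply finite_cup; [exact F|now apply earlier_finite].
    - intros x Hx. unfold E. sets. destruct (classic (exists y, y ∈ earlier A /\ x ∈ y)); tauto. }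
  assert (E_disj : forall A B x, A ∈ s -> B ∈ s -> x ∈ E A -> x ∈ E B -> A = B).
  { assert (K : forall A B x, A ∈ s -> B ∈ s -> x ∈ E A -> x ∈ E B ->
       base B = base A \/ fin_lt (base B) (base A) -> A = B).
    { intros A B x HA HB HxA HxB L. apply NNPP; intros N.
      assert (HB' := E_A B x HxB). unfold E in HxA. sets in HxA. destruct HxA as [_ HxA].
      apply HxA. exists B. split; [|exact HB']. apply in_earlier. split; [exact HB|]. auto. }
    intros A B x HA HB HxA HxB.
    destruct (fin_lt_total k (base A) (base B) Ok) as [L|[L|L]]; try now apply base_spec.
    - symmetry. apply (K B A x); auto.
    - apply (K A B x); auto.
    - apply (K A B x); auto. }
  assert (l_E : forall A, A ∈ s -> l A ∈ E A).
  { intros A HA. destruct (nonempty_ex (E A)) as [x Hx].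
    { intros Z. apply (E_inf A HA). rewrite Z. apply finite_void. }
    destruct (least_spec (fun x => x ∈ E A) x) as (_ & K & _); [|exact Hx|exact K].
    apply (ordinal_mem k); [exact Ok|]. apply (s_k A HA). now apply E_A. }
  exists (image s l). intros A HA. split.
  - exists (l A). split; [sets; eauto|]. now apply E_A, l_E.
  (* A second point of [E A] avoids the splitting set: as the chosen point of some [E B] it would
     force B to be A. *)
  - destruct (nonempty_ex (del (l A) (E A))) as [x Hx].
    { intros Z. apply (E_inf A HA). rewrite <- (adj_del (E A) (l A) (l_E A HA)), Z.
      apply finite_adj, finite_void. }
    sets in Hx. destruct Hx as [Hx Nx]. exists x. split; [now apply E_A|].
    intros K. sets in K. destruct K as (B & HB & ->).
    apply Nx. f_equal. apply (E_disj B A (l B)); [exact HB|exact HA|now apply l_E|exact Hx].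
Qed.

End OrderTypeOmega.

(** A set splitting the first omega elements of A splits A, and almost disjointness passes to
    subsets, so all members may be taken of order type omega. *)
Theorem property_B_almost_disjoint k n : ordinal k -> natural n -> M_to_B k omega n.
Proof.
  intros Ok Hn s Hs Had.
  set (g := fun A => initial A). assert (Hg : Fun1 g) by (unfold g; exact _).
  assert (g_sub : forall A, subset (g A) A) by (intros A x Hx; now apply in_initial in Hx).
  assert (A_inf : forall A, A ∈ s -> ~ finite A).
  { intros A HA (m & Hm & E). apply omega_infinite. exists m. split; [exact Hm|].
    apply (equipotent_trans _ A); [|exact E]. apply equipotent_sym. now apply Hs. }
  assert (g_inf : forall A, A ∈ s -> ~ finite (g A)).
  { intros A HA. apply (initial_infinite A k Ok); [now apply (Hs A)|now apply A_inf]. }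
  assert (ad : forall A B, A ∈ s -> B ∈ s -> A <> B -> card_lt (cap A B) n).
  { intros A B HA HB N. apply (Had A B); auto. intros x. apply in_cap. }
  destruct (property_B_order_type_omega k n (image s g)) as [x Hx]; auto.
  - intros A HA. sets in HA. destruct HA as (B & HB & ->). intros y Hy. apply (Hs B HB). now apply g_sub.
  - intros A HA. sets in HA. destruct HA as (B & HB & ->). auto.
  - intros A y HA Hy. sets in HA. destruct HA as (B & HB & ->). now apply initial_cap_finite.
  - intros A B HA HB N. sets in HA. sets in HB. destruct HA as (A' & HA & ->). destruct HB as (B' & HB & ->).
    apply (card_lt_natural_mono (cap A' B')); [exact Hn| |].
    + intros z Hz. sets in Hz. sets. split; apply g_sub; tauto.
    + apply ad; auto. intros ->. now apply N.
  - exists x. intros A HA. destruct (Hx (g A)) as [(y & Hy & Hy') (z & Hz & Hz')]; [sets; eauto|].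
    split; [exists y|exists z]; auto. split; [exact Hy|now apply g_sub]. split; [now apply g_sub|exact Hz'].
Qed.

End PropertyB.

(** * End-homogeneous trees and cliques *)

Section EndHomogeneous.
Context {M : set_structure} {zf : ZF M}.
Implicit Types (a b c d f p q r s t x y z m n i j h u v w : M).
Variables (k Y : M) (R : M -> M -> Prop).
Hypothesis Ok : ordinal k.
Hypothesis HY : subset Y k.
Context {HR : Def2 R}.

(* The set path y is e(y) of the header, see in_path.  Since membership of x in
   e(y) refers to e(y) ∩ x, it is decided by an inner recursion on x. *)
Definition path_flag y f x : M :=
  wfrec (fun b => b)
    (fun b g => ite (b ∈ Y /\ R b y /\ ap f b = sep b (fun z => ap g z = single void)) (single void) void) x.

Definition path y : M :=
  wfrec (fun b => b) (fun b f => sep b (fun x => path_flag b f x = single void)) y.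

#[global] Instance DefinableTerm_path_flag (t1 t2 t3 : (nat -> M) -> M) :
  DefinableTerm t1 -> DefinableTerm t2 -> DefinableTerm t3 ->
  DefinableTerm (fun e => path_flag (t1 e) (t2 e) (t3 e)).
Proof. intros H1 H2 H3. unfold path_flag. exact _. Qed.

#[global] Instance definable_path : DefinableFun1 path.
Proof. definable_by path. Qed.

Lemma in_path y x : ordinal y ->
  x ∈ path y <-> x ∈ y /\ x ∈ Y /\ R x y /\ path x = cap (path y) x.
Proof.
  intros Hy.
  set (g := path_flag y (graph y path)). assert (Hg : Fun1 g) by (unfold g; exact _).
  assert (E : path y = sep y (fun x => g x = single void)).
  { unfold path at 1. rewrite (wfrec_eq ordinal (fun b => b) _ ordinal_pr ordinal_wf y Hy).
    reflexivity. }
  assert (N : void <> (single void : M)).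
  { intros K. apply (in_void void). rewrite K at 2. now sets. }
  assert (G : forall x, ordinal x -> g x = ite (x ∈ Y /\ R x y /\ ap (graph y path) x =
     sep x (fun z => g z = single void)) (single void) void).
  { intros z Hz. unfold g at 1, path_flag.
    rewrite (wfrec_eq ordinal (fun b => b) _ ordinal_pr ordinal_wf z Hz).
    fold (path_flag y (graph y path)). fold g.
    replace (sep z (fun w => ap (graph z g) w = single void)) with (sep z (fun w => g w = single void)); [reflexivity|].
    apply set_ext; intros w. sets. split; intros [Hw K]; (split; [exact Hw|]);
      rewrite ap_graph in * by (exact _ || exact Hw); exact K. }
  assert (K : x ∈ path y <-> x ∈ y /\ g x = single void) by (rewrite E; now sets).
  rewrite K. split.
  - intros [Hx Gx]. assert (Ox : ordinal x) by now apply (ordinal_mem y).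
    rewrite (G x Ox) in Gx.
    destruct (classic (x ∈ Y /\ R x y /\ ap (graph y path) x = sep x (fun z => g z = single void))) as [H|H].
    + destruct H as (H1 & H2 & H3). split; [exact Hx|split; [exact H1|split; [exact H2|]]].
      rewrite ap_graph in H3 by (exact _ || exact Hx). rewrite H3, E.
      apply set_ext; intros z. sets. split; [|tauto]. intros [Hz Kz].
      split; [split; [now apply (ordinal_trans y x)|exact Kz]|exact Hz].
    + rewrite ite_false in Gx by exact H. contradiction.
  - intros (Hx & H1 & H2 & H3). assert (Ox : ordinal x) by now apply (ordinal_mem y).
    split; [exact Hx|]. rewrite (G x Ox). apply ite_true. split; [exact H1|split; [exact H2|]].
    rewrite ap_graph by (exact _ || exact Hx). rewrite H3, E.
    apply set_ext; intros z. sets. split; [tauto|]. intros [Hz Kz].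
    split; [split; [now apply (ordinal_trans y x)|exact Kz]|exact Hz].
Qed.

Lemma path_subset y : ordinal y -> subset (path y) y.
Proof. intros Hy x Hx. apply in_path in Hx; tauto. Qed.

Lemma path_subset_Y y : ordinal y -> subset (path y) Y.
Proof. intros Hy x Hx. apply in_path in Hx; tauto. Qed.

(** If y and z were joined, equality of the paths would make y meet the condition for belonging to
    the path of z, which is the path of y and lies below y. *)
Lemma path_independent y z : y ∈ Y -> z ∈ Y -> path y = path z -> y ∈ z -> ~ R y z.
Proof.
  intros Hy Hz E L H.
  assert (Oy : ordinal y) by (apply (ordinal_mem k); auto).
  assert (Oz : ordinal z) by (apply (ordinal_mem k); auto).
  assert (K : y ∈ path y).
  { rewrite E. apply in_path; [exact Oz|]. split; [exact L|split; [exact Hy|split; [exact H|]]].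
    rewrite <- E. apply set_ext; intros w. sets. split; [|tauto].
    intros Hw. split; [exact Hw|]. now apply path_subset. }
  apply path_subset in K; [|exact Oy]. now apply mem_irrefl in K.
Qed.

(** The path of a member z is the part of the whole path below z, so every smaller member is in the
    path of z and joined to z. *)
Lemma path_clique y x z : ordinal y -> x ∈ path y -> z ∈ path y -> x ∈ z -> R x z.
Proof.
  intros Oy Hx Hz L.
  assert (Oz : ordinal z) by (apply (ordinal_mem y); [exact Oy|now apply path_subset]).
  apply in_path in Hz; [|exact Oy]. destruct Hz as (_ & _ & _ & E).
  assert (K : x ∈ path z) by (rewrite E; sets; auto).
  apply in_path in K; tauto.
Qed.

Lemma path_related y x : ordinal y -> x ∈ path y -> R x y.
Proof. intros Oy Hx. apply in_path in Hx; tauto. Qed.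

Lemma path_initial y x : ordinal y -> x ∈ path y -> path x = cap (path y) x.
Proof. intros Oy Hx. apply in_path in Hx; tauto. Qed.

End EndHomogeneous.
#[global] Opaque path path_flag.

(** * Graphs on an infinite cardinal: small degrees and the regular case *)

Section Graphs.
Context {M : set_structure} {zf : ZF M}.
Implicit Types (a b c d f p q r s t x y z m n i j h u v w : M).

Lemma not_cofinal_bounded a k (G : M -> M) {HG : Fun1 G} : ordinal k ->
  (~ exists f, cofinal_map f a k) -> (forall x, x ∈ a -> G x ∈ k) ->
  exists b, b ∈ k /\ forall x, x ∈ a -> G x ∈ b.
Proof.
  intros Ok N H. apply NNPP; intros K. apply N. exists (graph a G).
  split; [now apply graph_function|].
  intros b Hb. apply NNPP; intros Nb. apply K. exists b. split; [exact Hb|].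
  intros x Hx. destruct (ordinal_trichotomy (G x) b) as [L|[L|L]]; [| |exact L| |].
  - apply (ordinal_mem k); auto.
  - now apply (ordinal_mem k).
  - exfalso. apply Nb. exists x, (G x). split; [exact Hx|split; [|auto]].
    apply app_graph; auto.
  - exfalso. apply Nb. exists x, (G x). split; [exact Hx|split; [|auto]].
    apply app_graph; auto.
Qed.

Variables (k : M) (E : M -> M -> Prop).
Hypothesis Hk : infinite_cardinal k.
Context {HE : Def2 E}.
Hypothesis E_sym : forall x y, E x y -> E y x.

Definition clique h : Prop := forall x y, x ∈ h -> y ∈ h -> x <> y -> E x y.
Definition independent h : Prop := forall x y, x ∈ h -> y ∈ h -> x <> y -> ~ E x y.

#[global] Instance definable_clique : DefinableRel1 clique.
Proof. definable_by clique. Qed.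

Let Ok : ordinal k := k_ordinal k Hk.

Lemma clique_by_order h : (forall x, x ∈ h -> ordinal x) ->
  (forall x y, x ∈ h -> y ∈ h -> x ∈ y -> E x y) -> clique h.
Proof.
  intros O H x y Hx Hy N. destruct (ordinal_trichotomy x y) as [L|[L|L]]; auto. contradiction.
Qed.

Lemma independent_by_order h : (forall x, x ∈ h -> ordinal x) ->
  (forall x y, x ∈ h -> y ∈ h -> x ∈ y -> ~ E x y) -> independent h.
Proof.
  intros O H x y Hx Hy N. destruct (ordinal_trichotomy x y) as [L|[L|L]];
    [now apply O|now apply O|now apply H|contradiction|].
  intros K. apply (H y x); auto.
Qed.

Lemma infinite_clique h : subset h k -> clique h -> ~ finite h ->
  exists h, subset h k /\ has_order_type h omega /\ clique h.
Proof.
  intros S C N.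
  assert (S' : subset (initial h) k).
  { intros x Hx. apply in_initial in Hx. apply S. tauto. }
  exists (initial h). split; [exact S'|split].
  - rewrite <- (idx_omega (initial h) k Ok).
    + now apply idx_order_type.
    + replace (cap (initial h) k) with (initial h); [now apply (initial_infinite h k)|].
      apply set_ext; intros x. sets. split; [|tauto]. intros Hx; split; [exact Hx|now apply S'].
    + intros x Hx _. now apply initial_cap_finite.
  - intros x y Hx Hy. apply in_initial in Hx. apply in_initial in Hy. apply C; tauto.
Qed.

Section SmallDegrees.
Hypothesis cliques_finite : forall h, subset h k -> clique h -> finite h.

Definition upper_neighbours c : M := sep k (fun y => forall x, x ∈ c -> x ∈ y /\ E x y).

#[global] Instance definable_upper_neighbours : DefinableFun1 upper_neighbours.
Proof. definable_by upper_neighbours. Qed.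

Lemma in_upper_neighbours c y : y ∈ upper_neighbours c <->
  y ∈ k /\ forall x, x ∈ c -> x ∈ y /\ E x y.
Proof. unfold upper_neighbours. sets. reflexivity. Qed.

(** If no good clique extends a good c by an upper neighbour, then all degrees inside
    [upper_neighbours c] are small. *)
Definition good c : Prop := c ∈ Fin k /\ clique c /\ ~ small k (upper_neighbours c).

#[global] Instance definable_good : DefinableRel1 good.
Proof. definable_by good. Qed.

Definition next_vertex c : M := least (fun x => x ∈ upper_neighbours c /\ good (adj x c)).

#[global] Instance definable_next_vertex : DefinableFun1 next_vertex.
Proof. definable_by next_vertex. Qed.

(** Replaces dependent choice: every element is the least admissible extension of the part below it.
    Canonical cliques are then initial segments of one sequence. *)
Definition canonical c : Prop := good c /\ forall x, x ∈ c -> x = next_vertex (cap c x).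

#[global] Instance definable_canonical : DefinableRel1 canonical.
Proof. definable_by canonical. Qed.

Lemma canonical_k c x : canonical c -> x ∈ c -> x ∈ k.
Proof. intros [[H _] _] Hx. apply in_Fin in H. now apply H. Qed.

Lemma canonical_ordinal c x : canonical c -> x ∈ c -> ordinal x.
Proof. intros H Hx. apply (ordinal_mem k); [exact Ok|]. now apply (canonical_k c). Qed.

(** The first element of d not below x extends the same part as x does, so both equal the same
    [next_vertex]. *)
Lemma canonical_agree c d x y : canonical c -> canonical d -> x ∈ c -> cap c x = cap d x ->
  y ∈ d -> y ∉ x -> x ∈ d.
Proof.
  intros Hc Hd Hx Exd Hy Nyx.
  destruct (least_exists (fun y => y ∈ d /\ y ∉ x) y) as (w & Ow & [Hw Nw] & Lw); auto.
  { now apply (canonical_ordinal d). }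
  assert (Ox := canonical_ordinal c x Hc Hx).
  assert (Ew : cap d w = cap c x).
  { rewrite Exd. apply set_ext; intros z. sets. split; intros [Hz Lz]; (split; [exact Hz|]).
    - apply NNPP; intros Nz. now apply (Lw z).
    - apply (not_lt_le x w); auto. }
  replace x with w; [exact Hw|].
  rewrite (proj2 Hc x Hx), (proj2 Hd w Hw), Ew. reflexivity.
Qed.

(** At the first element v of d below x and missing from c, both cliques agree below v, and
    [canonical_agree] puts v into c. *)
Lemma canonical_initial c d x y : canonical c -> canonical d -> x ∈ c -> y ∈ d -> y ∈ x -> y ∈ c.
Proof.
  intros Hc Hd Hx Hy L. apply NNPP; intros Ny.
  assert (Ox := canonical_ordinal c x Hc Hx).
  destruct (least_exists (fun y => y ∈ d /\ y ∈ x /\ y ∉ c) y) as (v & Ov & (Hv & Lvx & Nv) & Lv); auto.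
  { now apply (canonical_ordinal d). }
  assert (Sv : forall z, z ∈ d -> z ∈ v -> z ∈ c).
  { intros z Hz Kz. apply NNPP; intros Nz. apply (Lv z); [exact Kz|].
    split; [exact Hz|split; [|exact Nz]]. now apply (ordinal_trans x v). }
  assert (Tv : forall z, z ∈ c -> z ∈ v -> z ∈ d).
  { intros z Hz Kz. apply NNPP; intros Nz.
    destruct (least_exists (fun z => z ∈ c /\ z ∈ v /\ z ∉ d) z) as (w & Ow & (Hw & Lwv & Nw) & Lw); auto.
    { now apply (canonical_ordinal c). }
    apply Nw, (canonical_agree c d w v Hc Hd Hw); auto.
    - apply set_ext; intros q. sets. split; intros [Hq Kq]; (split; [|exact Kq]).
      + apply NNPP; intros Nq. apply (Lw q); [exact Kq|]. split; [exact Hq|split; [|exact Nq]].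
        now apply (ordinal_trans v w).
      + apply Sv; [exact Hq|]. now apply (ordinal_trans v w).
    - now apply mem_asym. }
  apply Nv, (canonical_agree d c v x Hd Hc Hv); auto.
  - apply set_ext; intros q. sets. split; intros [Hq Kq]; split; auto.
  - now apply mem_asym.
Qed.

(** Unless some good clique is maximal, canonical cliques can always be extended, and their union is
    an infinite clique. *)
Lemma small_degree_set : exists Y, subset Y k /\ ~ small k Y /\
  forall x, x ∈ Y -> small k (sep Y (fun y => E x y)).
Proof.
  assert (K : exists c, good c /\ forall x, x ∈ upper_neighbours c -> ~ good (adj x c)).
  { apply NNPP; intros N.
    assert (step : forall c, good c -> exists x, x ∈ upper_neighbours c /\ good (adj x c)).
    { intros c Hc. apply NNPP; intros Nc. apply N. exists c. split; [exact Hc|]. eauto. }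
    clear N.
    assert (nv : forall c, good c -> next_vertex c ∈ upper_neighbours c /\ good (adj (next_vertex c) c)).
    { intros c Hc. destruct (step c Hc) as (x & Hx & Gx).
      destruct (least_spec (fun x => x ∈ upper_neighbours c /\ good (adj x c)) x) as (_ & K & _);
        [|auto|exact K].
      apply (ordinal_mem k); [exact Ok|]. now apply in_upper_neighbours in Hx. }
    assert (ext : forall c, canonical c -> canonical (adj (next_vertex c) c)).
    { intros c [Gc Cc]. destruct (nv c Gc) as [Un Gn]. split; [exact Gn|].
      apply in_upper_neighbours in Un as [_ Un].
      intros x Hx. rewrite in_adj in Hx. destruct Hx as [Hx| ->].
      - replace (cap (adj (next_vertex c) c) x) with (cap c x); [now apply Cc|].
        apply set_ext; intros z. sets. split; [tauto|]. intros [[Hz| ->] L]; [auto|].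
        exfalso. destruct (Un x Hx) as [K _]. now apply (mem_asym _ _ L).
      - replace (cap (adj (next_vertex c) c) (next_vertex c)) with c; [reflexivity|].
        apply set_ext; intros z. sets. split.
        + intros Hz. split; [auto|]. now apply Un.
        + intros [[Hz| ->] L]; [exact Hz|]. now apply mem_irrefl in L. }
    assert (c0 : canonical void).
    { split; [|intros x Hx; now sets in Hx]. split; [apply Fin_void|split].
      - intros x y Hx. now sets in Hx.
      - replace (upper_neighbours void) with k; [now apply k_not_small|].
        apply set_ext; intros y. rewrite in_upper_neighbours. split; [|tauto].
        intros Hy; split; [exact Hy|]. intros x Hx. now sets in Hx. }
    (* The union of all canonical cliques is a clique, hence finite; the extension of the one
       containing its maximum goes beyond that maximum. *)
    set (B := sep k (fun x => exists c, canonical c /\ x ∈ c)).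
    assert (in_B : forall x, x ∈ B <-> exists c, canonical c /\ x ∈ c).
    { intros x. unfold B. sets. split; [tauto|]. intros (c & Hc & Hx).
      split; [now apply (canonical_k c)|eauto]. }
    assert (SB : subset B k) by (intros x Hx; unfold B in Hx; sets in Hx; tauto).
    assert (FB : finite B).
    { apply cliques_finite; [exact SB|]. apply clique_by_order.
      - intros x Hx. apply (ordinal_mem k); [exact Ok|now apply SB].
      - intros x y Hx Hy L. apply in_B in Hx. apply in_B in Hy.
        destruct Hx as (c & Hc & Hx). destruct Hy as (d & Hd & Hy).
        assert (K := canonical_initial d c y x Hd Hc Hy Hx L).
        destruct Hd as [(_ & C & _) _]. apply C; auto. intros ->. now apply mem_irrefl in L. }
    destruct (finite_max B FB) as (m & Hm & Sm).
    - intros x Hx. apply (ordinal_mem k); [exact Ok|now apply SB].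
    - exists (next_vertex void). apply in_B. exists (adj (next_vertex void) void).
      split; [now apply ext|]. sets. auto.
    - apply in_B in Hm. destruct Hm as (c & Hc & Hm).
      assert (Hv : next_vertex c ∈ B).
      { apply in_B. exists (adj (next_vertex c) c). split; [now apply ext|]. sets. auto. }
      destruct (nv c (proj1 Hc)) as [Un _]. apply in_upper_neighbours in Un as [_ Un].
      destruct (Un m Hm) as [L _]. apply Sm in Hv. sets in Hv. destruct Hv as [Hv|Hv].
      + now apply (mem_asym _ _ L).
      + rewrite Hv in L. now apply mem_irrefl in L. }
  destruct K as (c & (Fc & Cc & Nc) & Mc).
  exists (upper_neighbours c). split; [|split; [exact Nc|]].
  - intros y Hy. now apply in_upper_neighbours in Hy.
  - intros x Hx. assert (Hx' := Hx). apply in_upper_neighbours in Hx' as [Kx Ux].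
    assert (S : small k (upper_neighbours (adj x c))).
    { apply NNPP; intros N. apply (Mc x Hx). split; [now apply Fin_adj|split; [|exact N]].
      intros u v Hu Hv Nuv. sets in Hu. sets in Hv. destruct Hu as [Hu| ->], Hv as [Hv| ->].
      - now apply Cc.
      - now apply Ux.
      - apply E_sym. now apply Ux.
      - contradiction. }
    (* Neighbours above x form the upper neighbourhood of the extended clique, which is small by
       maximality; the others lie below x. *)
    apply (small_subset k _ (cup (upper_neighbours (adj x c)) (succ x))).
    + intros y Hy. sets in Hy. destruct Hy as [Hy L]. assert (Hy' := Hy).
      apply in_upper_neighbours in Hy' as [Ky Uy]. sets.
      destruct (ordinal_trichotomy x y) as [K|[K|K]]; try (now apply (ordinal_mem k)); auto.
      left. apply in_upper_neighbours. split; [exact Ky|]. intros z Hz. sets in Hz.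
      destruct Hz as [Hz| ->]; auto.
    + apply (small_cup k Hk); [exact S|]. apply small_mem, (k_succ k Hk), Kx.
Qed.

End SmallDegrees.

Lemma in_k_ordinal x : x ∈ k -> ordinal x.
Proof. now apply ordinal_mem. Qed.

Section Regular.
Hypothesis reg : forall a, a ∈ k -> ~ exists f, cofinal_map f a k.

Lemma small_bounded h : subset h k -> small k h -> exists b, b ∈ k /\ subset h b.
Proof.
  intros S Sm. assert (Hc := proj1 (small_idx k Hk h S) Sm).
  assert (I : forall x x', x ∈ h -> x' ∈ h -> idx h x = idx h x' -> x = x').
  { intros x x' Hx Hx'. apply idx_inj; auto; apply in_k_ordinal; auto. }
  destruct (not_cofinal_bounded (idx h k) k (fun v => inverse h (idx h) v) Ok (reg _ Hc)) as (b & Hb & K).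
  - intros v Hv. rewrite in_idx in Hv by exact Ok. destruct Hv as (z & Hz & _ & ->).
    rewrite inverse_eq; auto.
  - exists b. split; [exact Hb|]. intros x Hx. rewrite <- (inverse_eq h (idx h) x I Hx).
    apply K. apply idx_lt; auto.
Qed.

Definition bound h : M := least (fun b => b ∈ k /\ subset h b).

#[global] Instance definable_bound : DefinableFun1 bound.
Proof. definable_by bound. Qed.

Lemma bound_spec h b : b ∈ k -> subset h b -> bound h ∈ k /\ subset h (bound h).
Proof.
  intros Hb S. apply (least_spec (fun b => b ∈ k /\ subset h b) b); [now apply in_k_ordinal|auto].
Qed.

Lemma bounded_small h b : b ∈ k -> subset h b -> small k h.
Proof. intros Hb S. apply (small_subset k h b S). now apply small_mem. Qed.

(** The points of Y with empty path are independent. If they were bounded, every other point of Y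
    would be joined to one of them, and regularity would bound the union of their bounded
    neighbourhoods, hence Y. *)
Theorem regular_arrow_omega :
  (exists h, subset h k /\ equipotent h k /\ independent h) \/
  (exists h, subset h k /\ has_order_type h omega /\ clique h).
Proof.
  destruct (classic (exists h, subset h k /\ clique h /\ ~ finite h)) as [(h & Sh & Ch & Fh)|N].
  { right. now apply (infinite_clique h). }
  left. destruct small_degree_set as (Y & SY & NY & dY).
  { intros h Sh Ch. apply NNPP; intros Fh. eauto. }
  set (Q := sep Y (fun y => path Y E y = void)).
  assert (SQ : subset Q k) by (intros y Hy; unfold Q in Hy; sets in Hy; now apply SY).
  exists Q. split; [exact SQ|split].
  - apply not_small_equipotent; [exact Hk|exact SQ|]. intros K. apply NY.
    destruct (small_bounded Q SQ K) as (b & Hb & SQb).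
    set (G := fun x => ite (x ∈ Y) (bound (sep Y (fun y => E x y))) void).
    assert (HG : Fun1 G) by (unfold G; exact _).
    assert (G_spec : forall x, x ∈ Y -> G x ∈ k /\ subset (sep Y (fun y => E x y)) (G x)).
    { intros x Hx. unfold G. rewrite ite_true by exact Hx.
      destruct (small_bounded (sep Y (fun y => E x y))) as (d & Hd & Sd); [|now apply dY|].
      - intros y Hy. sets in Hy. now apply SY.
      - now apply (bound_spec _ d). }
    destruct (not_cofinal_bounded b k G Ok (reg b Hb)) as (d & Hd & Kd).
    { intros x _. destruct (classic (x ∈ Y)) as [Hx|Hx]; [now apply G_spec|].
      unfold G. rewrite ite_false by exact Hx. now apply void_in_k. }
    destruct (max_in_k k Hk b d Hb Hd) as (m & Hm & Sb & Sd).
    apply (bounded_small Y m Hm). intros y Hy.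
    assert (Oy : ordinal y) by now apply in_k_ordinal, SY.
    destruct (classic (path Y E y = void)) as [Ey|Ey].
    + apply Sb, SQb. unfold Q. now sets.
    + destruct (nonempty_ex _ Ey) as [x0 Hx0].
      destruct (ordinal_wf (path Y E y)) as (x & Hx & Lx).
      * intros p Hp. apply (ordinal_mem y); [exact Oy|]. now apply (path_subset Y E).
      * eauto.
      * assert (HxY := path_subset_Y Y E y Oy x Hx).
        (* The least element of a path has an empty path. *)
        assert (HxQ : x ∈ Q).
        { unfold Q. sets. split; [exact HxY|]. rewrite (path_initial Y E y x Oy Hx).
          apply is_empty_eq. intros z Hz. sets in Hz. now apply (Lx z). }
        apply Sd. assert (Gd := Kd x (SQb x HxQ)).
        apply (ordinal_trans d (G x)); [now apply in_k_ordinal| |exact Gd].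
        apply G_spec; [exact HxY|]. sets. split; [exact Hy|]. now apply (path_related Y E y x Oy).
  - apply independent_by_order; [intros x Hx; now apply in_k_ordinal, SQ|].
    intros x y Hx Hy L. unfold Q in Hx, Hy. sets in Hx. sets in Hy.
    apply (path_independent k Y E Ok SY); try tauto. destruct Hx, Hy. congruence.
Qed.

(** An infinite path of y supplies its first omega elements, and y itself is the additional top.
    With only finite paths there are countably many levels, which is where uncountability of k
    enters. *)
Theorem regular_arrow_omega_1 : omega ∈ k ->
  (exists h, subset h k /\ equipotent h k /\ independent h) \/
  (exists h, subset h k /\ has_order_type h (succ omega) /\ clique h).
Proof.
  intros Hw. set (e := path k E). assert (He : Fun1 e) by (unfold e; exact _).
  assert (Skk : subset k k) by (intros x; exact (fun H => H)).
  destruct (classic (exists y, y ∈ k /\ ~ finite (e y))) as [(y & Hy & Ny)|N].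
  - right. assert (Oy := in_k_ordinal y Hy). set (h0 := initial (e y)).
    assert (Se : subset (e y) y) by now apply (path_subset k E).
    assert (S0 : subset h0 (e y)) by (intros x Hx; now apply in_initial in Hx).
    assert (Sh : subset (adj y h0) k).
    { intros x Hx. rewrite in_adj in Hx. destruct Hx as [Hx| ->]; [|exact Hy].
      apply (ordinal_trans k y); auto. }
    exists (adj y h0). split; [exact Sh|split].
    + assert (Nyy : forall x, x ∈ y -> (x ∈ adj y h0 <-> x ∈ h0)).
      { intros x Hx. rewrite in_adj. split; [|auto]. intros [H| ->]; [exact H|].
        now apply mem_irrefl in Hx. }
      assert (E1 : idx (adj y h0) y = omega).
      { rewrite (idx_ext _ h0 y Oy Nyy). apply idx_omega; [exact Oy| |].
        - replace (cap h0 y) with h0; [now apply (initial_infinite (e y) y)|].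
          apply set_ext; intros x. rewrite in_cap. split; [auto|tauto].
        - intros x Hx _. now apply initial_cap_finite. }
      assert (E2 : idx (adj y h0) k = succ omega).
      { rewrite <- E1. apply set_ext; intros v. rewrite in_succ, !in_idx by assumption. split.
        - intros (z & Hz & Kz & ->). assert (Hz' := Hz). rewrite in_adj in Hz'. destruct Hz' as [Hz'| ->]; [left|right; reflexivity].
          exists z. split; [exact Hz|split; [now apply Se, S0|reflexivity]].
        - intros [(z & Hz & Kz & ->)| ->].
          + exists z. split; [exact Hz|split; [now apply Sh|reflexivity]].
          + exists y. split; [rewrite in_adj; auto|split; [exact Hy|reflexivity]]. }
      rewrite <- E2. now apply idx_order_type.
    + apply clique_by_order; [intros x Hx; now apply in_k_ordinal, Sh|].
      intros x z Hx Hz L. rewrite in_adj in Hx, Hz. destruct Hx as [Hx| ->], Hz as [Hz| ->].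
      * apply (path_clique k E y x z Oy); auto; now apply S0.
      * apply (path_related k E _ x Oy). now apply S0.
      * exfalso. apply (mem_asym _ _ L). now apply Se, S0.
      * now apply mem_irrefl in L.
  - assert (F : forall y, y ∈ k -> finite (e y)) by (intros y Hy; apply NNPP; intros Ny; eauto).
    clear N. destruct (classic (exists h, subset h k /\ independent h /\ ~ small k h)) as [(h & Sh & Ih & Nh)|N].
    { left. exists h. split; [exact Sh|split; [now apply not_small_equipotent|exact Ih]]. }
    exfalso.
    set (Q := fun s => sep k (fun y => e y = s)). assert (HQ : Fun1 Q) by (unfold Q; exact _).
    assert (SQ : forall s, subset (Q s) k) by (intros s y Hy; unfold Q in Hy; sets in Hy; tauto).
    assert (BQ : forall s, bound (Q s) ∈ k /\ subset (Q s) (bound (Q s))).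
    { intros s. destruct (small_bounded (Q s) (SQ s)) as (b & Hb & Sb); [|now apply (bound_spec _ b)].
      apply NNPP; intros Nb. apply N. exists (Q s). split; [apply SQ|split; [|exact Nb]].
      apply independent_by_order; [intros x Hx; now apply in_k_ordinal, (SQ s)|].
      intros x y Hx Hy L. unfold Q in Hx, Hy. sets in Hx. sets in Hy.
      apply (path_independent k k E Ok Skk); try tauto. unfold e in *. destruct Hx, Hy. congruence. }
    assert (level : forall n, natural n -> exists b, b ∈ k /\ forall y, y ∈ k -> equipotent (e y) n -> y ∈ b).
    { apply (natural_ind (fun n => exists b, b ∈ k /\ forall y, y ∈ k -> equipotent (e y) n -> y ∈ b)).
      - exists (bound (Q void)). split; [apply BQ|]. intros y Hy Eq. apply BQ. unfold Q. sets.
        split; [exact Hy|]. apply is_empty_eq. intros x Hx.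
        destruct (equipotent_elim _ _ Eq) as (g & _ & g1 & _). apply (in_void (g x)). auto.
      - intros n Hn (b & Hb & Kb).
        destruct (not_cofinal_bounded b k (fun x => bound (Q (adj x (e x)))) Ok (reg b Hb)) as (d & Hd & Kd).
        { intros x _. apply BQ. }
        exists d. split; [exact Hd|]. intros y Hy Eq. assert (Oy := in_k_ordinal y Hy).
        assert (Sy : subset (e y) y) by now apply (path_subset k E).
        destruct (finite_max (e y) (F y Hy)) as (x & Hx & Sx).
        { intros z Hz. apply (ordinal_mem y); auto. }
        { apply nonempty_ex. intros Z. rewrite Z in Eq. apply equipotent_sym in Eq.
          destruct (equipotent_elim _ _ Eq) as (g & _ & g1 & _). apply (in_void (g n)), g1. sets. auto. }
        assert (Kx : x ∈ k) by (apply (ordinal_trans k y); auto).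
        (* The largest element x of the path of y lies one level lower and determines that path, so
           y belongs to the bounded class of [adj x (e x)]. *)
        assert (Ex : e x = del x (e y)).
        { unfold e at 1. rewrite (path_initial k E y x Oy Hx). fold (e y).
          apply set_ext; intros z. sets. split; intros [Hz L]; (split; [exact Hz|]).
          - intros ->. now apply mem_irrefl in L.
          - apply Sx in Hz. sets in Hz. tauto. }
        assert (Hxb : x ∈ b).
        { apply Kb; [exact Kx|]. rewrite Ex.
          assert (Fd : finite (del x (e y))).
          { apply (finite_subset (e y)); [now apply F|]. intros z Hz. sets in Hz. tauto. }
          destruct (size_spec _ Fd) as [Nm Em]. set (m := size (del x (e y))) in *.
          assert (Es : equipotent (e y) (succ m)).
          { rewrite <- (adj_del (e y) x Hx). apply equipotent_adj; [sets; tauto|exact Em]. }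
          assert (Emn : succ m = succ n).
          { apply (natural_equipotent_eq (e y)); auto using natural_succ. }
          apply succ_inj in Emn. now rewrite <- Emn. }
        apply (ordinal_trans d (bound (Q (adj x (e x))))); [now apply in_k_ordinal| |now apply Kd].
        apply BQ. unfold Q. sets. split; [exact Hy|]. rewrite Ex. symmetry. now apply adj_del. }
    set (G := fun n => bound (sep k (fun y => equipotent (e y) n))).
    assert (HG : Fun1 G) by (unfold G; exact _).
    assert (G_spec : forall n, n ∈ omega -> G n ∈ k /\ forall y, y ∈ k -> equipotent (e y) n -> y ∈ G n).
    { intros n Hn. apply in_omega in Hn. destruct (level n Hn) as (b & Hb & Kb).
      destruct (bound_spec (sep k (fun y => equipotent (e y) n)) b Hb) as [H1 H2].
      - intros y Hy. sets in Hy. apply Kb; tauto.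
      - split; [exact H1|]. intros y Hy Eq. apply H2. now sets. }
    destruct (not_cofinal_bounded omega k G Ok (reg omega Hw)) as (b & Hb & Kb).
    { intros n Hn. now apply G_spec. }
    (* The point b itself lies on some level n, so it is below [G n], which is below b. *)
    destruct (F b Hb) as (n & Hn & En). apply in_omega in Hn.
    apply (mem_asym (G n) b); [now apply Kb|]. now apply G_spec.
Qed.

End Regular.
End Graphs.

(** * Singular cardinals and the partition relations *)

Section Singular.
Context {M : set_structure} {zf : ZF M}.
Implicit Types (a b c d f p q r s t x y z m n i j h u v w : M).
Variables (k mu : M) (E : M -> M -> Prop) (g : M -> M).
Hypothesis Hk : infinite_cardinal k.
Context {HE : Def2 E} {Hg : Fun1 g}.
Hypothesis E_sym : forall x y, E x y -> E y x.
Hypothesis Hmu : mu ∈ k.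
Hypothesis g_k : forall i, i ∈ mu -> g i ∈ k.
Hypothesis g_cofinal : forall b, b ∈ k -> exists i, i ∈ mu /\ subset b (g i).
Hypothesis mu_least : forall a, a ∈ mu -> ~ exists f, cofinal_map f a k.
Hypothesis cliques_finite : forall h, subset h k -> clique E h -> finite h.

Let Ok : ordinal k := k_ordinal k Hk.

Lemma singular_uncountable : omega ∈ k.
Proof.
  destruct (ordinal_le_cases omega k ordinal_omega Ok (omega_le_k k Hk)) as [L|L]; [exact L|].
  exfalso. assert (Hm := Hmu). rewrite <- L in Hm. apply in_omega in Hm.
  destruct (finite_naturals_bounded (image mu g)) as (n & Hn & Sn).
  - intros x Hx. sets in Hx. destruct Hx as (i & Hi & ->). rewrite L. now apply g_k.
  - apply (finite_image mu g). now apply finite_natural.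
  - destruct (g_cofinal n) as (i & Hi & Si); [rewrite <- L; now apply in_omega|].
    assert (K : g i ∈ n) by (apply Sn; sets; eauto). apply Si in K. now apply mem_irrefl in K.
Qed.

Section WithSmallDegrees.
Variable Y : M.
Hypothesis SY : subset Y k.
Hypothesis NY : ~ small k Y.
Hypothesis dY : forall x, x ∈ Y -> small k (sep Y (fun y => E x y)).

Definition nbrs x : M := sep Y (fun y => E x y).
(** Vertices with the same index have neighbourhoods with a common bound on their order types, as
    [small_union] requires. *)
Definition degree_index x : M := least (fun j => j ∈ mu /\ subset (idx (nbrs x) k) (g j)).
Definition E_index x y : Prop := E x y /\ degree_index x = degree_index y.

#[global] Instance definable_nbrs : DefinableFun1 nbrs.
Proof. definable_by nbrs. Qed.
#[global] Instance definable_degree_index : DefinableFun1 degree_index.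
Proof. definable_by degree_index. Qed.
#[global] Instance definable_E_index : DefinableRel2 E_index.
Proof. definable_by E_index. Qed.

Lemma nbrs_Y x : subset (nbrs x) Y.
Proof. intros y Hy. unfold nbrs in Hy. sets in Hy. tauto. Qed.

Lemma nbrs_k x : subset (nbrs x) k.
Proof. intros y Hy. now apply SY, (nbrs_Y x). Qed.

Lemma degree_index_spec x : x ∈ Y ->
  degree_index x ∈ mu /\ subset (idx (nbrs x) k) (g (degree_index x)).
Proof.
  intros Hx. destruct (g_cofinal (idx (nbrs x) k)) as (j & Hj & Sj).
  - apply (small_idx k Hk); [apply nbrs_k|]. now apply dY.
  - destruct (least_spec (fun j => j ∈ mu /\ subset (idx (nbrs x) k) (g j)) j) as (_ & K & _);
      [|auto|exact K].
    apply (ordinal_mem mu); [now apply (ordinal_mem k)|exact Hj].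
Qed.

Definition below y : M := path Y E_index y.

#[global] Instance definable_below : DefinableFun1 below.
Proof. definable_by below. Qed.

Lemma Y_ordinal y : y ∈ Y -> ordinal y.
Proof. intros H. apply (ordinal_mem k); [exact Ok|now apply SY]. Qed.

Lemma below_finite y : y ∈ Y -> finite (below y).
Proof.
  intros Hy. assert (Oy := Y_ordinal y Hy).
  assert (SB := path_subset_Y Y E_index y Oy). fold (below y) in SB.
  apply cliques_finite.
  - intros x Hx. now apply SY, SB.
  - apply clique_by_order; [exact E_sym| |].
    + intros x Hx. now apply Y_ordinal, SB.
    + intros x z Hx Hz L. now apply (path_clique Y E_index y x z Oy Hx Hz L).
Qed.

Definition class y : M := sep Y (fun z => below z = below y /\ degree_index z = degree_index y).

#[global] Instance definable_class : DefinableFun1 class.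
Proof. definable_by class. Qed.

Lemma in_class y z : z ∈ class y <-> z ∈ Y /\ below z = below y /\ degree_index z = degree_index y.
Proof. unfold class. sets. reflexivity. Qed.
Opaque class.

Lemma below_subset y : y ∈ Y -> subset (below y) (cap Y y).
Proof.
  intros Hy x Hx. apply in_cap. split.
  - exact (path_subset_Y Y E_index y (Y_ordinal y Hy) x Hx).
  - exact (path_subset Y E_index y (Y_ordinal y Hy) x Hx).
Qed.

Lemma class_independent y : independent E (class y).
Proof.
  apply independent_by_order; [exact E_sym| |].
  - intros x Hx. apply in_class in Hx. apply Y_ordinal, Hx.
  - intros x z Hx Hz L K. apply in_class in Hx. apply in_class in Hz.
    destruct Hx as (H1 & H2 & H3), Hz as (K1 & K2 & K3).
    apply (path_independent k Y E_index Ok SY x z H1 K1); [|exact L|].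
    + unfold below in *. congruence.
    + split; [exact K|congruence].
Qed.
Opaque below.

(* If all classes had order type below d outside the small set u, then the
   points of Y would be coded in an ordinal below k. *)
Lemma large_class u d : subset u Y -> small k u -> d ∈ k ->
  exists y, y ∈ Y /\ y ∉ u /\ subset d (idx (diff (class y) u) y).
Proof.
  intros Su Hu Hd. apply NNPP; intros N.
  assert (B : forall y, y ∈ Y -> y ∉ u -> idx (diff (class y) u) y ∈ d).
  { intros y Hy Ny. destruct (ordinal_le_or_lt d (idx (diff (class y) u) y)) as [L|L]; [| | |exact L].
    - now apply (k_mem_ordinal k Hk).
    - apply idx_ordinal. now apply Y_ordinal.
    - exfalso. eauto. }
  assert (Suk : subset u k) by (intros x Hx; now apply SY, Su).
  assert (Hi := proj1 (small_idx k Hk u Suk) Hu).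
  destruct (max_in_k k Hk omega mu singular_uncountable Hmu) as (d1 & Hd1 & S1 & S2).
  destruct (max_in_k k Hk d (idx u k) Hd Hi) as (d2 & Hd2 & S3 & S4).
  destruct (max_in_k k Hk d1 d2 Hd1 Hd2) as (th & Hth & S5 & S6).
  assert (Oth := k_mem_ordinal k Hk th Hth).
  assert (Ith : ~ finite th).
  { intros F. apply omega_infinite. apply (finite_subset th); [exact F|]. intros x Hx. auto. }
  destruct (coding_functions th Oth Ith) as (J & J2 & _ & HJ2 & _ & _ & J21 & J2i).
  set (l := fun y => ite (y ∈ u) (idx u y) (idx (diff (class y) u) y)).
  assert (Hl : Fun1 l) by (unfold l; exact _).
  (* The parameter of y: a bit for membership in u, the degree index, and the position in u or in
     the class outside u. *)
  set (c := fun y => J2 (ite (y ∈ u) void (succ void)) (J2 (degree_index y) (l y))).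
  assert (Hc : Fun1 c) by (unfold c; exact _).
  assert (b01 : forall y, ite (y ∈ u) void (succ void) ∈ th).
  { intros y. apply S5, S1, in_omega. destruct (classic (y ∈ u)) as [K|K].
    - rewrite ite_true by exact K. exact natural_void.
    - rewrite ite_false by exact K. apply natural_succ, natural_void. }
  assert (l_th : forall y, y ∈ Y -> l y ∈ th).
  { intros y Hy. unfold l. destruct (classic (y ∈ u)) as [K|K].
    - rewrite ite_true by exact K. apply S6, S4, idx_lt; [exact Ok|exact K|now apply SY].
    - rewrite ite_false by exact K. now apply S6, S3, B. }
  assert (j_th : forall y, y ∈ Y -> degree_index y ∈ th).
  { intros y Hy. apply S5, S2. now apply degree_index_spec. }
  apply NY. exists th. split; [exact Hth|].
  apply (embeds_by_code th Y (fun y => cap Y y) below c); [exact Oth|exact Ith| | | |].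
  - intros p q Hp Hq. sets in Hq. destruct Hq as [Hq L]. split; [exact Hq|].
    intros x Hx. sets in Hx. sets. split; [tauto|]. apply (ordinal_trans p q); [now apply Y_ordinal|tauto|exact L].
  - intros s Hs Ns. destruct (ordinal_wf s) as (p & Hp & Kp); [|exact Ns|].
    + intros p Hp. now apply Y_ordinal, Hs.
    + exists p. split; [exact Hp|]. intros q Hq K. sets in K. now apply (Kp q).
  - intros y Hy. split; [now apply below_finite|split].
    + now apply below_subset.
    + unfold c. apply J21; [apply b01|]. apply J21; auto.
  - intros y y' Hy Hy' E1 E2. unfold c in E2.
    apply J2i in E2; [|now apply b01|apply J21; auto|now apply b01|apply J21; auto].
    destruct E2 as [E2 E3]. apply J2i in E3; auto. destruct E3 as [E3 E4]. unfold l in E4.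
    assert (N01 : void <> (succ void : M)).
    { intros K. apply (in_void void). rewrite K at 2. sets. auto. }
    assert (O := Y_ordinal y Hy). assert (O' := Y_ordinal y' Hy').
    destruct (classic (y ∈ u)) as [K|K], (classic (y' ∈ u)) as [K'|K'].
    + rewrite !ite_true in E4 by assumption. now apply idx_inj in E4.
    + rewrite ite_true, ite_false in E2 by assumption. contradiction.
    + rewrite ite_false, ite_true in E2 by assumption. symmetry in E2. contradiction.
    + rewrite !ite_false in E4 by assumption.
      assert (EC : class y = class y') by (apply set_ext; intros z; rewrite !in_class, E1, E3; reflexivity).
      assert (C1 : y ∈ diff (class y') u).
      { apply in_diff. split; [|exact K]. apply in_class. split; [exact Hy|split; [exact E1|exact E3]]. }
      assert (C2 : y' ∈ diff (class y') u).
      { apply in_diff. split; [|exact K']. apply in_class.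
        split; [exact Hy'|split; [exact eq_refl|exact eq_refl]]. }
      rewrite EC in E4. exact (idx_inj _ y y' O O' C1 C2 E4).
Qed.

Definition pick u d : M := least (fun y => y ∈ Y /\ y ∉ u /\ subset d (idx (diff (class y) u) y)).
(** Cutting the class at the picked point keeps the piece small, which makes its set of neighbours
    small too. *)
Definition piece u d : M := cap (diff (class (pick u d)) u) (pick u d).
Definition nbrs_of s : M := bigcup (image s nbrs).
(** Independent sets of lengths at least [g i], each avoiding all neighbours of the earlier ones, so
    that their union is independent. *)
Definition pieces i : M :=
  wfrec (fun b => b)
    (fun b f => piece (bigcup (image b (fun i => nbrs_of (ap f i)))) (g b)) i.
Definition used i : M := bigcup (image i (fun j => nbrs_of (pieces j))).

#[global] Instance definable_pick : DefinableFun2 pick.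
Proof. definable_by pick. Qed.
#[global] Instance definable_piece : DefinableFun2 piece.
Proof. definable_by piece. Qed.
#[global] Instance definable_nbrs_of : DefinableFun1 nbrs_of.
Proof. definable_by nbrs_of. Qed.
#[global] Instance definable_pieces : DefinableFun1 pieces.
Proof. definable_by pieces. Qed.
#[global] Instance definable_used : DefinableFun1 used.
Proof. definable_by used. Qed.

Lemma in_nbrs_of s y : y ∈ nbrs_of s <-> y ∈ Y /\ exists x, x ∈ s /\ E x y.
Proof.
  unfold nbrs_of. sets. split.
  - intros (w & Hw & Hy). sets in Hw. destruct Hw as (x & Hx & ->). unfold nbrs in Hy.
    sets in Hy. split; [tauto|]. exists x. tauto.
  - intros (Hy & x & Hx & K). exists (nbrs x). sets. split; [eauto|]. unfold nbrs. now sets.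
Qed.

Lemma pieces_eq i : ordinal i -> pieces i = piece (used i) (g i).
Proof.
  intros Hi. unfold pieces.
  rewrite (wfrec_eq ordinal (fun b => b) _ ordinal_pr ordinal_wf i Hi). fold pieces.
  f_equal. unfold used. f_equal. apply set_ext; intros v. sets.
  split; intros (j & Hj & ->); exists j; rewrite ap_graph by (exact _ || exact Hj); auto.
Qed.

Lemma piece_spec u d : subset u Y -> small k u -> d ∈ k ->
  subset (piece u d) Y /\ (forall x, x ∈ piece u d -> x ∉ u) /\ independent E (piece u d) /\
  subset d (idx (piece u d) k) /\ small k (nbrs_of (piece u d)).
Proof.
  intros Su Hu Hd. destruct (large_class u d Su Hu Hd) as (y0 & Hy0 & Ny0 & Sy0).
  destruct (least_spec (fun y => y ∈ Y /\ y ∉ u /\ subset d (idx (diff (class y) u) y)) y0)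
    as (_ & (Py & Ny & Sd) & _); [now apply Y_ordinal|auto|].
  fold (pick u d) in Py, Ny, Sd. set (y := pick u d) in *.
  assert (Oy := Y_ordinal y Py).
  assert (in_piece : forall x, x ∈ piece u d -> x ∈ class y /\ x ∉ u /\ x ∈ y).
  { intros x Hx. unfold piece in Hx. fold y in Hx. sets in Hx. tauto. }
  assert (SP : subset (piece u d) Y).
  { intros x Hx. apply in_piece in Hx as (Hx & _). apply in_class in Hx. apply Hx. }
  split; [exact SP|split; [|split; [|split]]].
  - intros x Hx. now apply in_piece.
  - intros x z Hx Hz. apply in_piece in Hx. apply in_piece in Hz. apply (class_independent y); tauto.
  - intros v Hv. apply Sd in Hv. apply (idx_mono_r _ y k Ok Oy); [now apply ordinal_subset; auto|].
    unfold piece. fold y. rewrite (idx_ext _ (diff (class y) u) y Oy); [exact Hv|].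
    intros x Hx. sets. tauto.
  - apply (small_union k Hk (piece u d) nbrs (g (degree_index y))).
    + apply (small_subset k _ y); [intros x Hx; now apply in_piece|]. now apply small_mem, SY.
    + now apply g_k, degree_index_spec.
    + intros x Hx. split; [apply nbrs_k|]. apply in_piece in Hx as (Hx & _).
      apply in_class in Hx as (Hx & _ & <-). now apply degree_index_spec.
Qed.

Lemma used_subset i : subset (used i) Y.
Proof.
  intros x Hx. unfold used in Hx. sets in Hx. destruct Hx as (w & Hw & Hx). sets in Hw.
  destruct Hw as (j & Hj & ->). now apply in_nbrs_of in Hx.
Qed.

(** For i below mu the neighbourhoods of the earlier pieces have order types bounded below k,
    because mu is the least ordinal with a cofinal map. *)
Lemma used_small i : i ∈ mu -> small k (used i).
Proof.
  assert (Omu : ordinal mu) by now apply (ordinal_mem k).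
  intros Hi. assert (Oi := ordinal_mem mu i Omu Hi). revert i Oi Hi.
  apply (ordinal_ind (fun i => i ∈ mu -> small k (used i))).
  intros i Oi IH Hi.
  assert (K : forall j, j ∈ i -> small k (nbrs_of (pieces j))).
  { intros j Hj. assert (Hj' : j ∈ mu) by now apply (ordinal_trans mu i).
    rewrite pieces_eq by now apply (ordinal_mem i).
    apply piece_spec; [apply used_subset|now apply IH|now apply g_k]. }
  assert (S : forall j, subset (nbrs_of (pieces j)) k).
  { intros j x Hx. apply in_nbrs_of in Hx. now apply SY. }
  destruct (not_cofinal_bounded i k (fun j => idx (nbrs_of (pieces j)) k) Ok (mu_least i Hi)) as (d & Hd & Kd).
  { intros j Hj. apply (small_idx k Hk); auto. }
  unfold used. apply (small_union k Hk i (fun j => nbrs_of (pieces j)) d); [|exact Hd|].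
  - apply small_mem. now apply (ordinal_trans k mu).
  - intros j Hj. split; [apply S|]. apply ordinal_subset; [now apply (ordinal_mem k)|auto].
Qed.

Lemma singular_independent : exists h, subset h k /\ ~ small k h /\ independent E h.
Proof.
  assert (Omu : ordinal mu) by now apply (ordinal_mem k).
  assert (P : forall i, i ∈ mu -> subset (pieces i) Y /\ (forall x, x ∈ pieces i -> x ∉ used i) /\
    independent E (pieces i) /\ subset (g i) (idx (pieces i) k)).
  { intros i Hi. rewrite pieces_eq by now apply (ordinal_mem mu).
    destruct (piece_spec (used i) (g i) (used_subset i) (used_small i Hi) (g_k i Hi)) as (H1 & H2 & H3 & H4 & _).
    auto. }
  set (h := bigcup (image mu pieces)).
  assert (in_h : forall x, x ∈ h <-> exists i, i ∈ mu /\ x ∈ pieces i).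
  { intros x. unfold h. sets. split.
    - intros (w & Hw & Hx). sets in Hw. destruct Hw as (i & Hi & ->). eauto.
    - intros (i & Hi & Hx). exists (pieces i). sets. eauto. }
  assert (Sh : subset h k).
  { intros x Hx. apply in_h in Hx. destruct Hx as (i & Hi & Hx). now apply SY, (P i Hi). }
  exists h. split; [exact Sh|split].
  - intros K. apply (small_idx k Hk h Sh) in K.
    (* The successor makes [g i] exceed the order type of h, whereas the i-th piece, a subset of h,
       has type at least [g i]. *)
    destruct (g_cofinal _ (k_succ k Hk _ K)) as (i & Hi & Si).
    apply (mem_irrefl (idx h k)). apply (idx_mono (pieces i) h k).
    + intros x Hx. apply in_h. eauto.
    + exact Ok.
    + apply (P i Hi), Si. sets. auto.
  - assert (L : forall i j x y, i ∈ mu -> j ∈ mu -> i ∈ j -> x ∈ pieces i -> y ∈ pieces j -> ~ E x y).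
    { intros i j x y Hi Hj L Hx Hy K. destruct (P j Hj) as (SP & NP & _). apply (NP y Hy).
      unfold used. sets. exists (nbrs_of (pieces i)). sets. split; [exists i; split; [exact L|reflexivity]|].
      apply in_nbrs_of. split; [exact (SP y Hy)|]. exists x. split; [exact Hx|exact K]. }
    intros x y Hx Hy N K. apply in_h in Hx. apply in_h in Hy.
    destruct Hx as (i & Hi & Hx). destruct Hy as (j & Hj & Hy).
    destruct (ordinal_trichotomy i j) as [H|[H|H]]; try now apply (ordinal_mem mu).
    + now apply (L i j x y).
    + subst j. now apply (proj1 (proj2 (proj2 (P i Hi))) x y).
    + apply (L j i y x); auto.
Qed.

End WithSmallDegrees.
End Singular.

Section Arrow.
Context {M : set_structure} {zf : ZF M}.
Implicit Types (a b c d f p q r s t x y z m n i j h u v w : M).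

Theorem arrow_omega_graph k (E : M -> M -> Prop) {HE : Def2 E} : infinite_cardinal k ->
  (forall x y, E x y -> E y x) ->
  (exists h, subset h k /\ equipotent h k /\ independent E h) \/
  (exists h, subset h k /\ has_order_type h omega /\ clique E h).
Proof.
  intros Hk E_sym. assert (Ok := k_ordinal k Hk).
  assert (C0 : exists f, cofinal_map f k k).
  { exists (graph k (fun x => x)). split; [apply graph_function; auto; exact _|].
    intros b Hb. exists b, b. rewrite app_graph by exact _. auto. }
  destruct (least_exists (fun a => exists f, cofinal_map f a k) k Ok C0) as (mu & Omu & (f & Hf & Cf) & Lmu).
  destruct (classic (mu ∈ k)) as [Hmu|Hmu].
  - destruct (classic (exists h, subset h k /\ clique E h /\ ~ finite h)) as [(h & Sh & Ch & Fh)|N].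
    { right. now apply (infinite_clique k E Hk h). }
    left. assert (cf : forall h, subset h k -> clique E h -> finite h).
    { intros h Sh Ch. apply NNPP; intros Fh. eauto. }
    destruct (small_degree_set k E Hk E_sym cf) as (Y & SY & NY & dY).
    destruct (singular_independent k mu E (ap f) Hk E_sym Hmu) with (Y := Y) as (h & Sh & Nh & Ih); auto.
    + intros i Hi. now apply (app_ap f mu k).
    + intros b Hb. destruct (Cf b Hb) as (x & y & Hx & Hxy & L). exists x. split; [exact Hx|].
      destruct (ap_of_app f mu k x y Hf Hxy) as (_ & Hy & ->). destruct L as [-> |L].
      * intros z; auto.
      * apply ordinal_subset; [now apply (ordinal_mem k)|exact L].
    + exists h. split; [exact Sh|split; [now apply not_small_equipotent|exact Ih]].
  (* No ordinal below k has a cofinal map into k here; this case includes k = omega. *)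
  - apply (regular_arrow_omega k E Hk E_sym). intros a Ha. apply Lmu.
    exact (not_lt_le k mu Ok Omu Hmu a Ha).
Qed.

Lemma arrow_of_graphs k v : 
  (forall E : M -> M -> Prop, Def2 E -> (forall x y, E x y -> E y x) ->
    (exists h, subset h k /\ equipotent h k /\ independent E h) \/
    (exists h, subset h k /\ has_order_type h v /\ clique E h)) ->
  arrow k v.
Proof.
  intros H zero one two s f Hz (z & Ez & E1) (o & (z' & Ez' & E1') & E2) Hs Hf.
  apply is_empty_eq in Hz, Ez, Ez'. subst zero z z'.
  apply is_succ_eq in E1, E1', E2. subst o one two.
  assert (value : forall p, p ∈ s -> app f p void \/ app f p (succ void)).
  { intros p Hp. destruct (app_ap f s (succ (succ void)) p Hf Hp) as [A B].
    sets in B. destruct B as [[B|B]|B]; [contradiction| |]; rewrite B in A; auto. }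
  assert (comm : forall x y, upair x y = upair y x).
  { intros x y. apply set_ext; intros z. sets. tauto. }
  destruct (H (fun x y => x <> y /\ app f (upair x y) (succ void))) as [(h & Sh & Q & I)|(h & Sh & Q & C)].
  - exact _.
  - intros x y [N A]. rewrite comm. auto.
  - left. exists h. split; [exact Sh|split; [exact Q|]].
    intros p (x & y & Hx & Hy & N & Ep). apply is_upair_eq in Ep. subst p.
    destruct (value (upair x y)) as [A|A]; [|exact A|].
    + apply Hs. exists x, y. rewrite is_upair_eq. auto.
    + exfalso. apply (I x y); auto.
  - right. exists h. split; [exact Sh|split; [exact Q|]].
    intros p (x & y & Hx & Hy & N & Ep). apply is_upair_eq in Ep. subst p.
    now apply (C x y).
Qed.

Theorem arrow_omega k : infinite_cardinal k -> arrow k omega.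
Proof.
  intros Hk. apply arrow_of_graphs. intros E HE E_sym. now apply arrow_omega_graph.
Qed.

Theorem arrow_omega_1 k : regular k -> omega ∈ k -> arrow k (succ omega).
Proof.
  intros [Hk (_ & _ & reg)] Hw. apply arrow_of_graphs. intros E HE E_sym.
  now apply (regular_arrow_omega_1 k E Hk E_sym).
Qed.

End Arrow.

(** At kappa = omega the arrow to omega + 1 fails for the constant colouring 1, and the set mapping
    that takes n to the set n has no free set with two elements. Hence the two hypotheses
    [omega ∈ kappa]. *)
Theorem theorem4p2 (M : set_structure) (zf : ZF M)
    (omega omega_plus_1 kappa : M)
    (homega : is_omega omega) (homega_plus_1 : is_succ omega_plus_1 omega)
    (hkappa : infinite_cardinal kappa) :
  arrow kappa omega /\
  (regular kappa -> omega ∈ kappa -> arrow kappa omega_plus_1) /\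
  (omega ∈ kappa -> Free kappa omega kappa) /\
  FreeUnion kappa omega omega /\
  (forall n : M, n ∈ omega -> M_to_B kappa omega n).
Proof.
  apply is_omega_eq in homega. subst omega. apply is_succ_eq in homega_plus_1. subst omega_plus_1.
  split; [now apply arrow_omega|].
  split; [now apply arrow_omega_1|].
  split; [now apply Free_uncountable|].
  split; [now apply FreeUnion_omega|].
  intros n Hn. apply property_B_almost_disjoint; [exact (k_ordinal kappa hkappa)|now apply in_omega].
Qed.
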